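(* Let $S$ be a closed oriented surface of genus at least $2$, $\rho:\pi_1S\to\mathrm{SL}(3,\mathbb{R})$ Hitchin with invariant convex domain $\Omega\subset\mathbb{RP}^2$, and let $\eta:\pi_1S\to\mathrm{SAff}^*(3,\mathbb{R})$ be non-semi-simple with linear part $\rho$, with bending lamination $\tilde\lambda\subset\Omega$ on $\partial^+\Xi_\eta$ and bending cocycle $\psi$. Let $d_{\mathbb P}$ be any auxiliary Riemannian metric on the projective plane $\mathbb{P}((\mathbb{R}^3)^* )$. There is an $a\in(0,1)$ such that when $k$ is an arc transverse to $\tilde\lambda$ and $\ell_x$ is a leaf of $\tilde\lambda$ intersecting $k$ non-trivially, then $$d_{\mathbb P}\big([\psi(k)],\ell_x\big)=O\big((\operatorname{diam}k)^a\big),$$ where $\ell_x$ is regarded as the point of $\mathbb{P}((\mathbb{R}^3)^* )$ dual to the projective line containing it. Additionally, there exists a proper positive convex cone $\mathscr E\subset\mathrm{TAff}^*(3,\mathbb{R})\cong(\mathbb{R}^3)^*$ (depending on $k$) so that $\psi(k')\in\mathscr E$ for all subarcs $k'$ of $k$.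
   Context: $\rho$ Hitchin: $\rho$ preserves a properly and strictly convex $C^1$ domain $\Omega\subset\mathbb{RP}^2$, acting properly discontinuously with $\Omega/\rho\cong S$ compact. $\mathrm{SAff}^*(3,\mathbb{R})=\left\{\begin{pmatrix}A&\mathbf 0\\ \tau&1\end{pmatrix}:A\in\mathrm{SL}(3,\mathbb{R}),\tau\in(\mathbb{R}^3)^*\right\}$; the linear part is $A$; $\mathrm{TAff}^*(3,\mathbb{R})$ is the subgroup with $A=I$, identified with $(\mathbb{R}^3)^*=\{\alpha\in(\mathbb{R}^4)^*:\alpha(e_4)=0\}$. $\eta$ is semi-simple if it preserves a hyperplane in $\mathbb{RP}^3$. $\eta$ is $1$-Anosov with limit curve in $\partial\mathscr C\Omega\setminus\{[e_4]\}$, where $\mathscr C\Omega=[Q]^{-1}(\Omega)$, $[Q]:\mathbb{RP}^3\setminus\{[e_4]\}\to\mathbb{P}(\mathbb{R}^4/\langle e_4\rangle)=\mathbb{RP}^2$. $\Xi_\eta$ is the convex hull (in an affine chart containing $\mathscr C\Omega$) of the limit curve minus the curve. $\partial\Xi_\eta$ minus the limit curve is a union of two disks, each projecting homeomorphically to $\Omega$ under $[Q]$; $\partial^+\Xi_\eta$ is one of them, and $q^+:\Omega\to\partial^+\Xi_\eta$ is the inverse of $[Q]$. The bending lamination $\tilde\lambda\subset\Omega$ is the $[Q]$-image of the union of open one-dimensional faces in $\partial^+\Xi_\eta$; it is a $\pi_1S$-invariant geodesic lamination (closed set foliated by projective segments inextensible in $\Omega$, its leaves). For $x\in\Omega\setminus\tilde\lambda$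 let $\alpha(x)\in(\mathbb{R}^4)^*$ be the unique functional with $\alpha(x)(e_4)=1$ whose kernel is the supporting hyperplane to $\Xi_\eta$ at $q^+(x)$. The bending cocycle is $\psi(k)=\alpha(k(1))-\alpha(k(0))\in(\mathbb{R}^3)^*$, defined for an arc $k:[0,1]\to\Omega$ with endpoints not in $\tilde\lambda$ (so arcs and subarcs to which $\psi$ is applied have endpoints off $\tilde\lambda$). An arc transverse to $\tilde\lambda$ is a $C^1$ arc transverse to the leaves. Diameters are measured with respect to the lift to $\Omega\cong\widetilde S$ of a hyperbolic metric on $S$. A convex cone is proper if its closure contains no line, and positive means closed under multiplication by positive scalars.
   Formalization: The cone is claimed only for transverse arcs crossing each leaf at most once (arcs that recross a leaf have subarcs with opposite cocycles); the estimate assumes ψ(k) ≠ 0, proved for arcs crossing a leaf and none twice, and its O-constant is uniform over arcs in each compact subset of Ω. *)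

(* Defs.v *)
From HB Require Import structures.
From mathcomp Require Import all_boot all_order all_algebra.
From mathcomp Require Import all_classical all_reals all_analysis.

Set Implicit Arguments.
Unset Strict Implicit.
Unset Printing Implicit Defensive.

Import Order.TTheory GRing.Theory Num.Theory.
Import numFieldNormedType.Exports.

Local Open Scope classical_set_scope.
Local Open Scope ring_scope.

(** * Closed orientable surfaces and fundamental groups *)

Section Surface.
Context {R : realType}.

Definition circle_pt (t : R) : R * R := (cos (2 * pi * t), sin (2 * pi * t)).

(* The boundary circle of the unit disk is cut into 4g edges, read along the
   word a_0 b_0 a_0^-1 b_0^-1 a_1 b_1 ...; [glue g] is the equivalence relation
   generated by the side pairings. *)
Inductive glue (g : nat) : R * R -> R * R -> Prop :=
| glue_edge (i e : nat) (s : R) : (i < g)%N -> (e < 2)%N -> 0 <= s <= 1 ->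
    glue g (circle_pt (((4 * i + e)%:R + s) / (4 * g)%:R))
           (circle_pt (((4 * i + e + 2)%:R + (1 - s)) / (4 * g)%:R))
| glue_refl x : glue g x x
| glue_sym x y : glue g x y -> glue g y x
| glue_trans x y z : glue g x y -> glue g y z -> glue g x z.

Definition unit_disk : set (R * R) := [set z | z.1 ^+ 2 + z.2 ^+ 2 <= 1].

(* For g > 0: S is the 4g-gon with its sides glued.  The disk being compact and
   S Hausdorff, the continuous surjection p is a quotient map. *)
Definition closed_orientable_surface (g : nat) (S : topologicalType) : Prop :=
  hausdorff_space S /\
  exists p : R * R -> S,
    [/\ {within unit_disk, continuous p},
        p @` unit_disk = setT &
        forall z w, unit_disk z -> unit_disk w -> (p z = p w <-> glue g z w)].

Context {S : topologicalType}.

Definition loop (s0 : S) (l : R -> S) : Prop :=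
  [/\ {within `[0, 1], continuous l}, l 0 = s0 & l 1 = s0].

Definition loop_homotopic (s0 : S) (l l' : R -> S) : Prop :=
  exists H : R * R -> S,
    [/\ {within `[0, 1] `*` `[0, 1], continuous H},
        forall t, 0 <= t <= 1 -> H (t, 0) = l t /\ H (t, 1) = l' t &
        forall u, 0 <= u <= 1 -> H (0, u) = s0 /\ H (1, u) = s0].

Definition loop_concat (l l' : R -> S) : R -> S :=
  fun t => if t <= 2^-1 then l (2 * t) else l' (2 * t - 1).

(* [cls] induces an isomorphism from pi_1(S, s0) onto G. *)
Definition fundamental_group (s0 : S) (G : groupType) (cls : (R -> S) -> G) :
    Prop :=
  [/\ forall x : G, exists2 l, loop s0 l & cls l = x,
      forall l l', loop s0 l -> loop s0 l' ->
        (cls l = cls l' <-> loop_homotopic s0 l l') &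
      forall l l', loop s0 l -> loop s0 l' ->
        cls (loop_concat l l') = (cls l * cls l')%g].

End Surface.

(** * Calculus *)

Section Calculus.
Context {R : realType}.

(* g is C^k on the open set U *)
Fixpoint Ck (k : nat) (m n : nat) (U : set 'M[R]_(m, n))
    (g : 'M[R]_(m, n) -> R) : Prop :=
  if k is k'.+1 then
    (forall x, U x -> differentiable g x) /\
    forall i j, Ck k' U (fun x => 'D_(delta_mx i j) g x)
  else forall x, U x -> {for x, continuous g}.

Definition smooth m n (U : set 'M[R]_(m, n)) (g : 'M[R]_(m, n) -> R) : Prop :=
  forall k, Ck k U g.

(* Every C^1 map on [0, 1] (with one-sided derivatives at 0 and 1) is the
   restriction of such a c. *)
Definition C1_path m n (c : R -> 'M[R]_(m, n)) : Prop :=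
  (forall t, 0 <= t <= 1 -> derivable c t 1) /\
  {within `[0, 1], continuous (derive1 c)}.

Definition convex_hull m n (A : set 'M[R]_(m, n)) : set 'M[R]_(m, n) :=
  \bigcap_(B in [set B : set 'M[R]_(m, n) | convex_set B /\ A `<=` B]) B.

End Calculus.

(** * Projective geometry

   A point of a projective space is given by a nonzero vector, and a subset of
   it by the set of all nonzero vectors representing its points. *)

Section Projective.
Context {R : realType}.

Definition ev n (a : 'rV[R]_n) (v : 'cV[R]_n) : R := (a *m v) 0 0.

Definition same_pt m n (u v : 'M[R]_(m, n)) : Prop :=
  exists t : R, t != 0 /\ v = t *: u.

Definition projective_set n (X : set 'cV[R]_n) : Prop :=
  (forall v, X v -> v != 0) /\
  (forall (t : R) v, t != 0 -> X v -> X (t *: v)).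

(* topological boundary, in the projective space, of an open projective set *)
Definition proj_boundary n (X : set 'cV[R]_n) : set 'cV[R]_n :=
  [set v | [/\ v != 0, closure X v & ~ X v]].

(* orthogonal projector on the line of v: it embeds the projective space, with
   its topology, in the space of matrices *)
Definition line_projector n (v : 'cV[R]_n) : 'M[R]_n :=
  ((v^T *m v) 0 0)^-1 *: (v *m v^T).

(* the affine chart {f <> 0} contains the closure of X *)
Definition chart_of n (X : set 'cV[R]_n) (f : 'rV[R]_n) : Prop :=
  forall v, closure X v -> v != 0 -> ev f v != 0.

(* X in the affine chart {f <> 0}, identified with the affine space {f = 1} *)
Definition in_chart n (f : 'rV[R]_n) (X : set 'cV[R]_n) : set 'cV[R]_n :=
  [set v | X v /\ ev f v = 1].

Definition properly_convex n (X : set 'cV[R]_n) : Prop :=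
  exists f, chart_of X f /\ convex_set (in_chart f X).

Definition strictly_convex n (X : set 'cV[R]_n) : Prop :=
  forall v w, proj_boundary X v -> proj_boundary X w -> ~ same_pt v w ->
    ~ (forall a b : R, 0 < a -> 0 < b -> proj_boundary X (a *: v + b *: w)).

Definition C1_boundary n (X : set 'cV[R]_n) : Prop :=
  forall p, proj_boundary X p ->
    exists (U : set 'cV[R]_n) (F : 'cV[R]_n -> R),
      [/\ open U, U p, Ck 1 U F, exists u, 'D_u F p != 0 &
          forall v, U v -> (X v <-> 0 < F v)].

(* [v] is the attracting fixed point of the proximal map g *)
Definition attracting_fixpoint n (g : 'M[R]_n.+1) (v : 'cV[R]_n.+1) : Prop :=
  v != 0 /\
  exists (l : R) (b : 'rV[R]_n.+1),
    [/\ l != 0, b != 0 &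
        (fun m : nat => l ^- m *: (g ^+ m)) @ \oo --> v *m b].

End Projective.

(** * Representations *)

Section Representations.
Context {R : realType} {G : groupType}.

Definition is_representation n (r : G -> 'M[R]_n) : Prop :=
  r 1%g = 1%:M /\ forall x y, r (x * y)%g = r x *m r y.

(* rho preserves the properly and strictly convex C^1 domain X, acting properly
   discontinuously with X / rho homeomorphic to S *)
Definition Hitchin (S : topologicalType) (rho : G -> 'M[R]_3)
    (X : set 'cV[R]_3) : Prop :=
  [/\ [/\ projective_set X, open X & X !=set0],
      [/\ properly_convex X, strictly_convex X & C1_boundary X],
      forall x v, X v -> X (rho x *m v),
      forall K, compact K -> K `<=` X ->
        finite_set [set x | exists v (t : R),
          [/\ K v, t != 0 & K (t *: (rho x *m v))]] &
      exists p : 'cV[R]_3 -> S,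
        [/\ forall v, X v -> {for v, continuous p},
            forall U, open U -> U `<=` X -> open (p @` U),
            p @` X = setT &
            forall v w, X v -> X w ->
              (p v = p w <-> exists x, same_pt (rho x *m v) w)]].

Definition SAff (M : 'M[R]_(3 + 1)) : Prop :=
  [/\ \det (ulsubmx M) = 1, ursubmx M = 0 & drsubmx M = 1%:M].

Definition linear_part (eta : G -> 'M[R]_(3 + 1)) : G -> 'M[R]_3 :=
  fun x => ulsubmx (eta x).

Definition semi_simple (eta : G -> 'M[R]_(3 + 1)) : Prop :=
  exists b : 'rV[R]_(3 + 1),
    b != 0 /\ forall x, exists c : R, b *m eta x = c *: b.

End Representations.

(** * The convex hull of the limit curve and its bending lamination *)

Section Bending.
Context {R : realType} {G : groupType}.
Variables (eta : G -> 'M[R]_(3 + 1)) (X : set 'cV[R]_3).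
Let rho := linear_part eta.

Definition e4 : 'cV[R]_(3 + 1) := col_mx 0 1%:M.

(* the projection R^4 -> R^4 / <e4> = R^3 *)
Definition Q (w : 'cV[R]_(3 + 1)) : 'cV[R]_3 := usubmx w.

(* The Anosov limit map, the boundary of G being identified with the boundary
   of X: it is the only continuous equivariant map which is dynamics preserving. *)
Definition limit_map (xi : 'cV[R]_3 -> 'cV[R]_(3 + 1)) : Prop :=
  [/\ forall v, proj_boundary X v -> xi v != 0,
      forall (t : R) v, t != 0 -> proj_boundary X v ->
        same_pt (xi v) (xi (t *: v)),
      {within proj_boundary X, continuous (fun v => line_projector (xi v))},
      forall x v, proj_boundary X v ->
        same_pt (eta x *m xi v) (xi (rho x *m v)) &
      forall x v, proj_boundary X v -> attracting_fixpoint (rho x) v ->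
        attracting_fixpoint (eta x) (xi v)].

Definition limit_curve : set 'cV[R]_(3 + 1) :=
  [set w | exists xi v,
    [/\ limit_map xi, proj_boundary X v & same_pt (xi v) w]].

(* From now on one works in the affine chart {f o Q <> 0} of RP^3, identified
   with {f o Q = 1}.  If f satisfies [chart_of X f], this chart contains
   [Q]^-1(X) and the limit curve. *)
Variable f : 'rV[R]_3.

Definition chart4 : set 'cV[R]_(3 + 1) := [set w | ev f (Q w) = 1].

Definition Xi : set 'cV[R]_(3 + 1) :=
  convex_hull (limit_curve `&` chart4) `\` limit_curve.

(* the boundary of Xi minus the limit curve *)
Definition Xi_boundary : set 'cV[R]_(3 + 1) :=
  (closure Xi `&` closure (chart4 `\` Xi)) `\` limit_curve.

(* The two disks forming [Xi_boundary] are its connected components. *)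
Definition Xi_boundary_disk (D : set 'cV[R]_(3 + 1)) : Prop :=
  exists2 y, Xi_boundary y & D = connected_component Xi_boundary y.

(* F is the open face of y in Xi *)
Definition open_face (y : 'cV[R]_(3 + 1)) : set 'cV[R]_(3 + 1) :=
  [set z | z = y \/ exists a b (s t : R),
    [/\ Xi a, Xi b, 0 < s < 1, 0 < t < 1 &
        y = (1 - s) *: a + s *: b /\ z = (1 - t) *: a + t *: b]].

Definition one_dimensional (F : set 'cV[R]_(3 + 1)) : Prop :=
  exists y u, [/\ F y, u != 0,
    forall z, F z -> exists c : R, z = y + c *: u &
    exists2 z, F z & z <> y].

Variable D : set 'cV[R]_(3 + 1).

Definition leaf (L : set 'cV[R]_3) : Prop :=
  exists y, [/\ D y, open_face y `<=` D, one_dimensional (open_face y) &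
                L = Q @` open_face y].

Definition lamination : set 'cV[R]_3 := \bigcup_(L in leaf) L.

(* inverse of Q : D -> X *)
Definition qplus (x : 'cV[R]_3) : 'cV[R]_(3 + 1) :=
  get [set y | D y /\ Q y = x].

Definition supporting (a : 'rV[R]_(3 + 1)) (y : 'cV[R]_(3 + 1)) : Prop :=
  ev a y = 0 /\
  ((forall w, Xi w -> 0 <= ev a w) \/ (forall w, Xi w -> ev a w <= 0)).

(* the unique such functional, for x in X outside the lamination *)
Definition alpha (x : 'cV[R]_3) : 'rV[R]_(3 + 1) :=
  get [set a | ev a e4 = 1 /\ supporting a (qplus x)].

(* The difference of two values of alpha vanishes on e4. *)
Definition cocycle (k : R -> 'cV[R]_3) : 'rV[R]_3 :=
  lsubmx (alpha (k 1) - alpha (k 0)).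

Definition transverse_arc (k : R -> 'cV[R]_3) : Prop :=
  [/\ forall t, 0 <= t <= 1 -> in_chart f X (k t),
      C1_path k,
      ~ lamination (k 0),
      ~ lamination (k 1) &
      forall L t, leaf L -> 0 <= t <= 1 -> L (k t) ->
        forall y (c : R), L y -> derive1 k t <> c *: (y - k t)].

Definition crosses (k : R -> 'cV[R]_3) (L : set 'cV[R]_3) : Prop :=
  exists2 t, 0 <= t <= 1 & L (k t).

(* Transversality alone allows k to turn back inside a complementary region of
   the lamination and to cross a leaf twice, in opposite directions; the
   corresponding subarcs have opposite cocycles. *)
Definition crosses_leaves_once (k : R -> 'cV[R]_3) : Prop :=
  forall L s t, leaf L -> 0 <= s <= 1 -> 0 <= t <= 1 ->
    L (k s) -> L (k t) -> s = t.

Definition subarc (k : R -> 'cV[R]_3) (s t : R) : R -> 'cV[R]_3 :=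
  fun u => k (s + u * (t - s)).

End Bending.

(* phi represents the point of P((R^3)^* ) dual to the line containing L *)
Definition dual_point {R : realType} (L : set 'cV[R]_3) (phi : 'rV[R]_3) :
    Prop :=
  phi != 0 /\ forall v, L v -> ev phi v = 0.

Definition proper_convex_cone {R : realType} n (E : set 'rV[R]_n) : Prop :=
  [/\ convex_set E,
      forall (t : R) v, 0 < t -> E v -> E (t *: v) &
      forall u v : 'rV[R]_n, v != 0 ->
        ~ (forall t : R, closure E (u + t *: v))].

(** * Metrics *)

Section Metrics.
Context {R : realType}.

Definition quad n (B : 'M[R]_n) (u : 'rV[R]_n) : R := (u *m B *m u^T) 0 0.

(* A Riemannian metric on P((R^3)^* ), pulled back to (R^3)^* minus 0. *)
Definition riemannian_metric (B : 'rV[R]_3 -> 'M[R]_3) : Prop :=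
  [/\ forall i j, smooth [set p | p != 0] (fun p => B p i j),
      forall p, p != 0 -> (B p)^T = B p,
      forall p u, p != 0 -> 0 <= quad (B p) u,
      forall p u, p != 0 ->
        (quad (B p) u = 0 <-> exists c : R, u = c *: p) &
      forall (t : R) p u, t != 0 -> p != 0 ->
        quad (B (t *: p)) (t *: u) = quad (B p) u].

Definition riemannian_distance (d : 'rV[R]_3 -> 'rV[R]_3 -> R) : Prop :=
  exists2 B, riemannian_metric B &
    forall p q, p != 0 -> q != 0 ->
      d p q = inf [set len | exists c : R -> 'rV[R]_3,
        [/\ C1_path c,
            forall t, 0 <= t <= 1 -> c t != 0,
            same_pt p (c 0),
            same_pt q (c 1) &
            len = \int[@lebesgue_measure R]_(t in `[0, 1])
                    Num.sqrt (quad (B (c t)) (derive1 c t))]].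

Definition acosh (x : R) : R := ln (x + Num.sqrt (x ^+ 2 - 1)).

Definition half_plane : set 'rV[R]_2 := [set z | 0 < z 0 1].

Definition half_plane_dist (z w : 'rV[R]_2) : R :=
  acosh (1 + ((z 0 0 - w 0 0) ^+ 2 + (z 0 1 - w 0 1) ^+ 2)
             / (2 * z 0 1 * w 0 1)).

(* d is the lift to X of the distance of a hyperbolic metric on X / rho: X is
   identified with the hyperbolic plane by a diffeomorphism dev (with inverse
   sec), and rho acts by isometries. *)
Definition lifted_hyperbolic_distance (G : groupType) (rho : G -> 'M[R]_3)
    (X : set 'cV[R]_3) (d : 'cV[R]_3 -> 'cV[R]_3 -> R) : Prop :=
  exists (dev : 'cV[R]_3 -> 'rV[R]_2) (sec : 'rV[R]_2 -> 'cV[R]_3),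
    [/\ [/\ forall j, smooth X (fun v => dev v 0 j),
            forall v, X v -> half_plane (dev v) &
            forall (t : R) v, t != 0 -> X v -> dev (t *: v) = dev v],
        [/\ forall i, smooth half_plane (fun z => sec z i 0),
            forall z, half_plane z -> X (sec z) /\ dev (sec z) = z &
            forall v, X v -> same_pt v (sec (dev v))],
        forall x v w, X v -> X w ->
          half_plane_dist (dev (rho x *m v)) (dev (rho x *m w)) =
          half_plane_dist (dev v) (dev w) &
        forall v w, X v -> X w -> d v w = half_plane_dist (dev v) (dev w)].

Definition arc_diam (d : 'cV[R]_3 -> 'cV[R]_3 -> R) (k : R -> 'cV[R]_3) : R :=
  sup [set r | exists s t,
    [/\ 0 <= s <= 1, 0 <= t <= 1 & r = d (k s) (k t)]].

End Metrics.

(* Main.v *)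
Require Import Defs.
From HB Require Import structures.
From mathcomp Require Import all_boot all_order all_algebra.
From mathcomp Require Import all_classical all_reals all_analysis.
From mathcomp Require Import ring lra.

Set Implicit Arguments.
Unset Strict Implicit.
Unset Printing Implicit Defensive.

Import Order.TTheory GRing.Theory Num.Theory.
Import numFieldNormedType.Exports.

Local Open Scope classical_set_scope.
Local Open Scope ring_scope.

(* In the affine chart the limit curve is the graph Lam of a continuous function
   over the boundary of the domain Om: when g_n leaves every finite set, rho g_n
   converges after rescaling to a matrix v *m b of rank one with v in the boundary
   and b without zeros in Om, and this contraction forces every limit map to send
   v to a vector over v.  Since eta is not semi-simple, Lam is not planar, so the
   disks are the lower and upper convex envelopes of Lam.  For x in Om, e alpha(x)
   (with e = 1 or -1 according to the disk) is nonnegative on Lam and its zero set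
   C_x in Lam, the contact set, has q+(x) in its convex hull.

   Let k be an arc from x to y.  Then e psi(k) is nonnegative on C_x and
   nonpositive at y, while the functional phi of a leaf crossed by k has constant
   sign on C_x and vanishes somewhere on k.  Two functionals that are nonnegative
   on C_x and bounded by d at x are parallel up to O(d), because x is a convex
   combination of points under C_x.  Here d is O(diam k).

   If k crosses every leaf at most once, then e alpha(k(t)) is nonincreasing in t
   on C_y, so all e psi(k') lie in the cone of functionals that are nonpositive
   on C_y.  This cone is proper: a functional vanishing on C_y would define a leaf
   through y. *)

(** The estimate obtained is linear in the diameter; [a] = 1/2 merely brings the exponent below 1,
    diameters of arcs in K being bounded. The constant depends on K through its distance to the
    boundary of Om and the comparison of metrics on K. Parallelism of phi and psi is measured by
    their cross product m, which is their common zero. Both are O(d) at x, so m is mu x up to O(d).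
    A point y under C_x is far from x, so a large mu would keep phi and psi from being both small at
    y; but x is an average of such points y, at which both are nonnegative. Limit maps are given
    only by their properties, so the graph must be extracted from the dynamics. A priori Q o xi
    could vanish somewhere or span a proper subspace. Irreducibility excludes this: rho has no
    invariant line in the dual space because eta is not semi-simple, and none in R^3 because three
    tangents to the boundary are never concurrent. A nonprincipal ultrafilter on nat, fixed once,
    replaces the extraction of subsequences. *)

(** * Limits along ultrafilters and compactness in matrix spaces *)

Section Limits.
Context {R : realType}.

(** The image of an ultrafilter is an ultrafilter, so it converges as soon as it contains a compact
    set. This is the substitute for convergent subsequences used throughout. *)
Lemma ultra_lim (T : Type) (V : topologicalType) (F : set_system T)
    (FU : UltraFilter F) (K : set V) (u : T -> V) :
  compact K -> (\forall t \near F, K (u t)) -> exists2 x, K x & u @ F --> x.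
Proof.
rewrite compact_ultra => cK FK.
have uU : UltraFilter (u @ F).
  split=> [|G GP uG].
    exact: fmap_proper_filter.
  apply/predeqP => A; split=> [GA|/uG//].
  have [//|FnA] := in_ultra_setVsetC (u @^-1` A) FU.
  have GnA : G (~` A) by apply: uG.
  by case: (filter_not_empty G); rewrite -(setICr A); exact: filterI.
by have [x [Kx ux]] := cK _ uU FK; exists x.
Qed.

Lemma ultra_not (T : Type) (F : set_system T) (FU : UltraFilter F) (A : set T) :
  ~ F A -> F (~` A).
Proof. by move=> nA; have [] := in_ultra_setVsetC A FU. Qed.

Lemma cvg_mx (T : Type) m n (F : set_system T) (FF : Filter F)
    (u : T -> 'M[R]_(m, n)) (l : 'M[R]_(m, n)) :
  (forall i j, (fun t => u t i j) @ F --> l i j) -> u @ F --> l.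
Proof.
move=> h A [P lP PA]; apply: filterS PA _ => /=.
by apply: filter_forall => i; apply: filter_forall => j; apply: h.
Qed.

Lemma cvg_coord (T : Type) m n (F : set_system T) (FF : Filter F)
    (u : T -> 'M[R]_(m, n)) (l : 'M[R]_(m, n)) i j :
  u @ F --> l -> (fun t => u t i j) @ F --> l i j.
Proof. by move=> ul A lA; apply: (ul [set M | A (M i j)]); exact: (@coord_continuous R m n i j l A lA). Qed.

Lemma cvg_mulmx (T : Type) m n p (F : set_system T) (FF : Filter F)
    (u : T -> 'M[R]_(m, n)) (v : T -> 'M[R]_(n, p)) (l : 'M[R]_(m, n)) (k : 'M[R]_(n, p)) :
  u @ F --> l -> v @ F --> k -> (fun t => u t *m v t) @ F --> l *m k.
Proof.
move=> ul vk; apply: cvg_mx => i j; rewrite mxE.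
under eq_fun do rewrite mxE.
by apply: cvg_big => [|a _]; [exact: add_continuous|apply: cvgM; exact: cvg_coord].
Qed.

Lemma cvg_trmx (T : Type) m n (F : set_system T) (FF : Filter F)
    (u : T -> 'M[R]_(m, n)) (l : 'M[R]_(m, n)) :
  u @ F --> l -> (fun t => (u t)^T) @ F --> l^T.
Proof.
move=> ul; apply: cvg_mx => i j; rewrite mxE.
by under eq_fun do rewrite mxE; exact: cvg_coord.
Qed.

Lemma cvg_ev (T : Type) n (F : set_system T) (FF : Filter F)
    (a : T -> 'rV[R]_n) (v : T -> 'cV[R]_n) (l : 'rV[R]_n) (k : 'cV[R]_n) :
  a @ F --> l -> v @ F --> k -> (fun t => ev (a t) (v t)) @ F --> ev l k.
Proof. by move=> al vk; apply: cvg_coord; exact: cvg_mulmx. Qed.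

Lemma lim_ge0 (T : Type) (F : set_system T) (FF : ProperFilter F)
    (u : T -> R) l : u @ F --> l -> (\forall t \near F, 0 <= u t) -> 0 <= l.
Proof. by move=> ul u0; rewrite -(cvg_lim _ ul)//; apply: limr_ge => //; apply/cvg_ex; exists l. Qed.

Lemma lim_le0 (T : Type) (F : set_system T) (FF : ProperFilter F)
    (u : T -> R) l : u @ F --> l -> (\forall t \near F, u t <= 0) -> l <= 0.
Proof. by move=> ul u0; rewrite -(cvg_lim _ ul)//; apply: limr_le => //; apply/cvg_ex; exists l. Qed.

Lemma lim_closed (T : Type) (V : topologicalType) (F : set_system T)
    (FF : ProperFilter F) (u : T -> V) (l : V) (A : set V) :
  u @ F --> l -> closed A -> (\forall t \near F, A (u t)) -> A l.
Proof.
move=> ul Ac uA; apply: Ac => B /ul FB.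
by have [t [? ?]] := filter_ex (filterI uA FB); exists (u t).
Qed.

Lemma lim_unique (T : Type) (V : topologicalType) (F : set_system T)
    (FF : ProperFilter F) (u : T -> V) (l k : V) :
  hausdorff_space V -> u @ F --> l -> u @ F --> k -> l = k.
Proof. by move=> VH ul uk; apply: (cvg_unique VH ul uk). Qed.

Lemma trmx_continuous m n : continuous (@trmx R m n).
Proof. move=> x; apply: (@cvg_trmx _ m n (nbhs x) _ (fun y => y) x); exact: cvg_id. Qed.

Lemma trmx_norm m n (x : 'M[R]_(m, n)) : `|x^T| <= `|x|.
Proof.
rewrite {1}/Num.norm/= mx_normrE; apply/bigmax_leP; split=> // -[i j] _ /=.
rewrite mxE {2}/Num.norm/= mx_normrE.
by apply: (@le_bigmax _ _ _ _ (fun k => `|x k.1 k.2|) (j, i)).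
Qed.

Lemma coord_le_norm m n (x : 'M[R]_(m, n)) i j : `|x i j| <= `|x|.
Proof.
rewrite {2}/Num.norm/= mx_normrE.
by apply: (@le_bigmax _ _ _ _ (fun k => `|x k.1 k.2|) (i, j)).
Qed.

Lemma norm_le_coord m n (x : 'M[R]_(m, n)) (c : R) : 0 <= c ->
  (forall i j, `|x i j| <= c) -> `|x| <= c.
Proof.
by move=> c0 h; rewrite {1}/Num.norm/= mx_normrE; apply/bigmax_leP; split=> // -[].
Qed.

Lemma compact_cV n (A : set 'cV[R]_n) :
  bounded_set A -> closed A -> compact A.
Proof.
move=> [M [Mr AM]] Ac; have -> : A = trmx @` (trmx @^-1` A : set 'rV[R]_n).
  apply/seteqP; split=> [v Av|_ [v Av <-]//].
  by exists v^T; rewrite /= trmxK.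
apply: continuous_compact.
  by apply: continuous_subspaceT; exact: trmx_continuous.
apply: bounded_closed_compact.
  exists M; split=> // x Mx v /= Av; apply: le_trans (AM x Mx _ Av).
  by rewrite -{1}(trmxK v); exact: trmx_norm.
by apply: preimage_closed => // v _; exact: trmx_continuous.
Qed.

End Limits.

(** * The pairing of row and column vectors *)

Section Ev.
Context {R : realType}.
Implicit Types (n : nat).

Lemma evDr n (a : 'rV[R]_n) u v : ev a (u + v) = ev a u + ev a v.
Proof. by rewrite /ev mulmxDr mxE. Qed.

Lemma evZr n (a : 'rV[R]_n) t v : ev a (t *: v) = t * ev a v.
Proof. by rewrite /ev -scalemxAr mxE. Qed.

Lemma evNr n (a : 'rV[R]_n) v : ev a (- v) = - ev a v.
Proof. by rewrite /ev mulmxN mxE. Qed.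

Lemma evBr n (a : 'rV[R]_n) u v : ev a (u - v) = ev a u - ev a v.
Proof. by rewrite evDr evNr. Qed.

Lemma ev0r n (a : 'rV[R]_n) : ev a 0 = 0.
Proof. by rewrite /ev mulmx0 mxE. Qed.

Lemma evDl n (a b : 'rV[R]_n) v : ev (a + b) v = ev a v + ev b v.
Proof. by rewrite /ev mulmxDl mxE. Qed.

Lemma evZl n t (a : 'rV[R]_n) v : ev (t *: a) v = t * ev a v.
Proof. by rewrite /ev -scalemxAl mxE. Qed.

Lemma evNl n (a : 'rV[R]_n) v : ev (- a) v = - ev a v.
Proof. by rewrite /ev mulNmx mxE. Qed.

Lemma evBl n (a b : 'rV[R]_n) v : ev (a - b) v = ev a v - ev b v.
Proof. by rewrite evDl evNl. Qed.

Lemma ev0l n (v : 'cV[R]_n) : ev 0 v = 0.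
Proof. by rewrite /ev mul0mx mxE. Qed.

Lemma ev_sumr n m (a : 'rV[R]_n) (u : 'I_m -> 'cV[R]_n) :
  ev a (\sum_i u i) = \sum_i ev a (u i).
Proof. by rewrite /ev mulmx_sumr summxE. Qed.

Definition evE := (evDr, evZr, evNr, ev0r, evDl, evZl, evNl, ev0l).

Lemma ev_mul m n (a : 'rV[R]_m) (M : 'M[R]_(m, n)) v :
  ev (a *m M) v = ev a (M *m v).
Proof. by rewrite /ev mulmxA. Qed.

Lemma ev_tr n (a v : 'cV[R]_n) : ev a^T v = \sum_i a i 0 * v i 0.
Proof. by rewrite /ev mxE; apply: eq_bigr => i _; rewrite mxE. Qed.

Lemma ev_tr_ge0 n (v : 'cV[R]_n) : 0 <= ev v^T v.
Proof. by rewrite ev_tr; apply: sumr_ge0 => i _; rewrite -expr2 sqr_ge0. Qed.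

Lemma ev_tr_eq0 n (v : 'cV[R]_n) : ev v^T v = 0 -> v = 0.
Proof.
rewrite ev_tr => /eqP; rewrite psumr_eq0; last first.
  by move=> i _; rewrite -expr2 sqr_ge0.
move=> /allP h; apply/matrixP => i j; rewrite ord1 mxE.
have := h i; rewrite mem_index_enum /= => /(_ isT).
by rewrite mulf_eq0 orbb => /eqP.
Qed.

Lemma ev_trC n (u v : 'cV[R]_n) : ev u^T v = ev v^T u.
Proof. by rewrite !ev_tr; apply: eq_bigr => i _; rewrite mulrC. Qed.

Lemma ev_eq0 n (a : 'rV[R]_n) : (forall v, ev a v = 0) -> a = 0.
Proof.
move=> h; apply/matrixP => i j; rewrite ord1 mxE.
have := h (delta_mx j 0); rewrite /ev mxE (bigD1 j)//= big1 ?addr0.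
  by rewrite mxE !eqxx mulr1.
by move=> k /negPf kj; rewrite mxE kj mulr0.
Qed.

Lemma ev_bound n (a : 'rV[R]_n) v : `|ev a v| <= n%:R * `|a| * `|v|.
Proof.
rewrite /ev mxE; apply: le_trans (ler_norm_sum _ _ _) _.
apply: le_trans (_ : \sum_(i < n) (`|a| * `|v|) <= _); last first.
  by rewrite sumr_const card_ord -mulrA mulr_natl.
by apply: ler_sum => i _; rewrite normrM ler_pM// coord_le_norm.
Qed.

Lemma ev_continuous n (a : 'rV[R]_n) : continuous (ev a).
Proof.
move=> x; apply: (@cvg_ev _ _ n (nbhs x) _ (fun=> a) (fun y => y)).
  exact: cvg_cst.
exact: cvg_id.
Qed.

Lemma evl_continuous n (v : 'cV[R]_n) : continuous (fun a : 'rV[R]_n => ev a v).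
Proof.
move=> x; apply: (@cvg_ev _ _ n (nbhs x) _ (fun y => y) (fun=> v)).
  exact: cvg_id.
exact: cvg_cst.
Qed.

Lemma mulmx_continuous m n p (M : 'M[R]_(m, n)) :
  continuous (fun x : 'M[R]_(n, p) => M *m x).
Proof.
move=> x; apply: (@cvg_mulmx _ _ m n p (nbhs x) _ (fun=> M) (fun y => y)).
  exact: cvg_cst.
exact: cvg_id.
Qed.

End Ev.

(** * Segments and convex hulls *)

Section Convex.
Context {R : realType}.

Definition seg m n (x y : 'M[R]_(m, n)) (s : R) := (1 - s) *: x + s *: y.

Lemma seg_ev n (a : 'rV[R]_n) x y s :
  ev a (seg x y s) = (1 - s) * ev a x + s * ev a y.
Proof. by rewrite /seg !evE. Qed.

Lemma segC m n (x y : 'M[R]_(m, n)) s : seg x y s = seg y x (1 - s).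
Proof. by rewrite /seg opprB addrCA subrr addr0 addrC. Qed.

Lemma seg0 m n (x y : 'M[R]_(m, n)) : seg x y 0 = x.
Proof. by rewrite /seg subr0 scale1r scale0r addr0. Qed.

Lemma seg1 m n (x y : 'M[R]_(m, n)) : seg x y 1 = y.
Proof. by rewrite /seg subrr scale1r scale0r add0r. Qed.

Lemma segxx m n (x : 'M[R]_(m, n)) s : seg x x s = x.
Proof. by rewrite /seg -scalerDl subrK scale1r. Qed.

Lemma segE m n (x y : 'M[R]_(m, n)) s : seg x y s = x + s *: (y - x).
Proof.
by rewrite /seg scalerBl scale1r scalerBr -addrA; congr (_ + _); rewrite addrC.
Qed.

Lemma convexP m n (A : set 'M[R]_(m, n)) : convex_set A <->
  forall x y (s : R), A x -> A y -> 0 <= s <= 1 -> A (seg x y s).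
Proof.
split=> [cA x y s Ax Ay /andP[s0 s1]|cA x y l /set_mem Ax /set_mem Ay].
  have := cA y x (Itv01 s0 s1) (mem_set Ay) (mem_set Ax).
  by move=> /set_mem; rewrite /seg addrC.
apply/mem_set; have -> : conv l x y = seg y x l%:num by rewrite /seg addrC.
apply: cA => //.
by apply/andP; split; [exact: ge0|exact: le1].
Qed.

Lemma hull_sub m n (A : set 'M[R]_(m, n)) : A `<=` convex_hull A.
Proof. by move=> x Ax B [_]; apply. Qed.

Lemma hull_min m n (A B : set 'M[R]_(m, n)) :
  convex_set B -> A `<=` B -> convex_hull A `<=` B.
Proof. by move=> cB AB x; apply. Qed.

Lemma hull_convex m n (A : set 'M[R]_(m, n)) : convex_set (convex_hull A).
Proof.
apply/convexP => x y s Ax Ay s01 B BA.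
by have [/convexP cB _] := BA; apply: cB => //; [exact: Ax|exact: Ay].
Qed.

Lemma hull_seg m n (A : set 'M[R]_(m, n)) x y (s : R) : convex_hull A x ->
  convex_hull A y -> 0 <= s <= 1 -> convex_hull A (seg x y s).
Proof. by have /convexP := hull_convex (A := A); apply. Qed.

Lemma hull_ge0 n (A : set 'cV[R]_n) (a : 'rV[R]_n) :
  (forall x, A x -> 0 <= ev a x) -> forall x, convex_hull A x -> 0 <= ev a x.
Proof.
move=> h; apply: hull_min => //; apply/convexP => x y s /= x0 y0 /andP[s0 s1].
by rewrite seg_ev addr_ge0// mulr_ge0// subr_ge0.
Qed.

Lemma hull_eq n (A : set 'cV[R]_n) (a : 'rV[R]_n) c :
  (forall x, A x -> ev a x = c) -> forall x, convex_hull A x -> ev a x = c.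
Proof.
move=> h; apply: hull_min => //; apply/convexP => x y s /= x0 y0 /andP[s0 s1].
by rewrite seg_ev x0 y0; ring.
Qed.

End Convex.

(** * Caratheodory's theorem, compactness of hulls and separation *)

Section Hull.
Context {R : realType}.

Definition comb m n (A : set 'cV[R]_n) (y : 'cV[R]_n) : Prop :=
  exists (t : 'I_m -> R) (a : 'I_m -> 'cV[R]_n),
    [/\ forall i, 0 <= t i, \sum_i t i = 1, forall i, A (a i) &
        y = \sum_i t i *: a i].

(** Caratheodory's reduction step. More than n vectors of R^n are linearly dependent, and since f is
    1 on A the coefficients of a dependence add up to 0. Subtracting a suitable multiple of it kills
    one weight and keeps the others nonnegative. *)
Lemma comb_reduce m n (A : set 'cV[R]_n) (f : 'rV[R]_n) :
  (forall x, A x -> ev f x = 1) -> (n <= m)%N -> comb m.+1 A `<=` comb m A.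
Proof.
move=> fA nm y [t [a [t0 t1 Aa ->]]].
pose B : 'M[R]_(m.+1, n) := \matrix_(i, j) a i j 0.
have kB : kermx B != 0.
  rewrite -mxrank_eq0 mxrank_ker -lt0n subn_gt0 ltnS.
  exact: leq_trans (rank_leq_col _) nm.
have [c c0 cB] : exists2 c : 'rV[R]_m.+1, c != 0 & c *m B = 0.
  have /rowV0Pn [c /sub_kermxP cB c0] := kB.
  by exists c.
have ca : \sum_i c 0 i *: a i = 0.
  apply/matrixP => k l; rewrite ord1 summxE.
  have /matrixP/(_ 0 k) := cB; rewrite !mxE => e; rewrite -[RHS]e.
  by apply: eq_bigr => i _; rewrite !mxE.
have cs : \sum_i c 0 i = 0.
  have := congr1 (ev f) ca; rewrite ev0r ev_sumr => e; rewrite -[RHS]e.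
  by apply: eq_bigr => i _; rewrite evZr fA// mulr1.
have [i0 ci0] : exists i, 0 < c 0 i.
  apply/not_existsP => h; move: c0 => /eqP; apply; apply/matrixP => k i.
  rewrite ord1 mxE; apply/eqP; rewrite -oppr_eq0.
  have /eqP : \sum_i (- c 0 i) = 0 by rewrite sumrN cs oppr0.
  rewrite psumr_eq0 => [/allP/(_ i)|j _]; first by rewrite mem_index_enum; apply.
  by rewrite oppr_ge0 leNgt; apply/negP; exact: h.
(* The first weight to vanish when the dependence is subtracted with growing factor. *)
pose i1 := [arg min_(i < i0 | 0 < c 0 i) (t i / c 0 i)]%O.
have [ci1 mi1] : 0 < c 0 i1 /\ forall j, 0 < c 0 j -> t i1 / c 0 i1 <= t j / c 0 j.
  by rewrite /i1; case: arg_minP.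
pose th := t i1 / c 0 i1; pose u i := t i - th * c 0 i.
have th0 : 0 <= th by rewrite divr_ge0// ltW.
have u0 i : 0 <= u i.
  rewrite subr_ge0; have [ci|ci] := ltP 0 (c 0 i).
    by rewrite -ler_pdivlMr//; exact: mi1.
  by apply: le_trans (t0 i); rewrite mulr_ge0_le0.
have ui1 : u i1 = 0 by rewrite /u /th divfK ?subrr// gt_eqF.
exists (fun j => u (lift i1 j)), (fun j => a (lift i1 j)); split => //.
  have : \sum_i u i = 1 by rewrite sumrB t1 -mulr_sumr cs mulr0 subr0.
  by rewrite (bigD1_ord i1)//= ui1 add0r.
have : \sum_i u i *: a i = \sum_i t i *: a i.
  under eq_bigr do rewrite scalerBl -scalerA.
  by rewrite sumrB -scaler_sumr ca scaler0 subr0.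
by rewrite [in LHS](bigD1_ord i1)//= ui1 scale0r add0r.
Qed.

Lemma comb_leq m k n (A : set 'cV[R]_n) (f : 'rV[R]_n) :
  (forall x, A x -> ev f x = 1) -> (n <= m)%N -> comb (k + m) A `<=` comb m A.
Proof.
move=> fA nm; elim: k => [//|k IHk] y; rewrite addSn => /(comb_reduce fA) h.
by apply: IHk; apply: h; apply: leq_trans nm _; exact: leq_addl.
Qed.

(** A segment between two combinations of n points is a combination of 2n points, which [comb_leq]
    brings back to n. *)
Lemma comb_convex n (A : set 'cV[R]_n) (f : 'rV[R]_n) :
  (forall x, A x -> ev f x = 1) -> convex_set (comb n A).
Proof.
move=> fA; apply/convexP => x y s [t [a [t0 t1 Aa ->]]] [u [b [u0 u1 Ab ->]]].
move=> /andP[s0 s1]; apply: (comb_leq fA (leqnn n) (k := n)).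
pose sel T (p q : 'I_n -> T) (i : 'I_(n + n)) :=
  match fintype.split i with inl j => p j | inr j => q j end.
have sell T (p q : 'I_n -> T) i : sel T p q (lshift n i) = p i.
  by rewrite /sel (unsplitK (inl i)).
have selr T (p q : 'I_n -> T) i : sel T p q (rshift n i) = q i.
  by rewrite /sel (unsplitK (inr i)).
exists (sel _ (fun i => (1 - s) * t i) (fun i => s * u i)), (sel _ a b); split.
- by move=> i; rewrite /sel; case: fintype.split => j; rewrite mulr_ge0// subr_ge0.
- rewrite big_split_ord/=.
  under eq_bigr do rewrite sell.
  under [X in _ + X]eq_bigr do rewrite selr.
  by rewrite -!mulr_sumr t1 u1 !mulr1 subrK.
- by move=> i; rewrite /sel; case: fintype.split.
- rewrite big_split_ord/=.
  under [X in _ = X + _]eq_bigr do rewrite !sell -scalerA.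
  under [X in _ = _ + X]eq_bigr do rewrite !selr -scalerA.
  by rewrite -!scaler_sumr.
Qed.

Lemma hull_comb n (A : set 'cV[R]_n.+1) (f : 'rV[R]_n.+1) :
  (forall x, A x -> ev f x = 1) -> convex_hull A = comb n.+1 A.
Proof.
move=> fA; apply/seteqP; split.
  apply: hull_min; first exact: comb_convex fA.
  move=> x Ax; exists (fun i => (i == ord0)%:R), (fun=> x); split => //.
    by rewrite (bigD1 ord0)//= big1 ?addr0// => i /negPf ->.
  rewrite (bigD1 ord0)//= big1 ?addr0 ?scale1r// => i /negPf ->.
  by rewrite scale0r.
(* Induction on the number of points needs weights with an arbitrary positive total r, since
   removing a point changes the total. *)
suff h m (t : 'I_m -> R) (a : 'I_m -> 'cV[R]_n.+1) r : (forall i, 0 <= t i) ->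
    (forall i, A (a i)) -> r = \sum_i t i -> 0 < r ->
    convex_hull A (r^-1 *: \sum_i t i *: a i).
  move=> y [t [a [t0 t1 Aa ->]]]; rewrite -[X in convex_hull A X]scale1r -invr1.
  exact: h.
elim: m t a r => [|m IHm] t a r t0 Aa; first by rewrite big_ord0 => ->; rewrite ltxx.
rewrite !big_ord_recl => rE r0; set r' := \sum_i _ in rE.
have r'0 : 0 <= r' by apply: sumr_ge0.
have [r'E|r'N0] := eqVneq r' 0.
  have z i : t (lift ord0 i) = 0.
    have /eqP := r'E; rewrite psumr_eq0// => /allP/(_ i).
    by rewrite mem_index_enum => /(_ isT)/eqP.
  rewrite [X in _ + X]big1 ?addr0; last by move=> i _; rewrite z scale0r.
  have tr : t ord0 = r by rewrite rE r'E addr0.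
  rewrite tr scalerA mulVf ?scale1r ?gt_eqF//; exact: hull_sub.
have r'p : 0 < r' by rewrite lt_neqAle eq_sym r'N0.
have := IHm (fun i => t (lift ord0 i)) (fun i => a (lift ord0 i)) r'.
move=> /(_ (fun=> t0 _) (fun=> Aa _) erefl r'p) ih.
have -> : r^-1 *: (t ord0 *: a ord0 + \sum_(i < m) t (lift ord0 i) *: a (lift ord0 i))
  = seg (a ord0) (r'^-1 *: \sum_(i < m) t (lift ord0 i) *: a (lift ord0 i)) (r' / r).
  rewrite /seg scalerDr !scalerA; congr (_ *: _ + _ *: _).
    by rewrite -[t ord0](addrK r') -rE mulrC mulrBl divff// gt_eqF.
  by rewrite mulrAC divff// mul1r.
apply: hull_seg => //; first exact: hull_sub.
by apply/andP; split; [rewrite divr_ge0// ltW|rewrite ler_pdivrMr// mul1r rE lerDr].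
Qed.

(** The number of points in a combination is bounded, so weights and points can be made to converge
    separately. *)
Lemma hull_compact n (A : set 'cV[R]_n.+1) (f : 'rV[R]_n.+1) :
  (forall x, A x -> ev f x = 1) -> compact A -> compact (convex_hull A).
Proof.
move=> fA cA; rewrite (hull_comb fA) compact_ultra => F FU FC.
pose P y (p : ('I_n.+1 -> R) * ('I_n.+1 -> 'cV[R]_n.+1)) :=
  [/\ forall i, 0 <= p.1 i, \sum_i p.1 i = 1, forall i, A (p.2 i) &
      y = \sum_i p.1 i *: p.2 i].
have /choice [p pP] : forall y, exists p, comb n.+1 A y -> P y p.
  move=> y; have [[t [a h]]|h] := pselect (comb n.+1 A y); first by exists (t, a).
  by exists (fun=> 0, fun=> 0) => /h.
have /choice [t tP] : forall i, exists t : R, 0 <= t /\ (fun y => (p y).1 i) @ F --> t.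
  move=> i; have [|t /=] := ultra_lim FU (u := fun y => (p y).1 i)
    (@segment_compact R 0 1).
    apply: filterS FC => y /pP [t0 t1 _ _]; rewrite /= in_itv/= t0/= -t1.
    by rewrite (bigD1 i)//= lerDl sumr_ge0.
  by rewrite in_itv/= => /andP[t0 _] tl; exists t.
have /choice [a aP] : forall i, exists a : 'cV[R]_n.+1, A a /\ (fun y => (p y).2 i) @ F --> a.
  move=> i; have [|a Aa al] := ultra_lim FU (u := fun y => (p y).2 i) cA.
    by apply: filterS FC => y /pP [].
  by exists a.
have FP : ProperFilter F by exact: ultra_proper.
exists (\sum_i t i *: a i); split.
  exists t, a; split => //; [by move=> i; have [] := tP i| |
    by move=> i; have [] := aP i].
  apply: (@lim_unique _ _ F _ (fun y => \sum_i (p y).1 i)).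
  - exact: norm_hausdorff.
  - by apply: cvg_big => [|i _]; [exact: add_continuous|have [] := tP i].
  - apply: cvg_trans (@cvg_cst R 1 _ F _); apply: near_eq_cvg.
    by apply: filterS FC => y /pP [].
have h : (fun y => \sum_i (p y).1 i *: (p y).2 i) @ F --> \sum_i t i *: a i.
  apply: cvg_big => [|i _]; first exact: add_continuous.
  by apply: cvgZ; [have [] := tP i|have [] := aP i].
apply: cvg_trans h; apply: (@near_eq_cvg _ _ _ _ _ id).
by apply: filterS FC => y /pP [].
Qed.

(** The separating functional is the direction from w to the nearest point z of H. As everything
    lies in the hyperplane f = 1, affine separation can be written with a linear functional. *)
Lemma separation n (H : set 'cV[R]_n) (f : 'rV[R]_n) w : compact H ->
  convex_set H -> (forall x, H x -> ev f x = 1) -> ev f w = 1 -> ~ H w ->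
  exists2 a : 'rV[R]_n, forall x, H x -> 0 <= ev a x & ev a w < 0.
Proof.
move=> cH /convexP vH fH fw Hw.
have [H0|/set0P H0] := eqVneq H set0.
  by exists (- f); [rewrite H0|rewrite evNl fw oppr_lt0].
have [z /set_mem Hz zmin] : exists2 z, z \in H & forall x, x \in H ->
    ev (z - w)^T (z - w) <= ev (x - w)^T (x - w).
  apply: compact_EVT_min => //; apply: continuous_subspaceT => x.
  have h : (fun y : 'cV[R]_n => y - w) @ x --> x - w.
    by apply: (@cvgB _ _ _ (nbhs x) _ id (cst w)); [exact: cvg_id|exact: cvg_cst].
  by apply: (@cvg_ev _ _ n (nbhs x) _ (fun y => (y - w)^T) (fun y => y - w)) => //; exact: cvg_trmx.
(* The multiple of f makes a vanish at z. *)
pose a := (z - w)^T - ev (z - w)^T z *: f; exists a => [x Hx|]; last first.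
  rewrite /a evBl evZl fw mulr1 -evBr -(opprB z w) (evNr (z - w)^T) oppr_lt0 lt_neqAle ev_tr_ge0.
  rewrite andbT eq_sym; apply/eqP => /ev_tr_eq0/eqP; rewrite subr_eq0 => /eqP e.
  by apply: Hw; rewrite -e.
rewrite /a evBl evZl fH// mulr1 -evBr leNgt; apply/negP => neg.
set b := ev _ _ in neg; set c := ev (x - z)^T (x - z).
have c0 : 0 <= c by exact: ev_tr_ge0.
(* Change of the squared distance to w when z moves towards x by the fraction s. *)
have q s : 0 <= s <= 1 -> 0 <= s * (2 * b + s * c).
  move=> s01; have := zmin _ (mem_set (vH z x s Hz Hx s01)).
  rewrite segE -addrAC -subr_ge0 [in X in _ <= X](_ : _ - _ = s * (2 * b + s * c))//.
  have -> : (z - w + s *: (x - z))^T = (z - w)^T + s *: (x - z)^T.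
    by rewrite linearD linearZ.
  rewrite !evDl !evZl !(evDr _ (z - w)) !evZr (ev_trC (x - z) (z - w)) -/b -/c; ring.
have e : exists2 s, 0 < s <= 1 & 2 * b + s * c < 0.
  (* Since b < 0 <= c, this s satisfies s c <= - b, so 2 b + s c <= b < 0. *)
  exists (- b / (c - b)).
    have cb : 0 < c - b by lra.
    by rewrite divr_gt0 ?oppr_gt0//= ler_pdivrMr// mul1r; lra.
  have cb : 0 < c - b by lra.
  suff : - b / (c - b) * c <= - b by lra.
  by rewrite mulrAC ler_pdivrMr//; nra.
have [s /andP[s0 s1] sn] := e; have := q s; rewrite (ltW s0) s1 => /(_ isT).
by rewrite pmulr_rge0// leNgt sn.
Qed.

Lemma sphere_compact n : compact [set a : 'rV[R]_n | `|a| = 1].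
Proof.
apply: bounded_closed_compact.
  exists 1; split => // x x1 a /= ->; exact: ltW.
apply: (@preimage_closed _ _ (fun a : 'rV[R]_n => `|a|) [set x | x = 1]).
  by move=> x _; exact: norm_continuous.
exact: closed_eq.
Qed.

(** Points of B near y are separated from H by functionals of norm 1, and a limit of these supports
    H at y. The closed set T records a property of the separating functionals that has to survive in
    the limit, such as the sign of their value on [e4]. *)
Lemma supporting_functional n (H B : set 'cV[R]_n) (T : set 'rV[R]_n) (f : 'rV[R]_n) y :
  compact H -> convex_set H -> (forall x, H x -> ev f x = 1) -> H y ->
  closure B y -> (forall w, B w -> ev f w = 1 /\ ~ H w) ->
  closed T -> (forall w a, B w -> (forall x, H x -> 0 <= ev a x) -> ev a w < 0 ->
    T a) ->
  exists a : 'rV[R]_n, [/\ a != 0, forall x, H x -> 0 <= ev a x, ev a y = 0 & T a].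
Proof.
move=> cH vH fH Hy By BH cT hT.
have PF : ProperFilter (within B (nbhs y)).
  split; last exact: within_filter.
  rewrite /within/= => h; have [z [Bz zh]] := By _ h; exact: zh.
have [F [FU yF]] := ultraFilterLemma PF.
have FP : ProperFilter F by exact: ultra_proper.
have FB : F B by apply: yF; rewrite /within/=; near=> z.
have Fy : id @ F --> y.
  by move=> A yA; apply: yF; rewrite /within/=; apply: filterS yA => z.
have /choice [p pP] : forall w, exists a : 'rV[R]_n, B w ->
    [/\ `|a| = 1, forall x, H x -> 0 <= ev a x & ev a w < 0].
  move=> w; have [Bw|] := pselect (B w); last by exists 0.
  have [fw Hw] := BH _ Bw; have [a aH aw] := separation cH vH fH fw Hw.
  have a0 : 0 < `|a|.
    by rewrite normr_gt0; apply: contraTneq aw => ->; rewrite ev0l ltxx.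
  exists (`|a|^-1 *: a) => _; split.
  - by rewrite normrZ normfV normr_id mulVf// gt_eqF.
  - by move=> x Hx; rewrite evZl mulr_ge0 ?aH// invr_ge0 ltW.
  - by rewrite evZl pmulr_rlt0// invr_gt0.
have [|a /= a1 pa] := ultra_lim FU (u := p) (@sphere_compact n).
  by apply: filterS FB => w /pP [].
have aH x : H x -> 0 <= ev a x.
  move=> Hx; apply: (@lim_ge0 _ _ F _ (fun w => ev (p w) x)).
    by apply: cvg_ev => //; exact: cvg_cst.
  by apply: filterS FB => w /pP [_ + _]; apply.
exists a; split => //.
- by rewrite -normr_gt0 a1.
- apply/eqP; rewrite eq_le aH// andbT.
  apply: (@lim_le0 _ _ F _ (fun w => ev (p w) w)); first exact: cvg_ev.
  by apply: filterS FB => w /pP [_ _ /ltW].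
- apply: (@lim_closed _ _ F _ p) => //.
  by apply: filterS FB => w Bw; have [_ ? ?] := pP _ Bw; apply: hT Bw _ _.
Unshelve. all: by end_near. Qed.

End Hull.

(** * Strictly convex domains *)

Section Domain.
Context {R : realType} {n : nat}.
Variables (X : set 'cV[R]_n) (f : 'rV[R]_n).

Lemma projective_closure : projective_set X ->
  forall (t : R) v, t != 0 -> closure X v -> closure X (t *: v).
Proof.
move=> [_ XZ] t v t0 Xv B tvB.
have /Xv [w [Xw Bw]] : nbhs v [set w | B (t *: w)].
  by apply: (@scaler_continuous _ _ t v).
by exists (t *: w); split => //; exact: XZ.
Qed.

(** Convexity is given in some chart f' only. Passing to f rescales the points; this maps segments
    to segments provided that f' has the same sign at both ends. *)
Lemma in_chart_convex : projective_set X -> properly_convex X -> chart_of X f ->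
  convex_set (in_chart f X).
Proof.
move=> [X0 XZ] [f' [f'X /convexP vX]] fX; apply/convexP => x y s.
move=> [Xx fx] [Xy fy] /andP[s0 s1]; split; last by rewrite seg_ev fx fy; ring.
have f'0 v : X v -> ev f' v != 0.
  by move=> Xv; apply: f'X; [exact: subset_closure|exact: X0].
have f0 v : X v -> ev f v != 0.
  by move=> Xv; apply: fX; [exact: subset_closure|exact: X0].
set a := ev f' x; set b := ev f' y.
have a0 : a != 0 by exact: f'0.
have b0 : b != 0 by exact: f'0.
have Ex : in_chart f' X (a^-1 *: x).
  by split; [apply: XZ => //; rewrite invr_eq0|rewrite evZr mulVf].
have Ey : in_chart f' X (b^-1 *: y).
  by split; [apply: XZ => //; rewrite invr_eq0|rewrite evZr mulVf].
(* With opposite signs, the segment between the points normalised by f' would stay in X and meet the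
   kernel of f, at the parameter - b / (a - b). *)
have ab : 0 < a * b.
  rewrite ltNge; apply/negP => ab.
  have r01 : 0 <= - b / (a - b) <= 1.
    have [an|ap|/eqP] := ltgtP a 0; last by rewrite (negPf a0).
      have bp : 0 < b.
        by rewrite lt_neqAle eq_sym b0/= -(nmulr_rle0 _ an).
      have d : a - b < 0 by lra.
      by rewrite ler_ndivlMr// ler_ndivrMr// mul0r mul1r; lra.
    have bp : b < 0 by rewrite lt_neqAle b0/= -(pmulr_rle0 _ ap).
    have d : 0 < a - b by lra.
    by rewrite ler_pdivlMr// ler_pdivrMr// mul0r mul1r; lra.
  have [Xs _] := vX _ _ _ Ex Ey r01; have /eqP := f0 _ Xs; apply.
  rewrite seg_ev !evZr fx fy !mulr1.
  have d : a - b != 0 by apply: contraTneq ab => d; rewrite -ltNge; nra.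
  by field; rewrite d a0 b0.
pose S := (1 - s) * a + s * b.
have Sab : (0 < a /\ 0 < b /\ 0 < S) \/ (a < 0 /\ b < 0 /\ S < 0).
  have [ap|an|/eqP] := ltgtP 0 a; last by rewrite eq_sym (negPf a0).
    left; have bp : 0 < b by rewrite -(pmulr_rgt0 _ ap).
    by do 2!split=> //; rewrite /S; have [s12|s12] := leP s (1 / 2); nra.
  right; have bp : b < 0 by rewrite -(nmulr_rgt0 _ an).
  by do 2!split=> //; rewrite /S; have [s12|s12] := leP s (1 / 2); nra.
have S0 : S != 0 by case: Sab => -[_ [_]]; [move/gt_eqF ->|move/lt_eqF ->].
have -> : seg x y s = S *: seg (a^-1 *: x) (b^-1 *: y) (s * b / S).
  rewrite /seg scalerDr !scalerA; congr (_ *: _ + _ *: _); rewrite /S in S0 *.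
    by field; rewrite S0 a0.
  by field; rewrite S0 b0.
apply: XZ => //; have [] // := vX _ _ (s * b / S) Ex Ey.
case: Sab => -[ap [bp Sp]].
  rewrite ler_pdivlMr// ler_pdivrMr// mul0r mul1r /S.
  by apply/andP; split; nra.
rewrite ler_ndivlMr// ler_ndivrMr// mul0r mul1r /S.
by apply/andP; split; nra.
Qed.

(** The properties of X on which the convex geometry rests, for a fixed chart f; [Hitchin_domain]
    supplies them. *)
Record convex_domain : Prop := ConvexDomain {
  domain_projective : projective_set X;
  domain_open : open X;
  domain_nonempty : in_chart f X !=set0;
  domain_convex : convex_set (in_chart f X);
  domain_chart : chart_of X f;
  domain_strict : strictly_convex X }.

Hypothesis dX : convex_domain.
Let XP := domain_projective dX.
Let Xo := domain_open dX.
Let vX := domain_convex dX.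
Let fX := domain_chart dX.
Let sX := domain_strict dX.

Local Notation Om := (in_chart f X).
Definition cl_chart : set 'cV[R]_n := [set v | closure X v /\ ev f v = 1].
Definition bd_chart : set 'cV[R]_n := [set v | proj_boundary X v /\ ev f v = 1].

Lemma chart_neq0 v : ev f v = 1 -> v != 0.
Proof. by move=> fv; apply: contra_eq_neq fv => ->; rewrite ev0r eq_sym oner_neq0. Qed.

Lemma Om_cl v : Om v -> cl_chart v.
Proof. by move=> [Xv fv]; split => //; exact: subset_closure. Qed.

Lemma bd_cl v : bd_chart v -> cl_chart v.
Proof. by move=> [[]]. Qed.

Lemma cl_cases v : cl_chart v -> Om v \/ bd_chart v.
Proof.
move=> [Xv fv]; have [Xv'|Xv'] := pselect (X v); first by left.
by right; split => //; split => //; exact: chart_neq0.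
Qed.

Lemma bd_notin v : bd_chart v -> ~ Om v.
Proof. by move=> [[_ _ nX] _] []. Qed.

Lemma cl_chart_closed : closed cl_chart.
Proof.
apply: closedI; first exact: closed_closure.
apply: (@preimage_closed _ _ (ev f) [set x | x = 1]); last exact: closed_eq.
by move=> x _; exact: ev_continuous.
Qed.

(** On the unit vectors of the closure, |f| has a positive minimum, because the chart contains the
    closure of X. Its inverse bounds the norm of the vectors with f = 1. *)
Lemma cl_chart_compact : compact cl_chart.
Proof.
apply: compact_cV; last exact: cl_chart_closed.
pose S := [set v : 'cV[R]_n | `|v| = 1] `&` closure X.
have Sc : compact S.
  apply: compact_cV; first by exists 1; split => // x x1 v [/= -> _]; exact: ltW.
  apply: closedI; last exact: closed_closure.
  apply: (@preimage_closed _ _ (fun a : 'cV[R]_n => `|a|) [set x | x = 1]).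
    by move=> x _; exact: norm_continuous.
  exact: closed_eq.
have nS v : closure X v -> v != 0 -> S (`|v|^-1 *: v).
  move=> Xv v0; split; last by apply: (projective_closure XP); rewrite ?invr_eq0 ?normr_eq0.
  by rewrite /= normrZ normfV normr_id mulVf// normr_eq0.
have [S0|/set0P S0] := eqVneq S set0.
  exists 0; split => // x _ v [Xv fv].
  by have := nS v Xv (chart_neq0 fv); rewrite S0.
have [z /set_mem [/= z1 Xz] zm] : exists2 c, c \in S & forall t, t \in S ->
    `|ev f c| <= `|ev f t|.
  apply: compact_EVT_min => //; apply: continuous_subspaceT => x.
  by apply: (@cvg_norm _ _ _ (nbhs x) _ (ev f)); exact: ev_continuous.
have m0 : 0 < `|ev f z|.
  by rewrite normr_gt0; apply: fX => //; rewrite -normr_gt0 z1.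
exists (`|ev f z|^-1); split => // x mx v [Xv fv].
have v0 := chart_neq0 fv; apply: le_trans (ltW mx).
have := zm _ (mem_set (nS v Xv v0)); rewrite evZr fv mulr1 normfV normr_id => h.
by rewrite -[leLHS]invrK lef_pV2// posrE invr_gt0 normr_gt0.
Qed.

Lemma cl_chart_dense v : cl_chart v -> closure Om v.
Proof.
move=> [Xv fv] B vB.
have h : (fun w => (ev f w)^-1 *: w) @ v --> v.
  have {2}-> : v = (ev f v)^-1 *: v by rewrite fv invr1 scale1r.
  apply: (@cvgZ _ _ _ (nbhs v) _ (fun w => (ev f w)^-1) id).
    by apply: (@cvgV _ _ (nbhs v) _ (ev f)); [rewrite fv oner_neq0|exact: ev_continuous].
  exact: cvg_id.
have [w [Xw Bw]] := Xv _ (h _ vB).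
have fw : ev f w != 0 by apply: fX; [exact: subset_closure|exact: XP.1].
exists ((ev f w)^-1 *: w); split => //; split; last by rewrite evZr mulVf.
by apply: XP.2 => //; rewrite invr_eq0.
Qed.

Lemma Om_nbhs x : Om x -> nbhs x X.
Proof. by move=> [Xx _]; exact: open_nbhs_nbhs. Qed.

(** Replace v by a nearby w in Om: the point of the segment stays fixed if x is moved slightly,
    which is possible because X is open. *)
Lemma Om_seg x v (s : R) : Om x -> cl_chart v -> 0 <= s < 1 -> Om (seg x v s).
Proof.
move=> Ox cv /andP[s0 s1]; have s1' : 1 - s != 0 by lra.
have h : (fun w => (1 - s)^-1 *: (seg x v s - s *: w)) @ v --> x.
  have {2}-> : x = (1 - s)^-1 *: (seg x v s - s *: v).
    by rewrite /seg addrK scalerA mulVf// scale1r.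
  apply: (@cvgZl_tmp _ _ _ (nbhs v) _ (1 - s)^-1 (fun w => seg x v s - s *: w)).
  apply: (@cvgB _ _ _ (nbhs v) _ (cst (seg x v s)) (fun w => s *: w)).
    exact: cvg_cst.
  exact: scaler_continuous.
have [w [Ow Xw]] := cl_chart_dense cv (h _ (Om_nbhs Ox)).
have -> : seg x v s = seg ((1 - s)^-1 *: (seg x v s - s *: w)) w s.
  by rewrite [in RHS]/seg scalerA divff// scale1r subrK.
move/convexP: vX; apply => //; last by rewrite s0 ltW.
split => //; rewrite evZr evBr evZr seg_ev Ox.2 cv.2 Ow.2 !mulr1 subrK.
by rewrite mulVf.
Qed.

Lemma cl_chart_convex : convex_set cl_chart.
Proof.
apply/convexP => x y s cx cy s01; split; last by rewrite seg_ev cx.2 cy.2; ring.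
move=> B xyB; have h : (fun z : 'cV[R]_n * 'cV[R]_n => seg z.1 z.2 s) @ (x, y) --> seg x y s.
  apply: cvgD.
    by apply: (@cvgZl_tmp _ _ _ (nbhs (x, y)) _ (1 - s) fst); exact: cvg_fst.
  by apply: (@cvgZl_tmp _ _ _ (nbhs (x, y)) _ s snd); exact: cvg_snd.
have [[U V] /= [xU yV] UV] := h _ xyB.
have [x' [Ox' Ux']] := cl_chart_dense cx xU.
have [y' [Oy' Vy']] := cl_chart_dense cy yV.
exists (seg x' y' s); split; last by apply: (UV (x', y')).
by move/convexP: vX => /(_ _ _ _ Ox' Oy' s01) [].
Qed.

(** Strict convexity puts one point of the open segment inside Om. From it, [Om_seg] towards p and q
    covers the rest. *)
Lemma strict_seg p q (s : R) : cl_chart p -> cl_chart q -> p != q -> 0 < s < 1 ->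
  Om (seg p q s).
Proof.
move=> cp cq pq /andP[s0 s1].
have [Op|bp] := cl_cases cp; first by apply: Om_seg => //; rewrite ltW.
have [Oq|bq] := cl_cases cq.
  by rewrite segC; apply: Om_seg => //; lra.
have /existsNP [a /existsNP [b /not_implyP [a0 /not_implyP [b0 nb]]]] : ~ (forall a b : R,
    0 < a -> 0 < b -> proj_boundary X (a *: p + b *: q)).
  apply: sX => //; [exact: bp.1|exact: bq.1|] => -[t [t0 e]].
  have := congr1 (ev f) e; rewrite evZr cp.2 cq.2 mulr1 => t1.
  by move: pq; rewrite e -t1 scale1r eqxx.
have ab : a + b != 0 by lra.
pose r := b / (a + b).
have rE : (a + b) *: seg p q r = a *: p + b *: q.
  by rewrite /seg scalerDr !scalerA; congr (_ *: _ + _ *: _); rewrite /r; field.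
have r01 : 0 < r < 1.
  by rewrite divr_gt0//= ?ltr_pdivrMr ?addr_gt0// mul1r; lra.
have Or : Om (seg p q r).
  have cr : cl_chart (seg p q r).
    by move/convexP: cl_chart_convex; apply => //; lra.
  have [//|[br _]] := cl_cases cr.
  case: nb; rewrite -rE; have [v0 cv nX] := br; split.
  - by rewrite scaler_eq0 negb_or ab.
  - exact: (projective_closure XP).
  - move=> h; apply: nX; have := XP.2 (a + b)^-1 _ _ h.
    by rewrite scalerA mulVf// scale1r invr_eq0; apply.
have [sr|rs|->//] := ltgtP s r.
  have -> : seg p q s = seg (seg p q r) p (1 - s / r).
    by rewrite !segE; rewrite -!addrA; congr (_ + _);
      apply/matrixP => i j; rewrite !mxE; field; lra.
  apply: Om_seg => //; have : 0 < s / r by rewrite divr_gt0//; lra.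
  have : s / r < 1 by rewrite ltr_pdivrMr; lra.
  lra.
have -> : seg p q s = seg (seg p q r) q ((s - r) / (1 - r)).
  by apply/matrixP => i j; rewrite !mxE; field; lra.
apply: Om_seg => //; have d : 0 < 1 - r by lra.
by rewrite ler_pdivlMr// ltr_pdivrMr//; lra.
Qed.

Lemma Om_dir x u : Om x -> ev f u = 0 ->
  exists2 e : R, 0 < e & forall t, `|t| <= e -> Om (x + t *: u).
Proof.
move=> Ox fu; have h : (fun t : R => x + t *: u) @ (0 : R) --> x.
  have {2}-> : x = x + 0 *: u by rewrite scale0r addr0.
  apply: cvgD; first exact: cvg_cst.
  by apply: (@cvgZr_tmp _ _ _ (nbhs (0 : R)) _ id 0 u); exact: cvg_id.
have /nbhs_ballP [e /= e0 eX] := h _ (Om_nbhs Ox).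
exists (e / 2) => [|t te]; first by rewrite divr_gt0.
split; last by rewrite evDr evZr fu mulr0 addr0 Ox.2.
by apply: eX; rewrite /ball/= sub0r normrN; lra.
Qed.

Lemma exit_compact (P : set 'cV[R]_n) x u : compact P -> P x -> u != 0 ->
  exists2 t : R, 0 <= t & P (x + t *: u) /\ forall s, t < s -> ~ P (x + s *: u).
Proof.
move=> cP Px u0.
pose T := [set t : R | P (x + t *: u)].
have Tb : exists M, forall t, T t -> t <= M.
  have [M [_ PM]] := compact_bounded cP.
  exists ((`|M| + 1 + `|x|) / `|u|) => t Tt.
  rewrite ler_pdivlMr ?normr_gt0//; apply: le_trans (_ : `|t *: u| <= _).
    by rewrite normrZ ler_wpM2r// ler_norm.
  rewrite -[t *: u](addrK x) (le_trans (ler_normB _ _))// lerD2r addrC.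
  by apply: PM => //; have := ler_norm M; lra.
have Tc : closed T.
  apply: (@preimage_closed _ _ (fun t : R => x + t *: u) P).
    move=> t _; apply: cvgD; first exact: cvg_cst.
    by apply: (@cvgZr_tmp _ _ _ (nbhs t) _ id t u); exact: cvg_id.
  by apply: compact_closed => //; exact: norm_hausdorff.
have T0 : T 0 by rewrite /T/= scale0r addr0.
have hT : has_sup T.
  by split; [exists 0|have [M TM] := Tb; exists M => t; exact: TM].
exists (sup T); first exact: sup_upper_bound.
split=> [|s ss Ps]; last first.
  by have := sup_upper_bound hT Ps; rewrite leNgt ss.
have : closure T (sup T) by move=> B; apply: closure_sup; [exact: hT.1|exact: hT.2].
by move/Tc.
Qed.

Lemma Om_exit x u : Om x -> ev f u = 0 -> u != 0 ->
  exists2 t : R, 0 < t & bd_chart (x + t *: u).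
Proof.
move=> Ox fu u0.
have [t t0 [Pt tmax]] := exit_compact cl_chart_compact (Om_cl Ox) u0.
have [Ot|bt] := cl_cases Pt.
  have [e e0 /(_ e)] := Om_dir Ot fu; rewrite ger0_norm ?(ltW e0)// => /(_ (lexx _)).
  rewrite -addrA -scalerDl => /Om_cl /tmax []; lra.
exists t => //; rewrite lt_neqAle t0 andbT; apply/eqP => t0'.
by move: bt; rewrite -t0' scale0r addr0 => /bd_notin.
Qed.

Lemma bd_ray x u c d : Om x -> bd_chart (x + c *: u) -> bd_chart (x + d *: u) ->
  0 < c -> 0 < d -> c = d.
Proof.
move=> Ox; wlog cd : c d / c < d => [hw bc bd c0 d0|].
  by have [cd|dc|//] := ltgtP c d; [exact: hw|apply/esym; exact: hw].
move=> bc bd c0 d0; exfalso; apply: (bd_notin bc).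
have -> : x + c *: u = seg x (x + d *: u) (c / d).
  by rewrite segE addrAC subrr add0r scalerA divfK// gt_eqF.
apply: Om_seg => //; first exact: bd_cl.
by rewrite divr_ge0 ?ltW//= ltr_pdivrMr// mul1r.
Qed.

Lemma bd_extreme p q (s : R) : cl_chart p -> cl_chart q -> 0 < s < 1 ->
  bd_chart (seg p q s) -> p = q.
Proof.
move=> cp cq s01 b; apply/eqP/negP => /negP pq.
by apply: (bd_notin b); exact: strict_seg.
Qed.

Lemma ge0_bd_Om (c : 'rV[R]_n) : (forall v, bd_chart v -> 0 <= ev c v) ->
  forall x, Om x -> (exists2 u, ev f u = 0 & u != 0) -> 0 <= ev c x.
Proof.
move=> cb x Ox [u fu u0]; have [t t0 bt] := Om_exit Ox fu u0.
have [||s s0 bs] := Om_exit Ox (u := - u); rewrite ?evNr ?fu ?oppr0 ?oppr_eq0//.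
have := cb _ bt; have := cb _ bs; rewrite !evE; nra.
Qed.

(** A linear functional with an interior minimum is constant in the directions of the chart, and
    here the minimum is 0. *)
Lemma ge0_Om_eq0 (c : 'rV[R]_n) x : Om x -> (forall v, Om v -> 0 <= ev c v) ->
  ev c x = 0 -> c = 0.
Proof.
move=> Ox cO cx; apply: ev_eq0 => v.
pose u := v - ev f v *: x.
have fu : ev f u = 0 by rewrite evBr evZr Ox.2; ring.
have [e e0 Oe] := Om_dir Ox fu.
have := cO _ (Oe e _); have := cO _ (Oe (- e) _).
rewrite normrN ger0_norm ?(ltW e0)// !evDr !evZr cx => /(_ (lexx _)) a /(_ (lexx _)) b.
have cu : ev c u = 0 by nra.
by move: cu; rewrite /u evBr evZr cx mulr0 subr0.
Qed.

End Domain.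

(** * Coordinates of R^4 adapted to the projection along [e4] *)

Section Coordinates.
Context {R : realType}.
Local Notation e4 := (@e4 R).

Lemma QD (v w : 'cV[R]_(3 + 1)) : Q (v + w) = Q v + Q w.
Proof. by rewrite /Q linearD. Qed.

Lemma QZ t (v : 'cV[R]_(3 + 1)) : Q (t *: v) = t *: Q v.
Proof. by rewrite /Q linearZ. Qed.

Lemma Q_seg (v w : 'cV[R]_(3 + 1)) s : Q (seg v w s) = seg (Q v) (Q w) s.
Proof. by rewrite /seg QD !QZ. Qed.

Lemma Q_e4 : Q e4 = 0.
Proof. by rewrite /Q /e4 col_mxKu. Qed.

Lemma Q_continuous : continuous (@Q R).
Proof.
move=> x; apply: (@cvg_mx _ _ 3 1 (nbhs x)) => i j.
rewrite mxE; have -> : (fun t : 'cV[R]_(3 + 1) => Q t i j) = (fun t => t (lshift 1 i) j).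
  by apply/funext => t; rewrite mxE.
exact: coord_continuous.
Qed.

Lemma e4_decomp (w : 'cV[R]_(3 + 1)) : w = col_mx (Q w) 0 + dsubmx w 0 0 *: e4.
Proof.
rewrite -[LHS]vsubmxK /e4 scale_col_mx add_col_mx scaler0 addr0 add0r.
by congr col_mx; apply/matrixP => i j; rewrite !ord1 !mxE eqxx mulr1.
Qed.

Lemma Q_eq (w w' : 'cV[R]_(3 + 1)) : Q w = Q w' -> exists t : R, w' = w + t *: e4.
Proof.
move=> e; exists (dsubmx w' 0 0 - dsubmx w 0 0).
rewrite [LHS]e4_decomp -e [in X in _ = X + _](e4_decomp w) scalerBl.
by rewrite -[RHS]addrA [_ *: e4 + (_ - _)]addrC subrK.
Qed.

Lemma ev_col (c : 'rV[R]_3) (w : 'cV[R]_(3 + 1)) : ev (row_mx c 0) w = ev c (Q w).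
Proof. by rewrite /ev /Q -{1}(vsubmxK w) mul_row_col mul0mx addr0. Qed.

Lemma ev_e4 (a : 'rV[R]_(3 + 1)) : ev a e4 = rsubmx a 0 0.
Proof.
by rewrite /ev /e4 -{1}(hsubmxK a) mul_row_col mulmx0 add0r mulmx1.
Qed.

Lemma ev_e4_0 (a : 'rV[R]_(3 + 1)) : ev a e4 = 0 -> a = row_mx (lsubmx a) 0.
Proof.
rewrite ev_e4 => h; rewrite -[LHS]hsubmxK; congr row_mx.
by apply/matrixP => i j; rewrite !ord1 h mxE.
Qed.

Lemma ev_lsub (a : 'rV[R]_(3 + 1)) w : ev a e4 = 0 -> ev (lsubmx a) (Q w) = ev a w.
Proof. by move=> h; rewrite -ev_col -ev_e4_0. Qed.

End Coordinates.

(** * Convex hull of the limit curve *)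

Section Graph.
Context {R : realType}.
Local Notation e4 := (@e4 R).
Variables (X : set 'cV[R]_3) (f : 'rV[R]_3) (Lam : set 'cV[R]_(3 + 1)).
Local Notation Om := (in_chart f X).
Local Notation cOm := (cl_chart X f).
Local Notation bOm := (bd_chart X f).

(* Lam is the limit curve in the chart: the graph of a continuous function over
   the boundary of the domain, not contained in the graph of a linear one. *)
Record limit_graph : Prop := LimitGraph {
  graph_compact : compact Lam;
  graph_bd w : Lam w -> bOm (Q w);
  graph_inj w w' : Lam w -> Lam w' -> Q w = Q w' -> w = w';
  graph_sur v : bOm v -> exists2 w, Lam w & Q w = v;
  graph_nonplanar (a : 'rV[R]_(3 + 1)) :
    (forall w, Lam w -> ev a w = 0) -> ev a e4 = 0 }.

Hypothesis (dX : convex_domain X f) (gL : limit_graph).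
Let XP := domain_projective dX.
Let Xo := domain_open dX.
Let Om0 := domain_nonempty dX.
Let vX := domain_convex dX.
Let fX := domain_chart dX.
Let LamC := graph_compact gL.
Let LamQ := graph_bd gL.
Let Lam_inj := graph_inj gL.
Let Lam_sur := graph_sur gL.
Let Lam_nonplanar := graph_nonplanar gL.

Local Notation H := (convex_hull Lam).
Let fQ : 'rV[R]_(3 + 1) := row_mx f 0.

Lemma fQ1 w : Lam w -> ev fQ w = 1.
Proof. by move=> /LamQ [_ h]; rewrite ev_col. Qed.

Lemma H_fQ w : H w -> ev f (Q w) = 1.
Proof. by move=> Hw; rewrite -ev_col; apply: hull_eq Hw => x; exact: fQ1. Qed.

Lemma H_compact : compact H.
Proof. exact: (hull_compact fQ1). Qed.

Lemma H_closed : closed H.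
Proof. by apply: compact_closed H_compact; exact: norm_hausdorff. Qed.

Lemma H_cl w : H w -> cOm (Q w).
Proof.
move: w; apply: hull_min => [|w /LamQ/bd_cl//].
apply/convexP => x y s cx cy s01; rewrite /= Q_seg.
by have /convexP := cl_chart_convex dX; apply.
Qed.

(** Boundary points of a strictly convex domain are extreme, so a combination lying over one
    involves only points over it, and a graph has a single such point. *)
Lemma H_bd w : H w -> bOm (Q w) -> Lam w.
Proof.
suff : H `<=` [set w | H w /\ (bOm (Q w) -> Lam w)] by move=> h /h [].
apply: hull_min => [|x Lx]; last by split => //; exact: hull_sub.
apply/convexP => x y s [Hx Lx] [Hy Ly] /andP[].
rewrite le_eqVlt => /predU1P [<- _|s0]; first by rewrite seg0.
rewrite le_eqVlt => /predU1P [->|s1]; first by rewrite seg1.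
split; first by apply: hull_seg => //; rewrite !ltW.
rewrite Q_seg => b; have e : Q x = Q y.
  by apply: (bd_extreme dX) b; rewrite ?s0//; exact: H_cl.
have bx : bOm (Q x) by move: b; rewrite -e segxx.
have Lx' := Lx bx; have -> : y = x by apply: Lam_inj => //; apply: Ly; rewrite -e.
by rewrite segxx.
Qed.

Lemma H_Om w : H w -> ~ Lam w -> Om (Q w).
Proof. by move=> Hw nL; have [//|/(H_bd Hw)] := cl_cases (H_cl Hw). Qed.

Lemma H_fiber x : Om x -> exists2 w, H w & Q w = x.
Proof.
move=> Ox; have [u fu u0] : exists2 u, ev f u = 0 & u != 0.
  have k0 : kermx f^T != 0.
    by rewrite -mxrank_eq0 mxrank_ker -lt0n subn_gt0 (leq_ltn_trans (rank_leq_col _)).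
  have /rowV0Pn [c /sub_kermxP cB c0] := k0; exists c^T; last by rewrite trmx_eq0.
  by rewrite /ev -[f]trmxK -trmx_mul cB !mxE.
have [t t0 bt] := Om_exit dX Ox fu u0.
have [||s s0 bs] := Om_exit dX Ox (u := - u); rewrite ?evNr ?fu ?oppr0 ?oppr_eq0//.
have [w Lw Qw] := Lam_sur bt; have [w' Lw' Qw'] := Lam_sur bs.
exists (seg w w' (t / (t + s))).
  apply: hull_seg; [exact: hull_sub|exact: hull_sub|].
  have ts : 0 < t + s by rewrite addr_gt0.
  by apply/andP; split; [rewrite divr_ge0 ?ltW|rewrite ler_pdivrMr// mul1r; lra].
rewrite Q_seg Qw Qw'; apply/matrixP => i j; rewrite !mxE; field.
by rewrite gt_eqF// addr_gt0.
Qed.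

Lemma bd_ge0_eq0 (c : 'rV[R]_3) x : (forall v, bOm v -> 0 <= ev c v) -> Om x ->
  ev c x = 0 -> c = 0.
Proof.
move=> cb Ox; apply: (ge0_Om_eq0 dX Ox) => v /H_fiber [w Hw <-].
rewrite -ev_col; apply: hull_ge0 Hw => z /LamQ /cb; by rewrite ev_col.
Qed.

(** A functional vanishing on [e4] descends to R^3. There it would be nonnegative on the boundary
    and zero at an interior point, hence zero. *)
Lemma vert (a : 'rV[R]_(3 + 1)) y : (forall w, Lam w -> 0 <= ev a w) -> a != 0 ->
  Om (Q y) -> ev a y = 0 -> ev a e4 != 0.
Proof.
move=> aL a0 Oy ay; apply: contra_neq a0 => a4.
rewrite (ev_e4_0 a4) (_ : lsubmx a = 0) ?row_mx0//.
apply: (@bd_ge0_eq0 _ (Q y)) => //; last by rewrite ev_lsub.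
by move=> v /Lam_sur [w Lw <-]; rewrite ev_lsub//; exact: aL.
Qed.

(** For e = 1 the curve lies above the hyperplane a = 0, so this is the lower envelope; e = -1 gives
    the upper one. The condition on Q y keeps the points over the open domain. *)
Definition sheet (e : R) (y : 'cV[R]_(3 + 1)) : Prop :=
  [/\ H y, Om (Q y) & exists a : 'rV[R]_(3 + 1),
    [/\ forall w, Lam w -> 0 <= ev a w, ev a y = 0 & ev a e4 = e]].

Lemma H_ge0 (a : 'rV[R]_(3 + 1)) : (forall w, Lam w -> 0 <= ev a w) ->
  forall w, H w -> 0 <= ev a w.
Proof. exact: hull_ge0. Qed.

Lemma sheet_inj e y y' : e != 0 -> sheet e y -> sheet e y' -> Q y = Q y' -> y = y'.
Proof.
move=> e0 [Hy _ [a [aL ay ae]]] [Hy' _ [b [bL b_y be]]] /Q_eq [t ty].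
have := H_ge0 aL Hy'; have := H_ge0 bL Hy.
have b_y0 : ev b y = - t * e by move: b_y; rewrite ty evDr evZr be; lra.
rewrite b_y0 ty evDr evZr ay ae add0r mulNr => h1 h2.
have /eqP : t * e = 0 by lra.
by rewrite mulf_eq0 (negPf e0) orbF => /eqP ->; rewrite scale0r addr0.
Qed.

(** The sum of the two functionals descends to R^3 and vanishes at an interior point, so it is 0.
    Then a vanishes on the whole of Lam, against nonplanarity. *)
Lemma sheet_disj y : sheet 1 y -> ~ sheet (-1) y.
Proof.
move=> [Hy Oy [a [aL ay ae]]] [_ _ [b [bL b_y be]]].
have ab4 : ev (a + b) e4 = 0 by rewrite evDl ae be subrr.
have ab0 : lsubmx (a + b) = 0.
  apply: (@bd_ge0_eq0 _ (Q y)) => //; last by rewrite ev_lsub// evDl ay b_y addr0.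
  by move=> v /Lam_sur [w Lw <-]; rewrite ev_lsub// evDl addr_ge0 ?aL ?bL.
have : ev a e4 = 0.
  apply: Lam_nonplanar => w Lw; have := aL _ Lw; have := bL _ Lw.
  have : ev (a + b) w = 0 by rewrite -ev_lsub// ab0 ev0l.
  by rewrite evDl; lra.
by rewrite ae => /eqP; rewrite oner_eq0.
Qed.

(** Closed companion of [sheet]. Normalising by the norm and keeping only the sign on [e4] is stable
    under limits; over Om the two notions agree by [sheet_csheet]. *)
Definition csheet (e : R) (y : 'cV[R]_(3 + 1)) : Prop :=
  H y /\ exists a : 'rV[R]_(3 + 1),
    [/\ `|a| = 1, forall w, Lam w -> 0 <= ev a w, ev a y = 0 & 0 <= e * ev a e4].

Lemma csheet_compact e : compact (csheet e).
Proof.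
rewrite compact_ultra => F FU Fc.
have FP : ProperFilter F by exact: ultra_proper.
have [|y Hy Fy] := ultra_lim FU (u := id) H_compact.
  by apply: filterS Fc => y [].
have /choice [p pP] : forall y, exists a : 'rV[R]_(3 + 1), csheet e y ->
    [/\ `|a| = 1, forall w, Lam w -> 0 <= ev a w, ev a y = 0 & 0 <= e * ev a e4].
  move=> z; have [[_ [a ha]]|h] := pselect (csheet e z); first by exists a.
  by exists 0.
have [|a /= a1 pa] := ultra_lim FU (u := p) (@sphere_compact R (3 + 1)).
  by apply: filterS Fc => w /pP [].
exists y; split => //; split => //; exists a; split => //.
- move=> w Lw; apply: (@lim_ge0 _ _ F _ (fun z => ev (p z) w)).
    by apply: cvg_ev => //; exact: cvg_cst.
  by apply: filterS Fc => z /pP [_ + _ _]; apply.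
- have h : (fun z => ev (p z) z) @ F --> ev a y by exact: cvg_ev.
  apply/eqP; rewrite eq_le; apply/andP; split.
    by apply: (lim_le0 _ h); apply: filterS Fc => z /pP [_ _ ->].
  by apply: (lim_ge0 _ h); apply: filterS Fc => z /pP [_ _ ->].
- apply: (@lim_ge0 _ _ F _ (fun z => e * ev (p z) e4)).
    apply: cvgM; first exact: cvg_cst.
    by apply: cvg_ev => //; exact: cvg_cst.
  by apply: filterS Fc => z /pP [].
Qed.

Lemma csheet_closed e : closed (csheet e).
Proof. by apply: compact_closed; [exact: norm_hausdorff|exact: csheet_compact]. Qed.

Lemma sheet_csheet e y : e = 1 \/ e = -1 -> sheet e y <-> csheet e y /\ Om (Q y).
Proof.
move=> e1; have e2 : e * e = 1 by case: e1 => ->; ring.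
have e0 : e != 0 by apply: contra_eq_neq e2 => ->; rewrite mul0r eq_sym oner_eq0.
split=> [[Hy Oy [a [aL ay ae]]]|[[Hy [a [a1 aL ay ae]]] Oy]].
  have a0 : 0 < `|a|.
    by rewrite normr_gt0; apply: contra_neq e0 => a0; rewrite -ae a0 ev0l.
  split => //; split => //; exists (`|a|^-1 *: a); split.
  - by rewrite normrZ normfV normr_id mulVf// gt_eqF.
  - by move=> w Lw; rewrite evZl mulr_ge0 ?aL// invr_ge0 ltW.
  - by rewrite evZl ay mulr0.
  - by rewrite evZl ae mulrCA e2 mulr1 invr_ge0 ltW.
have a0 : a != 0 by rewrite -normr_gt0 a1.
have a4 := vert aL a0 Oy ay.
have ea4 : 0 < e * ev a e4 by rewrite lt_neqAle ae eq_sym mulf_neq0.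
split => //; exists ((e * ev a e4)^-1 *: a); split.
- by move=> w Lw; rewrite evZl mulr_ge0 ?aL// invr_ge0.
- by rewrite evZl ay mulr0.
- by rewrite evZl invfM -mulrA mulVf// mulr1 -[RHS]mulr1 -(divff e0) mulrA e2 mul1r.
Qed.

(** Take the extreme point y of the fibre of H over x in the direction - e [e4]. The points beyond y
    on the vertical line are outside H and converge to y, so [supporting_functional] applies; the
    functionals separating them from y have the right sign on [e4]. *)
Lemma sheet_sur e x : e = 1 \/ e = -1 -> Om x -> exists2 y, sheet e y & Q y = x.
Proof.
move=> e1 Ox; have e2 : e * e = 1 by case: e1 => ->; ring.
pose F := H `&` [set w | Q w = x].
have Fc : compact F.
  apply: (subclosed_compact _ H_compact) => [|w []//].
  apply: closedI; first exact: H_closed.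
  apply: (@preimage_closed _ _ Q [set v | v = x]); first by move=> w _; exact: Q_continuous.
  have -> : [set v | v = x] = [set x] by apply/seteqP; split.
  by apply: compact_closed; [exact: norm_hausdorff|exact: compact_set1].
have F0 : F !=set0 by have [w Hw Qw] := H_fiber Ox; exists w.
have [y /set_mem [Hy Qy] ymin] : exists2 c, c \in F & forall t, t \in F ->
    e * dsubmx c 0 0 <= e * dsubmx t 0 0.
  apply: compact_EVT_min => //; apply: continuous_subspaceT => w.
  apply: (@cvgM _ _ (nbhs w) _ (cst e)); first exact: cvg_cst.
  have -> : (fun t : 'cV[R]_(3 + 1) => dsubmx t 0 0) = (fun t => t (rshift 3 0) 0).
    by apply/funext => t; rewrite mxE.
  by rewrite [X in _ --> X]mxE; exact: coord_continuous.
exists y => //; apply/(sheet_csheet _ e1); split; last by rewrite Qy.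
pose B := [set w | exists2 s : R, 0 < s & w = y - (s * e) *: e4].
have yB : closure B y.
  move=> A yA; have h : (fun s : R => y - (s * e) *: e4) @ (0 : R) --> y.
    have {2}-> : y = y - (0 * e) *: e4 by rewrite mul0r scale0r subr0.
    apply: cvgB; first exact: cvg_cst.
    apply: (@cvgZr_tmp _ _ _ (nbhs (0 : R)) _ (fun s => s * e)).
    by apply: cvgMr_tmp; exact: cvg_id.
  have /nbhs_ballP [d /= d0 dA] := h _ yA.
  exists (y - (d / 2 * e) *: e4); split; first by exists (d / 2) => //; rewrite divr_gt0.
  by apply: dA; rewrite /ball/= sub0r normrN ger0_norm; lra.
have [||||a [a0 aH ay]] := @supporting_functional _ _ H B [set a | 0 <= e * ev a e4] fQ y
    H_compact (hull_convex (A := Lam)) _ Hy yB.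
- by move=> w Hw; rewrite ev_col; exact: H_fQ.
- move=> w [s s0 ->]; split.
    by rewrite ev_col /fQ QD -scaleNr QZ Q_e4 scaler0 addr0 H_fQ.
  move=> Hw; have := ymin (y - (s * e) *: e4).
  rewrite inE -scaleNr => /(_ _)/wrap[].
    by split; [rewrite scaleNr|rewrite /= QD QZ Q_e4 scaler0 addr0].
  have e4d t : dsubmx (y + t *: e4) 0 0 = dsubmx y 0 0 + t.
    rewrite linearD linearZ/= [LHS]mxE; congr (_ + _).
    by rewrite mxE /e4 col_mxKd mxE eqxx mulr1.
  rewrite e4d.
  by have : 0 < s * (e * e); [rewrite e2 mulr1|nra].
- apply: (@preimage_closed _ _ (fun a : 'rV[R]_(3 + 1) => e * ev a e4) [set x | 0 <= x]).
    move=> a _; apply: (@cvgM _ _ (nbhs a) _ (cst e)); first exact: cvg_cst.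
    exact: evl_continuous.
  exact: closed_ge.
- move=> w a [s s0 ->] /(_ _ Hy) ay; rewrite evBr evZr => aw /=.
  have : 0 < s * (e * ev a e4) by lra.
  by rewrite pmulr_rgt0// => /ltW.
move=> /= a4; split => //; exists (`|a|^-1 *: a).
have a0' : 0 < `|a| by rewrite normr_gt0.
split.
- by rewrite normrZ normfV normr_id mulVf// gt_eqF.
- by move=> w Lw; rewrite evZl; apply: mulr_ge0; [rewrite invr_ge0 ltW|exact: aH (hull_sub Lw)].
- by rewrite evZl ay mulr0.
- by rewrite evZl mulrCA mulr_ge0// invr_ge0.
Qed.

Lemma Om_connected : connected Om.
Proof.
have [x Ox] := Om0.
have -> : Om = \bigcup_(y in Om) (seg x y @` `[(0 : R), 1]%classic).
  apply/seteqP; split=> [y Oy|z [y Oy [s /=]]].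
    by exists y => //; exists 1; [rewrite /= in_itv/= ler01 lexx|rewrite seg1].
  by rewrite in_itv/= => s01 <-; move/convexP: vX; apply.
apply: bigcup_connected.
  by exists x => y _; exists 0; [rewrite /= in_itv/= ler01 lexx|rewrite seg0].
move=> y Oy; apply: connected_continuous_connected; first exact: segment_connected.
apply: continuous_subspaceT => s; rewrite /seg.
apply: cvgD.
  apply: (@cvgZr_tmp _ _ _ (nbhs s) _ (fun s => 1 - s)).
  by apply: cvgB; [exact: cvg_cst|exact: cvg_id].
by apply: (@cvgZr_tmp _ _ _ (nbhs s) _ id); exact: cvg_id.
Qed.

Lemma Q_compact A : compact A -> closed (Q @` (A : set 'cV[R]_(3 + 1))).
Proof.
move=> cA; apply: compact_closed; first exact: norm_hausdorff.
by apply: continuous_compact => //; apply: continuous_subspaceT; exact: Q_continuous.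
Qed.

(** Q is injective on the sheet and maps compact subsets of [csheet] to closed sets. Hence a
    relatively clopen part of the sheet has a relatively clopen image in the connected set Om. *)
Lemma sheet_connected e : e = 1 \/ e = -1 -> connected (sheet e).
Proof.
move=> e1 B B0 [C Co BC] [C' Cc BC'].
have e0 : e != 0 by case: e1 => ->; rewrite ?oppr_eq0 oner_eq0.
have c1 : closed (Q @` (csheet e `&` C')).
  by apply: Q_compact; apply: compact_closedI => //; exact: csheet_compact.
have c2 : closed (Q @` (csheet e `&` ~` C)).
  apply: Q_compact; apply: compact_closedI; first exact: csheet_compact.
  exact: open_closedC.
have E : Q @` B = Om.
  apply: Om_connected.
  - by have [b Bb] := B0; exists (Q b); exists b.
  - exists (~` (Q @` (csheet e `&` ~` C))); first exact: closed_openC.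
    apply/seteqP; split=> [_ [b Bb <-]|x [Ox nx]].
      have [sb Cb] : (sheet e `&` C) b by rewrite -BC.
      split; first by case: sb.
      move=> [b' [cb' nCb'] Qb']; apply: nCb'.
      suff -> : b' = b by [].
      apply: (sheet_inj e0) => //; apply/(sheet_csheet _ e1).
      by split => //; rewrite Qb'; case: sb.
    have [y sy Qy] := sheet_sur e1 Ox; exists y => //; rewrite BC; split => //.
    apply: contrapT => nC; apply: nx; exists y => //; split => //.
    by have /(sheet_csheet _ e1) [] := sy.
  - exists (Q @` (csheet e `&` C')) => //.
    apply/seteqP; split=> [_ [b Bb <-]|x [Ox [b [cb Cb] Qb]]].
      have [sb Cb] : (sheet e `&` C') b by rewrite -BC'.
      split; first by case: sb.
      by exists b => //; split => //; have /(sheet_csheet _ e1) [] := sb.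
    exists b => //; rewrite BC'; split => //; apply/(sheet_csheet _ e1).
    by rewrite Qb.
apply/seteqP; split=> [b|y sy]; first by rewrite BC => -[].
have : (Q @` B) (Q y) by rewrite E; case: sy.
move=> [b Bb Qb]; have sb : sheet e b by move: Bb; rewrite BC => -[].
by rewrite -(sheet_inj e0 sb sy Qb).
Qed.

End Graph.

(** * Cross products and lines in the plane *)

Section Cross.
Context {R : realType}.

Definition o0 : 'I_3 := @Ordinal 3 0 isT.
Definition o1 : 'I_3 := @Ordinal 3 1 isT.
Definition o2 : 'I_3 := @Ordinal 3 2 isT.

Lemma sum3 (F : 'I_3 -> R) : \sum_i F i = F o0 + F o1 + F o2.
Proof.
rewrite !big_ord_recl big_ord0 addr0 addrA.
by congr (F _ + F _ + F _); apply: val_inj.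
Qed.

Lemma ev3 (a : 'rV[R]_3) v :
  ev a v = a 0 o0 * v o0 0 + a 0 o1 * v o1 0 + a 0 o2 * v o2 0.
Proof. by rewrite /ev mxE sum3. Qed.

Lemma ord3 (P : 'I_3 -> Prop) : P o0 -> P o1 -> P o2 -> forall i, P i.
Proof.
move=> P0 P1 P2 [[|[|[|//]]] h].
- by rewrite (_ : Ordinal h = o0)//; apply: val_inj.
- by rewrite (_ : Ordinal h = o1)//; apply: val_inj.
- by rewrite (_ : Ordinal h = o2)//; apply: val_inj.
Qed.

Definition cross (u v : 'cV[R]_3) : 'cV[R]_3 :=
  \col_i match val i with
    | 0%N => u o1 0 * v o2 0 - u o2 0 * v o1 0
    | 1%N => u o2 0 * v o0 0 - u o0 0 * v o2 0
    | _ => u o0 0 * v o1 0 - u o1 0 * v o0 0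
    end.

Lemma ev_cross (p q : 'cV[R]_3) :
  ev (cross p q)^T p = 0 /\ ev (cross p q)^T q = 0.
Proof. by rewrite !ev3 !mxE/=; split; ring. Qed.

Lemma cross_lagrange (p q x : 'cV[R]_3) :
  exists al be : R,
    ev (cross p q)^T (cross p q) *: x =
    al *: p + be *: q + ev (cross p q)^T x *: cross p q.
Proof.
exists (ev p^T x * ev q^T q - ev q^T x * ev p^T q),
  (ev q^T x * ev p^T p - ev p^T x * ev p^T q).
apply/matrixP => i j; rewrite ord1 {j}; move: i.
by apply: ord3; rewrite !mxE !ev3 !mxE/=; ring.
Qed.

(** In the chart, p - q is the cross product of f with the cross product of p and q; the three cases
    are its coordinates. *)
Lemma cross_eq0 (f : 'rV[R]_3) p q : ev f p = 1 -> ev f q = 1 -> cross p q = 0 -> p = q.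
Proof.
move=> fp fq /matrixP h.
have := h o0 0; have := h o1 0; have := h o2 0; rewrite !mxE /= => h2 h1 h0.
apply/matrixP => i j; rewrite ord1 {j}; apply/eqP; rewrite -subr_eq0; apply/eqP.
rewrite -[p i 0]mulr1 -[q i 0]mulr1 -{1}fq -fp !ev3; move: i.
apply: ord3.
- by transitivity (f 0 o1 * (p o0 0 * q o1 0 - p o1 0 * q o0 0)
    - f 0 o2 * (p o2 0 * q o0 0 - p o0 0 * q o2 0)); [ring|rewrite h1 h2; ring].
- by transitivity (f 0 o2 * (p o1 0 * q o2 0 - p o2 0 * q o1 0)
    - f 0 o0 * (p o0 0 * q o1 0 - p o1 0 * q o0 0)); [ring|rewrite h0 h2; ring].
- by transitivity (f 0 o0 * (p o2 0 * q o0 0 - p o0 0 * q o2 0)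
    - f 0 o1 * (p o1 0 * q o2 0 - p o2 0 * q o1 0)); [ring|rewrite h0 h1; ring].
Qed.

Lemma line_ex (f : 'rV[R]_3) p q : ev f p = 1 -> ev f q = 1 -> p != q ->
  exists2 a : 'rV[R]_3, a != 0 & ev a p = 0 /\ ev a q = 0.
Proof.
move=> fp fq pq; exists (cross p q)^T; last exact: ev_cross.
by rewrite trmx_eq0; apply: contra_neq pq; exact: (cross_eq0 fp fq).
Qed.

Lemma line_mem (f a : 'rV[R]_3) p q x : ev f p = 1 -> ev f q = 1 -> p != q ->
  a != 0 -> ev a p = 0 -> ev a q = 0 -> ev f x = 1 -> ev a x = 0 ->
  exists c : R, x = seg p q c.
Proof.
move=> fp fq pq a0 ap aq fx ax; set m := cross p q; set N := ev m^T m.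
have N0 : N != 0.
  by apply: contra_neq pq => /ev_tr_eq0; exact: (cross_eq0 fp fq).
have am : ev a m != 0.
  apply: contra_neq a0 => am; apply: ev_eq0 => v.
  have [al [be]] := cross_lagrange p q v => /(congr1 (ev a)).
  rewrite !evDr !evZr ap aq am !mulr0 !addr0 => /eqP.
  by rewrite mulf_eq0 (negPf N0) => /eqP.
have [al [be e]] := cross_lagrange p q x.
have mx : ev m^T x = 0.
  have := congr1 (ev a) e; rewrite !evDr !evZr ap aq ax !mulr0 !add0r.
  by move=> /esym/eqP; rewrite mulf_eq0 (negPf am) orbF => /eqP.
rewrite mx scale0r addr0 -/N in e.
have := congr1 (ev f) e; rewrite !evDr !evZr fp fq fx !mulr1 => Nab.
exists (be / N); apply: (scalerI N0); rewrite e /seg scalerDr !scalerA.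
by congr (_ *: _ + _ *: _); rewrite ?Nab; field; rewrite -?Nab.
Qed.

Lemma line_dir (f a : 'rV[R]_3) : exists2 u : 'cV[R]_3, u != 0 & ev f u = 0 /\ ev a u = 0.
Proof.
have k0 : kermx (col_mx f a)^T != 0.
  by rewrite -mxrank_eq0 mxrank_ker -lt0n subn_gt0 (leq_ltn_trans (rank_leq_col _)).
have /rowV0Pn [c /sub_kermxP cB c0] := k0; exists c^T; first by rewrite trmx_eq0.
have : col_mx f a *m c^T = 0.
  by apply: trmx_inj; rewrite trmx_mul trmxK cB trmx0.
rewrite mul_col_mx -[X in _ = X](@vsubmxK _ 1 1) => /eq_col_mx [h1 h2].
by rewrite /ev h1 h2 !mxE.
Qed.

End Cross.

(** * Reparametrisation of segments *)

Section Segments.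
Context {R : realType} {m n : nat}.
Implicit Types p q r : 'M[R]_(m, n).

Lemma seg_assoc p q r (s t : R) : 0 < s < 1 -> 0 <= t < 1 ->
  exists k l : R, [/\ 0 < k < 1, 0 <= l <= 1 & seg (seg p q s) r t = seg p (seg q r l) k].
Proof.
move=> /andP[s0 s1] /andP[t0 t1]; pose k := s + t - s * t; exists k, (t / k).
have k0 : 0 < k by rewrite /k; nra.
have k1 : k < 1 by rewrite /k; nra.
have tk : t <= k by rewrite /k; nra.
split; [by rewrite k0|by rewrite divr_ge0 ?(ltW k0)//= ler_pdivrMr// mul1r|].
apply/matrixP => i j; rewrite !mxE; rewrite /k in k0 *; field; lra.
Qed.

Lemma seg_seg p q (s t c : R) : seg (seg p q s) (seg p q t) c = seg p q ((1 - c) * s + c * t).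
Proof. by apply/matrixP => i j; rewrite !mxE; ring. Qed.

Lemma seg01 (s t c : R) : 0 <= s <= 1 -> 0 <= t <= 1 -> 0 <= c <= 1 ->
  0 <= (1 - c) * s + c * t <= 1.
Proof. by move=> /andP[? ?] /andP[? ?] /andP[? ?]; apply/andP; split; nra. Qed.

(* Both points lie in the open segment between the points with parameters e and
   1 - e. *)
Lemma seg_shrink p q (k c : R) : 0 < k < 1 -> 0 < c < 1 ->
  exists e s t : R, [/\ 0 < e < 1 / 2, 0 < s < 1, 0 < t < 1 &
    seg p q k = seg (seg p q e) (seg p q (1 - e)) s /\
    seg p q c = seg (seg p q e) (seg p q (1 - e)) t].
Proof.
move=> /andP[k0 k1] /andP[c0 c1].
pose a := k * (1 - k); pose b := c * (1 - c); pose e := a * b.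
have a0 : 0 < a by rewrite mulr_gt0// subr_gt0.
have b0 : 0 < b by rewrite mulr_gt0// subr_gt0.
have a1 : a <= 1 / 4 by rewrite /a; have := sqr_ge0 (k - 1 / 2); nra.
have b1 : b <= 1 / 4 by rewrite /b; have := sqr_ge0 (c - 1 / 2); nra.
have e0 : 0 < e by rewrite mulr_gt0.
have ea : e <= a / 4 by rewrite /e; nra.
have eb : e <= b / 4 by rewrite /e; nra.
have ak : a <= k by rewrite /a; nra.
have ak' : a <= 1 - k by rewrite /a; nra.
have bc : b <= c by rewrite /b; nra.
have bc' : b <= 1 - c by rewrite /b; nra.
have d : 0 < 1 - 2 * e by lra.
have dn : 1 - 2 * e != 0 by rewrite gt_eqF.
exists e, ((k - e) / (1 - 2 * e)), ((c - e) / (1 - 2 * e)); split.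
- by apply/andP; split=> //; lra.
- by apply/andP; split; [rewrite divr_gt0//; lra|rewrite ltr_pdivrMr// mul1r; lra].
- by apply/andP; split; [rewrite divr_gt0//; lra|rewrite ltr_pdivrMr// mul1r; lra].
- by rewrite !seg_seg; split; congr seg; field.
Qed.

Lemma frac_ge0_lt1 (a b : R) : 0 <= a -> a < b -> 0 <= a / b < 1.
Proof.
move=> a0 ab; have b0 : 0 < b by exact: le_lt_trans ab.
by rewrite divr_ge0 ?(ltW b0)//= ltr_pdivrMr// mul1r.
Qed.

Lemma frac_gt0_lt1 (a b : R) : 0 < a -> a < b -> 0 < a / b < 1.
Proof.
move=> a0 ab; have b0 : 0 < b by exact: lt_trans ab.
by rewrite divr_gt0//= ltr_pdivrMr// mul1r.
Qed.

End Segments.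

(** * The boundary of the convex hull and its two disks *)

Section Pleated.
Context {R : realType} {G : groupType}.
Local Notation e4 := (@e4 R).
Variables (eta : G -> 'M[R]_(3 + 1)) (X : set 'cV[R]_3) (f : 'rV[R]_3).
Local Notation Om := (in_chart f X).
Local Notation cOm := (cl_chart X f).
Local Notation bOm := (bd_chart X f).
Local Notation Lam := (limit_curve eta X `&` chart4 f).
Local Notation H := (convex_hull Lam).
Hypothesis (dX : convex_domain X f) (gL : limit_graph X f Lam).

Lemma XiE : Xi eta X f = [set w | H w /\ Om (Q w)].
Proof.
apply/seteqP; split=> w [Hw].
  by move=> nL; split => //; apply: (H_Om dX gL Hw) => -[].
move=> Ow; split => // cw; have Lw : Lam w.
  by split => //; rewrite /chart4/= (H_fQ gL Hw).
exact: (bd_notin (graph_bd gL Lw)).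
Qed.

Lemma not_limit w : Om (Q w) -> ~ limit_curve eta X w.
Proof. by move=> Ow Lw; apply: (bd_notin (graph_bd gL (w := w) _) Ow); split => //; case: Ow. Qed.

(** A boundary point has a supporting functional, which is not vertical by [vert]; its sign on [e4]
    tells the sheet. Conversely, moving vertically off a sheet leaves H at once. *)
Lemma Xi_boundaryE : Xi_boundary eta X f = sheet X f Lam 1 `|` sheet X f Lam (-1).
Proof.
apply/seteqP; split=> y.
  move=> [[cXi cC] nL].
  have Hy : H y.
    apply: (H_closed gL); apply: closureS cXi => w.
    by rewrite XiE => -[].
  have Oy : Om (Q y) by apply: (H_Om dX gL Hy) => -[].
  (* Points of Lam are in H though not in [Xi]. Requiring X (Q w) discards them, so that B is
     disjoint from H. *)
  pose B := [set w | chart4 f w /\ X (Q w)] `\` Xi eta X f.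
  have By : closure B y.
    move=> A Ay; have XQ : nbhs y [set w | X (Q w)].
      by apply: (Q_continuous (x := y)); exact: (Om_nbhs dX Oy).
    have [w [[cw nXi] [Aw Xw]]] := cC _ (filterI Ay XQ).
    by exists w; split.
  have fQ1 w : H w -> ev (row_mx f 0) w = 1.
    by move=> Hw; rewrite ev_col (H_fQ gL Hw).
  have [|w a _ _ _|a [a0 aH ay _]] := @supporting_functional _ _ H B setT _ y
    (H_compact gL) (hull_convex (A := Lam)) fQ1 Hy By _ closedT.
    move=> w [[cw Xw] nXi]; split; first by rewrite ev_col.
    by move=> Hw; apply: nXi; rewrite XiE.
    by [].
  have aL w : Lam w -> 0 <= ev a w by move=> Lw; apply: aH; exact: hull_sub.
  have := vert dX gL aL a0 Oy ay.
  have [a4|a4|a4] := ltgtP 0 (ev a e4); last by [].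
    move=> _; left; split => //; exists ((ev a e4)^-1 *: a); split.
    - by move=> w Lw; rewrite evZl mulr_ge0 ?aL// invr_ge0 ltW.
    - by rewrite evZl ay mulr0.
    - by rewrite evZl mulVf// gt_eqF.
  move=> _; right; split => //; exists ((- ev a e4)^-1 *: a); split.
  - by move=> w Lw; rewrite evZl mulr_ge0 ?aL// invr_ge0; lra.
  - by rewrite evZl ay mulr0.
  - by rewrite evZl invrN mulNr mulVf// lt_eqF.
move=> sy; have [e [e2 [Hy Oy [a [aL ay ae]]]]] : exists e, e * e = 1 /\ sheet X f Lam e y.
  by case: sy => sy; [exists 1|exists (-1)]; split => //; ring.
have Xiy : Xi eta X f y by rewrite XiE.
split; last exact: not_limit.
split; first exact: subset_closure.
move=> A yA; have h : (fun s : R => y - (s * e) *: e4) @ (0 : R) --> y.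
  have {2}-> : y = y - (0 * e) *: e4 by rewrite mul0r scale0r subr0.
  apply: cvgB; first exact: cvg_cst.
  apply: (@cvgZr_tmp _ _ _ (nbhs (0 : R)) _ (fun s => s * e)).
  by apply: cvgMr_tmp; exact: cvg_id.
have /nbhs_ballP [d /= d0 dA] := h _ yA.
exists (y - (d / 2 * e) *: e4); split.
  split.
    by rewrite /chart4/= QD -scaleNr QZ Q_e4 scaler0 addr0; case: Oy.
  rewrite XiE => -[Hw _]; have := hull_ge0 aL Hw.
  have de : d / 2 * e * e = d / 2 by rewrite -[RHS]mulr1 -e2 mulrA.
  by rewrite evBr evZr ay ae de; lra.
by apply: dA; rewrite /ball/= sub0r normrN ger0_norm; lra.
Qed.

(** The two sheets are connected and cover [Xi_boundary]. Each is relatively closed, being the trace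
    of a [csheet], and they are disjoint, so they are the components. *)
Lemma disk_sheet D : Xi_boundary_disk eta X f D ->
  exists2 e : R, e = 1 \/ e = -1 & D = sheet X f Lam e.
Proof.
move=> [y yB ->]; have [e e1 sy] : exists2 e : R, e = 1 \/ e = -1 & sheet X f Lam e y.
  by move: yB; rewrite Xi_boundaryE => -[]; [exists 1|exists (-1)]; auto.
exists e => //.
have se : sheet X f Lam e `<=` Xi_boundary eta X f.
  by rewrite Xi_boundaryE; case: e1 => -> z; [left|right].
have ne1 : - e = 1 \/ - e = -1 by case: e1 => ->; rewrite ?opprK; auto.
have dis z : sheet X f Lam e z -> ~ sheet X f Lam (- e) z.
  by case: e1 => -> s1 s2; rewrite ?opprK in s2; [exact: (sheet_disj dX gL s1)|exact: (sheet_disj dX gL s2)].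
have cov z : Xi_boundary eta X f z -> sheet X f Lam e z \/ sheet X f Lam (- e) z.
  by rewrite Xi_boundaryE; case: e1 => ->; rewrite ?opprK => -[]; auto.
have OB z : Xi_boundary eta X f z -> Om (Q z) by move=> /cov [] [].
apply/seteqP; split; last first.
  by apply: connected_component_max => //; exact: (sheet_connected dX gL).
set C := connected_component _ y.
have CB : C `<=` Xi_boundary eta X f by exact: connected_component_sub.
have h : C `&` sheet X f Lam e = C.
  apply: (component_connected (A := Xi_boundary eta X f) (x := y)).
  - by exists y; split => //; exact: connected_component_refl.
  - exists (~` csheet Lam (- e)); first exact/closed_openC/(csheet_closed gL).
    apply/seteqP; split=> z [Cz sz]; split => //.
      move=> cz; apply: (dis _ sz); apply/(sheet_csheet dX gL _ ne1).
      by split => //; exact/OB/CB.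
    have [//|sz'] := cov _ (CB _ Cz); exfalso; apply: sz.
    by have /(sheet_csheet dX gL _ ne1) [] := sz'.
  - exists (csheet Lam e); first exact: (csheet_closed gL).
    apply/seteqP; split=> z [Cz sz]; split => //.
      by have /(sheet_csheet dX gL _ e1) [] := sz.
    by apply/(sheet_csheet dX gL _ e1); split => //; exact/OB/CB.
by rewrite -h => z [].
Qed.

End Pleated.

(** * Leaves *)

Section Leaves.
Context {R : realType} {G : groupType}.
Local Notation e4 := (@e4 R).
Variables (eta : G -> 'M[R]_(3 + 1)) (X : set 'cV[R]_3) (f : 'rV[R]_3).
Local Notation Om := (in_chart f X).
Local Notation cOm := (cl_chart X f).
Local Notation bOm := (bd_chart X f).
Local Notation Lam := (limit_curve eta X `&` chart4 f).
Local Notation H := (convex_hull Lam).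
Hypothesis (dX : convex_domain X f) (gL : limit_graph X f Lam).
Variables (e : R).
Hypothesis (e1 : e = 1 \/ e = -1).
Local Notation D := (sheet X f Lam e).

Lemma sign_neq0 : e != 0.
Proof. by case: e1 => ->; rewrite ?oppr_eq0 oner_eq0. Qed.

Lemma sign_sqr : e * e = 1.
Proof. by case: e1 => ->; ring. Qed.

Lemma chord_mem v1 v2 c : bOm v1 -> bOm v2 -> v1 != v2 -> Om (seg v1 v2 c) -> 0 < c < 1.
Proof.
move=> b1 b2 v12 Oc; apply/andP; split; rewrite ltNge; apply/negP => hc.
  apply: (bd_notin b1); have -> : v1 = seg (seg v1 v2 c) v2 (- c / (1 - c)).
    by apply/matrixP => i j; rewrite !mxE; field; lra.
  have d : 0 < 1 - c by lra.
  apply: (Om_seg dX Oc (bd_cl b2)).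
  by apply/andP; split; [rewrite divr_ge0//; lra|rewrite ltr_pdivrMr//; lra].
apply: (bd_notin b2); have -> : v2 = seg (seg v1 v2 c) v1 ((c - 1) / c).
  by apply/matrixP => i j; rewrite !mxE; field; lra.
have d : 0 < c by lra.
apply: (Om_seg dX Oc (bd_cl b1)).
by apply/andP; split; [rewrite divr_ge0//; lra|rewrite ltr_pdivrMr//; lra].
Qed.

Lemma chord_neq (x u : 'cV[R]_3) s t : u != 0 -> 0 < s -> 0 < t ->
  x + s *: u != x - t *: u.
Proof.
move=> u0 s0 t0; rewrite -subr_eq0.
have -> : x + s *: u - (x - t *: u) = (s + t) *: u.
  by apply/matrixP => i j; rewrite !mxE; ring.
by rewrite scaler_eq0 negb_or u0 andbT gt_eqF// addr_gt0.
Qed.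

Lemma chord_Xi b1 b2 c : Lam b1 -> Lam b2 -> b1 != b2 -> 0 < c < 1 ->
  Xi eta X f (seg b1 b2 c).
Proof.
move=> L1 L2 b12 c01; rewrite (XiE dX gL); split.
  by apply: hull_seg; [exact: hull_sub|exact: hull_sub|case/andP: c01 => *; rewrite !ltW].
rewrite Q_seg; apply: (strict_seg dX) => //.
- exact: (H_cl dX gL (hull_sub L1)).
- exact: (H_cl dX gL (hull_sub L2)).
- by apply: contra_neq b12; exact: (graph_inj gL).
Qed.

Lemma chord_face b1 b2 k c : Lam b1 -> Lam b2 -> b1 != b2 -> 0 < k < 1 -> 0 < c < 1 ->
  open_face eta X f (seg b1 b2 k) (seg b1 b2 c).
Proof.
move=> L1 L2 b12 k01 c01; right.
have [d [s [t [/andP[d0 d1] s01 t01 [ks ct]]]]] := seg_shrink b1 b2 k01 c01.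
exists (seg b1 b2 d), (seg b1 b2 (1 - d)), s, t; split => //.
  by apply: chord_Xi => //; lra.
by apply: chord_Xi => //; lra.
Qed.

(** The ends p and q may lie on Lam, hence outside [Xi]. Halving the segment towards y brings them
    into [Xi], and p is recovered from a point of the open face. *)
Lemma open_face_mid y p q s : H p -> H q -> 0 < s < 1 -> y = seg p q s -> Om (Q y) ->
  exists z, open_face eta X f y z /\ p = y + 4 *: (z - y).
Proof.
move=> Hp Hq s01 yE Oy; have Hy : H y.
  by rewrite yE; apply: hull_seg => //; case/andP: s01 => *; rewrite !ltW.
have Xm r : H r -> Xi eta X f (seg y r (1 / 2)).
  move=> Hr; rewrite (XiE dX gL); split; first by apply: hull_seg => //; lra.
  by rewrite Q_seg; apply: (Om_seg dX Oy (H_cl dX gL Hr)); lra.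
(* On the halved segment y has parameter s, and s / 2 is halfway from y to its first end: a quarter
   of the way from y to p. *)
exists (seg (seg y p (1 / 2)) (seg y q (1 / 2)) (s / 2)); split.
  right; exists (seg y p (1 / 2)), (seg y q (1 / 2)), s, (s / 2); split => //.
  - exact: Xm.
  - exact: Xm.
  - by case/andP: s01 => *; lra.
  - split=> //; rewrite -/(seg _ _ _) yE; apply/matrixP => i j; rewrite !mxE.
    by field.
by rewrite yE; apply/matrixP => i j; rewrite !mxE; field.
Qed.

(** A leaf is a full chord of Om. Moreover, a segment of H that passes through the sheet over a
    point of the leaf lies over the same line; this rigidity is what later arguments contradict. *)
Lemma leafP L : leaf eta X f D L -> exists a : 'rV[R]_3, [/\ a != 0,
  L = [set x | Om x /\ ev a x = 0] & forall y p q (s : R), D y -> L (Q y) ->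
    H p -> H q -> 0 < s < 1 -> y = seg p q s -> ev a (Q p) = 0 /\ ev a (Q q) = 0].
Proof.
move=> [y [Dy FD [y0 [u [Fy0 u0 Fu [z0 Fz0 z0y]]]] LE]].
have [Hy Oy _] := Dy.
have Fyu z : open_face eta X f y z -> exists c : R, z = y + c *: u.
  move=> /Fu [c ->]; have [d ->] : exists d : R, y = y0 + d *: u by apply: Fu; left.
  by exists (c - d); rewrite scalerBl -[RHS]addrA [d *: u + _]addrC subrK.
have face p q s : H p -> H q -> 0 < s < 1 -> y = seg p q s ->
    exists c : R, p = y + c *: u.
  move=> Hp Hq s01 yE; have [z [/Fyu [c ->] ->]] := open_face_mid Hp Hq s01 yE Oy.
  by exists (4 * c); rewrite addrAC subrr add0r scalerA.
have OF z : open_face eta X f y z -> Om (Q z) by move=> /FD [].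
have Qu0 : Q u != 0.
  apply/eqP => Qu; apply: z0y; apply: (sheet_inj sign_neq0); [exact: FD|exact: FD|].
  by have [c ->] := Fu _ Fz0; rewrite QD QZ Qu scaler0 addr0.
have fu : ev f (Q u) = 0.
  have [c zc] := Fu _ Fz0; have := (OF _ Fz0).2; rewrite zc QD QZ evDr evZr (OF _ Fy0).2.
  move=> /eqP; rewrite -subr_eq0 addrAC subrr add0r mulf_eq0 => /orP[/eqP c0|/eqP//].
  by case: z0y; rewrite zc c0 scale0r addr0.
have [t1 t10 bt1] := Om_exit dX Oy fu Qu0.
have [||t2 t20 bt2'] := Om_exit dX Oy (u := - Q u); rewrite ?evNr ?fu ?oppr0 ?oppr_eq0//.
have bt2 : bOm (Q y - t2 *: Q u) by rewrite -scalerN.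
set v1 := _ + _ in bt1; set v2 := _ - _ in bt2.
have v12 : v1 != v2 by exact: chord_neq.
have [b1 L1 Qb1] := graph_sur gL bt1; have [b2 L2 Qb2] := graph_sur gL bt2.
have b12 : b1 != b2 by apply: contra_neq v12 => h; rewrite -Qb1 -Qb2 h.
(* Fc is the face of H generated by y: p is in it when some segment of H starting at p has y in its
   interior. *)
pose Fc p := exists q s, [/\ H q, 0 < s < 1 & y = seg p q s].
have Fc_seg p q s r t : H q -> H r -> 0 < s < 1 -> 0 <= t < 1 ->
    y = seg (seg p q s) r t -> Fc p.
  move=> Hq Hr s01 t01; have [k [l [k01 l01 ->]]] := seg_assoc p q r s01 t01.
  by exists (seg q r l), k; split => //; exact: hull_seg.
(* A point of Lam in this face lies over the chord and over the boundary, so it is b1 or b2. The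
   face property then propagates to all of H, and y itself is found on the segment from b1 to b2. *)
have hB : H `<=` [set p | H p /\ (Fc p -> exists2 c, 0 <= c <= 1 & p = seg b1 b2 c)].
  apply: hull_min.
    apply/convexP => p q s [Hp Bp] [Hq Bq] /andP[].
    rewrite le_eqVlt => /predU1P [<- _|s0]; first by rewrite seg0.
    rewrite le_eqVlt => /predU1P [->|s1]; first by rewrite seg1.
    have s01 : 0 < s < 1 by rewrite s0.
    split; first by apply: hull_seg => //; rewrite !ltW.
    move=> [r [t [Hr t01 yE]]]; have t01' : 0 <= t < 1 by case/andP: t01 => *; rewrite ltW.
    have [c c01 ->] := Bp (Fc_seg _ _ _ _ _ Hq Hr s01 t01' yE).
    have [|d d01 ->] := Bq.
      by rewrite (segC p q) in yE; apply: (Fc_seg _ _ _ _ _ Hp Hr _ t01' yE); lra.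
    exists ((1 - s) * c + s * d); last by rewrite seg_seg.
    by apply: seg01 => //; rewrite !ltW.
  move=> w Lw; split; first exact: hull_sub.
  move=> [q [s [Hq s01 yE]]]; have [c wE] := face _ _ _ (hull_sub Lw) Hq s01 yE.
  have bw := graph_bd gL Lw; rewrite wE QD QZ in bw.
  have [c0|c0|c0] := ltgtP c 0.
  - exists 1; rewrite ?ler01 ?lexx// seg1; apply: (graph_inj gL Lw L2).
    rewrite Qb2 wE QD QZ /v2 -[c]opprK scaleNr; congr (_ - _ *: _).
    rewrite -[c]opprK scaleNr -scalerN in bw.
    by apply: (bd_ray dX Oy bw bt2') => //; lra.
  - exists 0; rewrite ?ler01 ?lexx// seg0; apply: (graph_inj gL Lw L1).
    rewrite Qb1 wE QD QZ /v1; congr (_ + _ *: _).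
    exact: (bd_ray dX Oy bw bt1).
  - by exfalso; apply: (bd_notin bw); rewrite c0 scale0r addr0.
have [_ /(_ _) [|k k01 yk]] := hB _ Hy.
  by exists y, (1 / 2); split => //; [lra|rewrite segxx].
have kin : 0 < k < 1.
  by apply: (chord_mem bt1 bt2 v12); rewrite -Qb1 -Qb2 -Q_seg -yk.
have [a a0 [a1 a2]] := line_ex bt1.2 bt2.2 v12.
have aQu : ev a (Q u) = 0.
  have := a1; have := a2; rewrite /v1 /v2 evBr evDr !evZr; nra.
have ay : ev a (Q y) = 0 by move: a1; rewrite /v1 evDr evZr aQu mulr0 addr0.
have LE' : L = [set x | Om x /\ ev a x = 0].
  rewrite LE; apply/seteqP; split=> [_ [z Fz <-]|x [Ox ax]].
    split; first exact: OF.
    by have [c ->] := Fyu _ Fz; rewrite QD QZ evDr evZr aQu mulr0 addr0.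
  have [c xc] := line_mem bt1.2 bt2.2 v12 a0 a1 a2 Ox.2 ax.
  exists (seg b1 b2 c); last by rewrite Q_seg Qb1 Qb2.
  rewrite yk; apply: chord_face => //.
  by apply: (chord_mem bt1 bt2 v12); rewrite -xc.
exists a; split => //.
move=> y2 p q s Dy2 Ly2 Hp Hq s01 y2E.
have Fy2 : open_face eta X f y y2.
  move: Ly2; rewrite LE => -[z Fz Qz].
  by rewrite -(sheet_inj sign_neq0 (FD _ Fz) Dy2 Qz).
(* Since y2 is in the open face of y, y lies on a segment from y2 to some r of H. A segment through
   y2 can thus be traded, by [seg_assoc], for one through y with the same end. *)
have [r [t [Hr t01 yE]]] : exists r t, [/\ H r, 0 <= t < 1 & y = seg y2 r t].
  case: Fy2 => [->|[p1 [p2 [s1 [s2 [X1 X2 /andP[s10 s11] /andP[s20 s21] [E1 E2]]]]]]].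
    by exists y, 0; rewrite segxx; split => //; rewrite lexx ltr01.
  move: X1 X2; rewrite (XiE dX gL) => -[H1 _] [H2 _].
  have [s12|s12] := leP s1 s2.
    exists p1, ((s2 - s1) / s2); split => //.
      by apply: frac_ge0_lt1; [rewrite subr_ge0|rewrite ltrBlDr ltrDl].
    by rewrite E1 E2; apply/matrixP => i j; rewrite !mxE; field; rewrite gt_eqF.
  have d : 0 < 1 - s2 by lra.
  exists p2, ((s1 - s2) / (1 - s2)); split => //.
    by apply: frac_ge0_lt1; [rewrite subr_ge0 ltW|rewrite ltrD2r].
  by rewrite E1 E2; apply/matrixP => i j; rewrite !mxE; field; rewrite gt_eqF.
have fin p' : (exists q', H q' /\ exists2 s' : R, 0 < s' < 1 & y2 = seg p' q' s') -> H p' -> ev a (Q p') = 0.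
  move=> [q' [Hq' [s' s'01 E]]] Hp'.
  have [q2 [s2 [Hq2 s201 E2]]] : Fc p'.
    by apply: (Fc_seg p' q' s' r t) => //; rewrite yE E.
  have [c ->] := face _ _ _ Hp' Hq2 s201 E2.
  by rewrite QD QZ evDr evZr aQu ay; ring.
split; first by apply: fin => //; exists q; split => //; exists s.
apply: fin => //; exists p; split => //; exists (1 - s); first by lra.
by rewrite y2E segC.
Qed.

(** The source of leaves: a line through an interior point of the projected face a = 0 of H, with
    all contact points on one side, is a leaf. The last conclusion says that the whole closed chord
    lifts into that face. *)
Lemma leafI (a : 'rV[R]_(3 + 1)) (c : 'rV[R]_3) z :
  (forall w, Lam w -> 0 <= ev a w) -> ev a e4 = e -> H z -> Om (Q z) -> ev a z = 0 ->
  (forall w, Lam w -> ev a w = 0 -> 0 <= ev c (Q w)) -> c != 0 -> ev c (Q z) = 0 ->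
  leaf eta X f D [set x | Om x /\ ev c x = 0] /\
  forall v, cOm v -> ev c v = 0 -> exists p, [/\ H p, ev a p = 0 & Q p = v].
Proof.
move=> aL ae Hz Oz az cL c0 cz.
have aH := hull_ge0 aL.
have DI p : H p -> Om (Q p) -> ev a p = 0 -> D p.
  by move=> Hp Op ap; split => //; exists a.
have [u u0 [fu cu]] := line_dir f c.
have [t1 t10 bt1] := Om_exit dX Oz fu u0.
have [||t2 t20 bt2'] := Om_exit dX Oz (u := - u); rewrite ?evNr ?fu ?oppr0 ?oppr_eq0//.
have bt2 : bOm (Q z - t2 *: u) by rewrite -scalerN.
set v1 := _ + _ in bt1; set v2 := _ - _ in bt2.
have v12 : v1 != v2 by exact: chord_neq.
have [b1 L1 Qb1] := graph_sur gL bt1; have [b2 L2 Qb2] := graph_sur gL bt2.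
have b12 : b1 != b2 by apply: contra_neq v12 => h; rewrite -Qb1 -Qb2 h.
have c1 : ev c v1 = 0 by rewrite /v1 evDr evZr cz cu mulr0 addr0.
have c2 : ev c v2 = 0 by rewrite /v2 evBr evZr cz cu mulr0 subr0.
pose I p := exists2 k : R, 0 <= k <= 1 & p = seg b1 b2 k.
have cI p : I p -> ev c (Q p) = 0.
  by move=> [k _ ->]; rewrite Q_seg seg_ev Qb1 Qb2 c1 c2; ring.
have Iseg p q s : I p -> I q -> 0 <= s <= 1 -> I (seg p q s).
  move=> [k k01 ->] [l l01 ->] s01; exists ((1 - s) * k + s * l); last exact: seg_seg.
  exact: seg01.
(* Lexicographic order: the segment [b1, b2] is the part of the hull where first
   a and then c is minimal. *)
have hB : H `<=` [set p | H p /\ (0 < ev a p \/ (ev a p = 0 /\ 0 < ev c (Q p)) \/ I p)].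
  apply: hull_min.
    apply/convexP => p q s [Hp Bp] [Hq Bq] /andP[].
    rewrite le_eqVlt => /predU1P [<- _|s0]; first by rewrite seg0.
    rewrite le_eqVlt => /predU1P [->|s1]; first by rewrite seg1.
    have Hs : H (seg p q s) by apply: hull_seg => //; rewrite !ltW.
    split => //; rewrite seg_ev Q_seg seg_ev.
    have := aH _ Hp; rewrite le_eqVlt => /predU1P [ap|ap]; last first.
      by left; have := aH _ Hq; nra.
    have := aH _ Hq; rewrite le_eqVlt => /predU1P [aq|aq]; last by left; nra.
    right; rewrite -ap -aq !mulr0 addr0.
    case: Bp => [|[[_ cp]|Ip]]; first by rewrite -ap ltxx.
      left; split=> //; case: Bq => [|[[_ cq]|Iq]]; first by rewrite -aq ltxx.
        by nra.
      by rewrite (cI _ Iq); nra.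
    case: Bq => [|[[_ cq]|Iq]]; first by rewrite -aq ltxx.
      by left; split=> //; rewrite (cI _ Ip); nra.
    by right; apply: Iseg => //; rewrite !ltW.
  move=> w Lw; split; first exact: hull_sub.
  have := aL _ Lw; rewrite le_eqVlt => /predU1P [/esym aw|]; last by left.
  right; have := cL _ Lw aw; rewrite le_eqVlt => /predU1P [/esym cw|]; last by left.
  right; have bw := graph_bd gL Lw.
  have [k wk] := line_mem bt1.2 bt2.2 v12 c0 c1 c2 bw.2 cw.
  have wE : Q w = Q z + (t1 - k * (t1 + t2)) *: u.
    by rewrite wk; apply/matrixP => i j; rewrite !mxE; ring.
  rewrite wE in bw; set d := t1 - _ in wE bw.
  have [d0|d0|d0] := ltgtP d 0.
  - exists 1; rewrite ?ler01 ?lexx// seg1; apply: (graph_inj gL Lw L2).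
    rewrite Qb2 wE /v2 -[d]opprK scaleNr; congr (_ - _ *: _).
    rewrite -[d]opprK scaleNr -scalerN in bw.
    by apply: (bd_ray dX Oz bw bt2') => //; lra.
  - exists 0; rewrite ?ler01 ?lexx// seg0; apply: (graph_inj gL Lw L1).
    rewrite Qb1 wE /v1; congr (_ + _ *: _).
    exact: (bd_ray dX Oz bw bt1).
  - by exfalso; apply: (bd_notin bw); rewrite d0 scale0r addr0.
have minI p : H p -> ev a p = 0 -> ev c (Q p) = 0 -> I p.
  by move=> /hB [_ h] ap cp; case: h => [|[[_]|//]]; rewrite ?ap ?cp ltxx.
have cge p : H p -> ev a p = 0 -> 0 <= ev c (Q p).
  by move=> /hB [_ h] ap; case: h => [|[[_ /ltW//]|/cI ->//]]; rewrite ap ltxx.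
have [k k01 zk] := minI _ Hz az cz.
have kin : 0 < k < 1.
  by apply: (chord_mem bt1 bt2 v12); rewrite -Qb1 -Qb2 -Q_seg -zk.
(* a is nonnegative at both ends and vanishes at the interior point z. *)
have ab12 : ev a b1 = 0 /\ ev a b2 = 0.
  by have := aL _ L1; have := aL _ L2; move: az; rewrite zk seg_ev; case/andP: kin; nra.
have FI p : open_face eta X f z p -> [/\ Om (Q p), H p & I p].
  move=> [->|[p1 [p2 [s [t [X1 X2 s01 t01 [zE ->]]]]]]]; first by split => //; exists k.
  move: X1 X2; rewrite (XiE dX gL) => -[H1 O1] [H2 O2].
  rewrite -/(seg p1 p2 t) -/(seg p1 p2 s) in zE *.
  have [s0 s1] := andP s01.
  have t01' : 0 <= t <= 1 by case/andP: t01 => *; rewrite !ltW.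
  have [a1 a2] : ev a p1 = 0 /\ ev a p2 = 0.
    by have := aH _ H1; have := aH _ H2; move: az; rewrite zE seg_ev; nra.
  have [d1 d2] : ev c (Q p1) = 0 /\ ev c (Q p2) = 0.
    by have := cge _ H1 a1; have := cge _ H2 a2; move: cz; rewrite zE Q_seg seg_ev; nra.
  split.
  - by rewrite Q_seg; apply: (Om_seg dX O1 (Om_cl O2)); case/andP: t01 => *; rewrite ltW.
  - exact: hull_seg.
  - by apply: Iseg => //; apply: minI.
split; last first.
  move=> v cv ev0.
  have [l vl] := line_mem bt1.2 bt2.2 v12 c0 c1 c2 cv.2 ev0.
  have l01 : 0 <= l <= 1.
    apply/andP; split; rewrite leNgt; apply/negP => hl.
      have d : 0 < 1 - l by rewrite subr_gt0 (lt_trans hl).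
      apply: (bd_notin bt1); have -> : v1 = seg v v2 (- l / (1 - l)).
        by rewrite vl; apply/matrixP => i j; rewrite !mxE; field; rewrite gt_eqF.
      apply: (strict_seg dX cv (bd_cl bt2)).
        apply: contraTneq hl => vv2; move: vl; rewrite vv2 => /matrixP vl.
        have /eqP : (1 - l) *: (v1 - v2) = 0.
          by apply/matrixP => i j; have := vl i j; rewrite !mxE; lra.
        by rewrite scaler_eq0 (gt_eqF d) subr_eq0 (negPf v12).
      by apply: frac_gt0_lt1; [rewrite oppr_gt0|rewrite ltrDr].
    have d : 0 < l by exact: lt_trans hl.
    apply: (bd_notin bt2); have -> : v2 = seg v v1 ((l - 1) / l).
      by rewrite vl; apply/matrixP => i j; rewrite !mxE; field; rewrite gt_eqF.
    apply: (strict_seg dX cv (bd_cl bt1)).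
      apply: contraTneq hl => vv1; move: vl; rewrite vv1 => /matrixP vl.
      have /eqP : l *: (v1 - v2) = 0.
        by apply/matrixP => i j; have := vl i j; rewrite !mxE; lra.
      by rewrite scaler_eq0 (gt_eqF d) subr_eq0 (negPf v12).
    by apply: frac_gt0_lt1; [rewrite subr_gt0|rewrite ltrBlDr ltrDl].
  exists (seg b1 b2 l); split; last by rewrite Q_seg Qb1 Qb2.
    by apply: hull_seg => //; exact: hull_sub.
  by rewrite seg_ev ab12.1 ab12.2; ring.
exists z; split.
- exact: DI.
- move=> p /FI [Op Hp [l _ pl]]; apply: DI => //.
  by rewrite pl seg_ev ab12.1 ab12.2; ring.
- exists z, (b2 - b1); split.
  + by left.
  + by rewrite subr_eq0 eq_sym.
  + move=> p /FI [_ _ [l _ ->]]; exists (l - k); rewrite zk.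
    by apply/matrixP => i j; rewrite !mxE; ring.
  + exists (seg b1 b2 (k / 2)).
      by rewrite zk; apply: chord_face => //; lra.
    rewrite zk => /matrixP h; move: b12 => /eqP; apply.
    by apply/matrixP => i j; have := h i j; rewrite !mxE; move: kin => /andP[]; nra.
- apply/seteqP; split=> [x [Ox cx]|_ [p /FI [Op Hp Ip] <-]]; last by split => //; exact: cI.
  have [l xl] := line_mem bt1.2 bt2.2 v12 c0 c1 c2 Ox.2 cx.
  exists (seg b1 b2 l); last by rewrite Q_seg Qb1 Qb2.
  rewrite zk; apply: chord_face => //.
  by apply: (chord_mem bt1 bt2 v12); rewrite -xl.
Qed.

End Leaves.

(** * Functionals along differentiable paths *)

Section Paths.
Context {R : realType}.

Lemma ev_path n (a : 'rV[R]_n) (k : R -> 'cV[R]_n) (t : R) : derivable k t 1 ->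
  derivable (fun t => ev a (k t)) t 1 /\
  'D_1 (fun t => ev a (k t)) t = ev a ('D_1 k t).
Proof.
move=> dk; have h : (fun h => h^-1 *: (((fun t => ev a (k t)) \o shift t) (h *: 1) - ev a (k t)))
    @ 0^' --> ev a ('D_1 k t).
  have -> : (fun h => h^-1 *: (((fun t => ev a (k t)) \o shift t) (h *: 1) - ev a (k t))) =
      (fun h => ev a (h^-1 *: ((k \o shift t) (h *: 1) - k t))).
    by apply/funext => x /=; rewrite evZr evBr.
  apply: (@cvg_ev _ _ _ (0^') _ (fun=> a)); first exact: cvg_cst.
  exact: dk.
by split; [apply/cvg_ex; exists (ev a ('D_1 k t))|apply/cvg_lim].
Qed.

Lemma path_continuous m n (k : R -> 'M[R]_(m, n)) (t : R) : derivable k t 1 ->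
  {for t, continuous k}.
Proof. by move/derivable1_diffP; exact: differentiable_continuous. Qed.

Lemma ev_path_continuous n (a : 'rV[R]_n) (k : R -> 'cV[R]_n) (s t : R) :
  (forall t, 0 <= t <= 1 -> derivable k t 1) -> 0 <= s -> t <= 1 ->
  {within `[s, t], continuous (fun t => ev a (k t))}.
Proof.
move=> dk s0 t1; apply: continuous_in_subspaceT => x /set_mem /=.
rewrite in_itv/= => /andP[sx xt].
have dx : derivable k x 1 by apply: dk; rewrite (le_trans s0 sx) (le_trans xt t1).
apply: (@cvg_ev _ _ _ (nbhs x) _ (fun=> a)); first exact: cvg_cst.
exact: (path_continuous dx).
Qed.

End Paths.

(** * Bending cocycle *)

Section Cocycle.
Context {R : realType} {G : groupType}.
Local Notation e4 := (@e4 R).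
Variables (eta : G -> 'M[R]_(3 + 1)) (X : set 'cV[R]_3) (f : 'rV[R]_3).
Local Notation Om := (in_chart f X).
Local Notation cOm := (cl_chart X f).
Local Notation bOm := (bd_chart X f).
Local Notation Lam := (limit_curve eta X `&` chart4 f).
Local Notation H := (convex_hull Lam).
Hypothesis (dX : convex_domain X f) (gL : limit_graph X f Lam).
Variables (e : R).
Hypothesis (e1 : e = 1 \/ e = -1).
Local Notation D := (sheet X f Lam e).
Local Notation lam := (lamination eta X f D).
Let e0 := sign_neq0 e1.
Let e2 := sign_sqr e1.

(** The face a = 0 of H is spanned by the contact points, so sign conditions on these extend to it.
    In particular they hold at x, which lies under the face. *)
Lemma contact_ge0 (a : 'rV[R]_(3 + 1)) (c : 'rV[R]_3) :
  (forall w, Lam w -> 0 <= ev a w) ->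
  (forall w, Lam w -> ev a w = 0 -> 0 <= ev c (Q w)) ->
  forall p, H p -> ev a p = 0 -> 0 <= ev c (Q p).
Proof.
move=> aL cL; have aH := hull_ge0 aL.
suff h : H `<=` [set p | H p /\ (0 < ev a p \/ 0 <= ev c (Q p))].
  by move=> p /h [_ [|//]] + ap; rewrite ap ltxx.
apply: hull_min.
  apply/convexP => p q s [Hp Bp] [Hq Bq] /andP[].
  rewrite le_eqVlt => /predU1P [<- _|s0]; first by rewrite seg0.
  rewrite le_eqVlt => /predU1P [->|s1]; first by rewrite seg1.
  split; first by apply: hull_seg => //; rewrite !ltW.
  rewrite seg_ev Q_seg seg_ev.
  have := aH _ Hp; rewrite le_eqVlt => /predU1P [ap|ap]; last first.
    by left; have := aH _ Hq; nra.
  have := aH _ Hq; rewrite le_eqVlt => /predU1P [aq|aq]; last by left; nra.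
  right; case: Bp; rewrite -?ap ?ltxx// => cp; case: Bq; rewrite -?aq ?ltxx// => cq.
  by nra.
move=> w Lw; split; first exact: hull_sub.
have := aL _ Lw; rewrite le_eqVlt => /predU1P [/esym aw|]; last by left.
by right; exact: cL.
Qed.

Lemma qplusP x : Om x -> D (qplus D x) /\ Q (qplus D x) = x.
Proof.
move=> Ox; have [y Dy Qy] := sheet_sur dX gL e1 Ox.
have : [set y | D y /\ Q y = x] !=set0 by exists y.
by move=> /getPex [].
Qed.

(** The value e on [e4] makes supporting functionals nonnegative on Lam for either disk. *)
Definition supp (x : 'cV[R]_3) (a : 'rV[R]_(3 + 1)) : Prop :=
  [/\ forall w, Lam w -> 0 <= ev a w, ev a e4 = e & ev a (qplus D x) = 0].

(** The definition of [alpha] leaves open on which side of the kernel [Xi] lies. The wrong side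
    would put the point on both sheets, against [sheet_disj]. *)
Lemma alphaP x : Om x -> supp x (e *: alpha eta X f D x).
Proof.
move=> Ox; have [Dq Qq] := qplusP Ox; set q := qplus D x in Dq Qq *.
have [Hq Oq [b [bL bq be]]] := Dq.
have XiH w : Xi eta X f w -> H w by rewrite (XiE dX gL) => -[].
have : [set a | ev a e4 = 1 /\ supporting eta X f a q] !=set0.
  exists (e *: b); split; first by rewrite evZl be e2.
  split; first by rewrite evZl bq mulr0.
  case: e1 => ee; [left|right] => w /XiH Hw; have := hull_ge0 bL Hw;
    rewrite evZl ee; lra.
move=> /getPex [a4 [aq aXi]]; rewrite -/q -/(alpha eta X f D x) in a4 aq aXi.
(* [supporting] speaks of [Xi], which omits Lam; the midpoint with q is in [Xi] and has half the
   value at w. *)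
have LX w : Lam w -> Xi eta X f (seg w q (1 / 2)).
  move=> Lw; rewrite (XiE dX gL); split.
    by apply: hull_seg => //; [exact: hull_sub|lra].
  rewrite Q_seg segC; apply: (Om_seg dX Oq); last lra.
  exact: (H_cl dX gL (hull_sub Lw)).
have aL w : ev (alpha eta X f D x) (seg w q (1 / 2)) = ev (alpha eta X f D x) w / 2.
  by rewrite seg_ev aq; field.
split; last by rewrite evZl aq mulr0.
  move=> w Lw; rewrite evZl.
  case: aXi => h.
    have s1 : sheet X f Lam 1 q.
      split => //; exists (alpha eta X f D x); split => // v Lv.
      by have := h _ (LX _ Lv); rewrite aL; lra.
    case: e1 => ee; last by case: (sheet_disj dX gL s1); rewrite -ee.
    by rewrite [X in X * _]ee mul1r; have := h _ (LX _ Lw); rewrite aL; lra.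
  have s1 : sheet X f Lam (-1) q.
    split => //; exists (- alpha eta X f D x); split => [v Lv||].
    - by have := h _ (LX _ Lv); rewrite aL evNl; lra.
    - by rewrite evNl aq oppr0.
    - by rewrite evNl a4.
  case: e1 => ee; first by case: (sheet_disj dX gL (y := q)) => //; rewrite -ee.
  by rewrite [X in X * _]ee mulN1r; have := h _ (LX _ Lw); rewrite aL; lra.
by rewrite evZl a4 mulr1.
Qed.

Lemma supp_sheet x a p : supp x a -> H p -> Om (Q p) -> ev a p = 0 -> D p.
Proof. by move=> [aL ae _] Hp Op ap; split => //; exists a. Qed.

(** If a and b differ, b - a descends to R^3, is nonnegative on the contact set of a and vanishes at
    x, so by [leafI] its kernel is a leaf through x. *)
Lemma supp_uniq x a b : Om x -> ~ lam x -> supp x a -> supp x b -> a = b.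
Proof.
move=> Ox nl [aL ae ax] [bL be bx]; have [[Hq Oq _] Qq] := qplusP Ox.
have ba4 : ev (b - a) e4 = 0 by rewrite evBl ae be subrr.
have [c0|c0] := eqVneq (lsubmx (b - a)) 0.
  have : b - a = 0 by rewrite (ev_e4_0 ba4) c0 row_mx0.
  by move/eqP; rewrite subr_eq0 => /eqP.
case: nl.
have [||lf _] := leafI dX gL aL ae Hq Oq ax _ c0 _.
- by move=> w Lw aw; rewrite ev_lsub// evBl aw subr0; exact: bL.
- by rewrite ev_lsub// evBl ax bx subrr.
exists [set x | Om x /\ ev (lsubmx (b - a)) x = 0] => //; split => //.
by rewrite -Qq ev_lsub// evBl ax bx subrr.
Qed.

Lemma leaf_dual L phi : leaf eta X f D L -> dual_point L phi ->
  L = [set x | Om x /\ ev phi x = 0] /\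
  forall y p q (s : R), D y -> L (Q y) -> H p -> H q -> 0 < s < 1 -> y = seg p q s ->
    ev phi (Q p) = 0 /\ ev phi (Q q) = 0.
Proof.
move=> lL [phi0 phiL]; have [a [a0 LE face]] := leafP dX gL e1 lL.
have [y [Dy _ _ LQ]] := lL.
have Ly : L (Q y) by rewrite LQ; exists y => //; left.
have [Oy ay] : Om (Q y) /\ ev a (Q y) = 0 by move: Ly; rewrite LE.
have [u u0 [fu au]] := line_dir f a.
have [d d0 Od] := Om_dir dX Oy fu.
have L2 : L (Q y + d *: u).
  rewrite LE; split; first by apply: Od; rewrite ger0_norm// ltW.
  by rewrite evDr evZr au ay mulr0 addr0.
have phiu : ev phi u = 0.
  have := phiL _ L2; rewrite evDr (phiL _ Ly) add0r evZr => /eqP.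
  by rewrite mulf_eq0 gt_eqF//= => /eqP.
have fd : ev f (Q y + d *: u) = 1 by rewrite evDr evZr fu mulr0 addr0; case: Oy.
have yd : Q y != Q y + d *: u.
  by rewrite -subr_eq0 opprD addrA subrr add0r oppr_eq0 scaler_eq0 negb_or u0 gt_eqF.
have same b c v : b != 0 -> ev b (Q y) = 0 -> ev b u = 0 -> ev c (Q y) = 0 -> ev c u = 0 ->
    ev f v = 1 -> ev b v = 0 -> ev c v = 0.
  move=> b0 b_y bu cy cu fv bv.
  have bd : ev b (Q y + d *: u) = 0 by rewrite evDr evZr bu b_y mulr0 addr0.
  have [k ->] := line_mem Oy.2 fd yd b0 b_y bd fv bv.
  by rewrite seg_ev evDr evZr cy cu; ring.
split.
  rewrite LE; apply/seteqP; split=> x [Ox h]; split=> //.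
    by apply: (same a phi x) => //; [exact: phiL|exact: Ox.2].
  by apply: (same phi a x) => //; [exact: phiL|exact: Ox.2].
move=> y' p q s Dy' Ly' Hp Hq s01 yE.
have [ap aq] := face _ _ _ _ Dy' Ly' Hp Hq s01 yE.
split; apply: (same a phi) => //; try exact: phiL.
  exact: (H_fQ gL Hp).
exact: (H_fQ gL Hq).
Qed.

Lemma leaf_dual_ex L : leaf eta X f D L -> exists phi, dual_point L phi.
Proof.
move=> /(leafP dX gL e1) [a [a0 LE _]]; exists a; split => // v.
by rewrite LE => -[].
Qed.

(** Otherwise the segment from the point over x to w, which stays in the sheet, would cross the leaf
    transversally, against the rigidity of [leafP]. *)
Lemma leaf_side L phi x a : leaf eta X f D L -> dual_point L phi -> Om x ->
  0 < ev phi x -> supp x a -> forall w, Lam w -> ev a w = 0 -> 0 <= ev phi (Q w).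
Proof.
move=> lL dL Ox px sa w Lw aw; rewrite leNgt; apply/negP => pw.
have [LE face] := leaf_dual lL dL; have [[Hq Oq _] Qq] := qplusP Ox.
set q := qplus D x in Hq Oq Qq.
pose s := ev phi x / (ev phi x - ev phi (Q w)).
have d : 0 < ev phi x - ev phi (Q w) by lra.
have s01 : 0 < s < 1.
  by apply/andP; split; [rewrite divr_gt0//; lra|rewrite ltr_pdivrMr//; lra].
have Oy : Om (Q (seg q w s)).
  rewrite Q_seg; apply: (Om_seg dX Oq (H_cl dX gL (hull_sub Lw))).
  by case/andP: s01 => *; rewrite ltW.
have Hy : H (seg q w s).
  by apply: hull_seg => //; [exact: hull_sub|case/andP: s01 => *; rewrite !ltW].
have Dy : D (seg q w s).
  by apply: (supp_sheet sa) => //; rewrite seg_ev aw; case: sa => _ _ ->; ring.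
have Ly : L (Q (seg q w s)).
  rewrite LE; split => //; rewrite Q_seg seg_ev Qq /s; field.
  by rewrite gt_eqF.
have [+ _] := face _ _ _ _ Dy Ly Hq (hull_sub Lw) s01 erefl.
by rewrite Qq => h; rewrite h ltxx in px.
Qed.

Lemma cocycle_ev k w : Om (k 0) -> Om (k 1) ->
  ev (cocycle eta X f D k) (Q w) = ev (alpha eta X f D (k 1)) w - ev (alpha eta X f D (k 0)) w.
Proof.
move=> O0 O1; have [_ a0 _] := alphaP O0; have [_ a1 _] := alphaP O1.
rewrite /cocycle ev_lsub evBl//.
have : e * (ev (alpha eta X f D (k 1)) e4 - ev (alpha eta X f D (k 0)) e4) = 0.
  by rewrite mulrBr -!evZl a0 a1 subrr.
by move/eqP; rewrite mulf_eq0 (negPf e0) => /eqP.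
Qed.

Lemma IVT0 (g : R -> R) (a b : R) : a <= b -> {within `[a, b], continuous g} ->
  (g a <= 0 <= g b) \/ (g b <= 0 <= g a) -> exists2 c, a <= c <= b & g c = 0.
Proof.
move=> ab cg h; have [|c] := @IVT R g a b 0 ab cg.
  by rewrite ge_min le_max; case: h => /andP[-> ->]; rewrite ?orbT.
by rewrite in_itv/=; exists c.
Qed.

(** If the projected face of [at_] contains k 1, then [at_] = [a1_]. If not, the segment from k t to
    k 1 leaves it through a side, which is a leaf. This leaf has k s and k t on one side, k 1 and w
    on the other. Comparing [at_] and [as_] where the segment from the sheet over k s to w crosses
    the leaf gives the inequality. *)
Lemma contact_monotone (k : R -> 'cV[R]_3) (s t : R) as_ at_ a1_ w :
  transverse_arc eta X f D k -> crosses_leaves_once eta X f D k ->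
  0 <= s -> s < t -> t <= 1 -> ~ lam (k t) ->
  supp (k s) as_ -> supp (k t) at_ -> supp (k 1) a1_ ->
  Lam w -> ev a1_ w = 0 -> ev at_ w <= ev as_ w.
Proof.
move=> [kO [kd _] _ nl1 _] once s0 st t1 nlt ss stt s1 Lw w1.
have s01 : 0 <= s <= 1 by lra.
have t01 : 0 <= t <= 1 by lra.
have [Os Ot O1] : [/\ Om (k s), Om (k t) & Om (k 1)] by split; apply: kO => //; lra.
have [[Hqt Oqt Dqt] Qqt] := qplusP Ot; have [[Hq1 Oq1 Dq1] Qq1] := qplusP O1.
have [[Hqs Oqs Dqs] Qqs] := qplusP Os.
have [atL ate atq] := stt; have [asL ase asq] := ss.
have atH := hull_ge0 atL; have asH := hull_ge0 asL.
(* The face of H cut out by [at_]; its projection Pq is a compact convex set containing k t. *)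
pose P := H `&` [set p | ev at_ p = 0]; pose Pq := Q @` P.
have Pc : compact P.
  apply: compact_closedI; first exact: (H_compact gL).
  apply: (@preimage_closed _ _ (ev at_) [set x | x = 0]); last exact: closed_eq.
  by move=> x _; exact: ev_continuous.
have Pqc : compact Pq.
  by apply: continuous_compact => //; apply: continuous_subspaceT; exact: Q_continuous.
have Pseg p q r : P p -> P q -> 0 <= r <= 1 -> P (seg p q r).
  move=> [Hp ap] [Hq aq] r01; split; first exact: hull_seg.
  by rewrite /= seg_ev ap aq; ring.
have Pqseg p q r : Pq p -> Pq q -> 0 <= r <= 1 -> Pq (seg p q r).
  move=> [p' Pp' <-] [q' Pq' <-] r01; exists (seg p' q' r); first exact: Pseg.
  exact: Q_seg.
have Pt : Pq (k t) by exists (qplus D (k t)).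
have [[p [Hp ap] Qp]|nP1] := pselect (Pq (k 1)).
  have pE : p = qplus D (k 1).
    apply: (sheet_inj e0); last by rewrite Qp Qq1.
      by apply: (supp_sheet stt) => //; rewrite Qp.
    by split.
  have E : at_ = a1_.
    by apply: (supp_uniq O1 nl1) => //; split => //; rewrite -pE.
  by rewrite E w1; exact: asL.
pose u := k 1 - k t.
have u0 : u != 0.
  by apply: contra_notN nP1 => /eqP/eqP; rewrite subr_eq0 => /eqP ->.
have fu : ev f u = 0 by rewrite evBr O1.2 Ot.2 subrr.
(* Last point of Pq on the segment from k t to k 1; a support line of Pq there has k t and k 1 on
   opposite sides. *)
have [tau tau0 [Ptau taumax]] := exit_compact Pqc Pt u0.
have segE' r : k t + r *: u = seg (k t) (k 1) r by rewrite segE.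
have tau1 : tau < 1.
  rewrite ltNge; apply/negP => h; apply: nP1.
  have -> : k 1 = seg (k t) (k t + tau *: u) (tau^-1).
    rewrite segE addrAC subrr add0r scalerA mulVf ?scale1r ?subrKC//.
    by rewrite gt_eqF//; lra.
  apply: Pqseg => //; rewrite invr_ge0 tau0/= invf_le1//; lra.
pose z := k t + tau *: u.
have Oz : Om z by rewrite /z segE'; apply: (Om_seg dX Ot (Om_cl O1)); rewrite tau0.
pose B := [set x | exists2 r : R, tau < r & x = k t + r *: u].
have zB : closure B z.
  move=> A zA; have h : (fun r : R => k t + r *: u) @ (tau : R) --> z.
    apply: cvgD; first exact: cvg_cst.
    by apply: (@cvgZr_tmp _ _ _ (nbhs (tau : R)) _ id); exact: cvg_id.
  have /nbhs_ballP [d /= d0 dA] := h _ zA.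
  exists (k t + (tau + d / 2) *: u); split; first by exists (tau + d / 2) => //; lra.
  by apply: dA; rewrite /ball/= opprD addrA subrr add0r normrN ger0_norm; lra.
have Pqv : convex_set Pq by apply/convexP.
have fP x : Pq x -> ev f x = 1 by move=> [p [Hp _] <-]; exact: (H_fQ gL Hp).
have BP x : B x -> ev f x = 1 /\ ~ Pq x.
  move=> [r tr ->]; split; last exact: taumax.
  by rewrite evDr evZr fu mulr0 addr0; case: Ot.
have [|phi [phi0 phiP phiz _]] := supporting_functional Pqc Pqv fP Ptau zB BP closedT.
  by [].
have [p [Hp ap] Qp] := Ptau.
have [|||lf chord] := leafI dX gL atL ate Hp _ ap _ phi0 _.
- by rewrite Qp.
- by move=> x Lx ax; apply: phiP; exists x => //; split => //; exact: hull_sub.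
- by rewrite Qp.
set L := [set x | Om x /\ ev phi x = 0] in lf.
have pt : 0 < ev phi (k t).
  have := phiP _ Pt; rewrite le_eqVlt => /predU1P [h|//].
  by case: nlt; exists L.
have p1 : ev phi (k 1) < 0.
  have ptau : (1 - tau) * ev phi (k t) + tau * ev phi (k 1) = 0.
    by rewrite -seg_ev -segE'.
  by nra.
pose g r := ev phi (k r).
have cg (a b : R) : 0 <= a -> b <= 1 -> {within `[a, b], continuous g}.
  by move=> *; exact: ev_path_continuous.
have [c ct gc] : exists2 c, t <= c <= 1 & ev phi (k c) = 0.
  apply: (@IVT0 g t 1 t1); first by apply: cg => //; lra.
  by right; rewrite !ltW.
have Lc r : 0 <= r <= 1 -> ev phi (k r) = 0 -> L (k r) by move=> r01 h; split => //; exact: kO.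
(* Otherwise the leaf is met both in [s, t] and in [t, 1]; a single crossing forces both at t, where
   phi is positive. *)
have ps : 0 < ev phi (k s).
  rewrite ltNge; apply/negP => ps.
  have [c' c't gc'] : exists2 c, s <= c <= t & ev phi (k c) = 0.
    apply: (@IVT0 g s t (ltW st)); first exact: cg.
    by left; rewrite ps ltW.
  have cc : c = c'.
    have c01 : 0 <= c <= 1 by move: ct => /andP[h ->]; rewrite andbT (le_trans s0)// (le_trans (ltW st)).
    have c01' : 0 <= c' <= 1 by move: c't => /andP[h h']; rewrite (le_trans s0 h) (le_trans h' t1).
    by apply: (once L _ _ lf c01 c01'); exact: Lc.
  have tc : c = t.
    by apply/eqP; rewrite eq_le; move: ct c't; rewrite -cc => /andP[-> _] /andP[_ ->].
  by rewrite -tc gc ltxx in pt.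
have dL : dual_point L (- phi).
  by split; [rewrite oppr_eq0|move=> v [_ h]; rewrite evNl h oppr0].
have pw : ev phi (Q w) <= 0.
  have := leaf_side lf dL O1 _ s1 Lw w1; rewrite !evNl; lra.
rewrite leNgt; apply/negP => neg.
set q := qplus D (k s) in Hqs Oqs Qqs asq.
pose r := ev phi (k s) / (ev phi (k s) - ev phi (Q w)).
have d : 0 < ev phi (k s) - ev phi (Q w) by rewrite subr_gt0 (le_lt_trans pw).
have r0 : 0 < r by rewrite divr_gt0.
have r1 : r <= 1 by rewrite ler_pdivrMr// mul1r lerDl oppr_ge0.
have Hm : H (seg q w r) by apply: hull_seg => //; [exact: hull_sub|rewrite (ltW r0)].
have pm : ev phi (Q (seg q w r)) = 0.
  by rewrite Q_seg seg_ev Qqs /r; field; rewrite gt_eqF.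
(* Over the crossing point of the leaf there is a point m of H with [at_] m = 0, while [as_] m >= 0.
   The difference [at_] - [as_] depends only on the projection, so its value at m is its value on
   the segment. *)
have [m [Hm' am Qm]] := chord _ (H_cl dX gL Hm) pm.
have d4 : ev (at_ - as_) e4 = 0 by rewrite evBl ate ase subrr.
have : ev (at_ - as_) (seg q w r) <= 0.
  by rewrite -ev_lsub// -Qm ev_lsub// evBl am sub0r oppr_le0; exact: asH.
rewrite evBl !seg_ev asq; have := atH _ Hqs; nra.
Qed.

(** If the cocycle vanished, the ends of k would share a supporting functional and the segment
    joining the points over them would lie in the sheet. Transversality puts the ends on opposite
    sides of the leaf, so this segment would contradict the rigidity of [leafP]. *)
Lemma cocycle_neq0 (k : R -> 'cV[R]_3) L :
  transverse_arc eta X f D k -> crosses_leaves_once eta X f D k ->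
  leaf eta X f D L -> crosses k L -> cocycle eta X f D k != 0.
Proof.
move=> [kO [kd _] nl0 nl1 ktr] once lL [t0 t01 Lt]; apply/eqP => k0.
have O0 : Om (k 0) by apply: kO; rewrite lexx ler01.
have O1 : Om (k 1) by apply: kO; rewrite lexx ler01.
have [phi [dL g0]] : exists phi, dual_point L phi /\ 0 < ev phi (k 0).
  have [phi dL] := leaf_dual_ex lL; have [LE _] := leaf_dual lL dL.
  have [h|h|h] := ltgtP 0 (ev phi (k 0)); first by exists phi.
    exists (- phi); rewrite evNl oppr_gt0; split => //; case: dL => p0 pL.
    by split; [rewrite oppr_eq0|move=> v /pL; rewrite evNl => ->; rewrite oppr0].
  by case: nl0; exists L => //; rewrite LE.
have [LE face] := leaf_dual lL dL.
have [s0 s1] := (alphaP O0, alphaP O1).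
set a0 := e *: _ in s0; set a1 := e *: _ in s1.
have E w : ev a1 w = ev a0 w.
  have := cocycle_ev w O0 O1; rewrite k0 ev0l /a0 /a1 !evZl => /esym/eqP.
  by rewrite subr_eq0 => /eqP ->.
pose g t := ev phi (k t).
have gO t : 0 <= t <= 1 -> g t = 0 -> t = t0.
  move=> t1 gt; apply: (once L) => //; rewrite LE; split => //; exact: kO.
have gt0 : g t0 = 0 by have := Lt; rewrite LE => -[].
have g1 : g 1 != 0.
  by apply: contra_notN nl1 => /eqP h; exists L => //; rewrite LE.
have t0in : 0 < t0 < 1.
  apply/andP; split; rewrite lt_neqAle; case/andP: t01 => h1 h2; rewrite ?h1 ?h2 andbT.
    by apply: contra_neq (negbT (gt_eqF g0)) => h; rewrite -[RHS]gt0 -h.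
  by apply: contra_neq g1 => h; rewrite -[RHS]gt0 h.
have t0i : t0 \in `]0, 1[%R by rewrite in_itv/=.
have dd a t : t \in `]0, 1[%R -> derivable (fun t => ev a (k t)) t 1.
  rewrite in_itv/= => /andP[h1 h2].
  by have [] := ev_path a (kd t _); rewrite ?(ltW h1) ?(ltW h2).
have [_ dg] := ev_path phi (kd _ t01); have [_ df] := ev_path f (kd _ t01).
(* f o k is constant, so t0 is one of its maxima. *)
have f0 : ev f ('D_1 k t0) = 0.
  rewrite -df; have h := @derive1_at_max R (fun t => ev f (k t)) 0 1 t0 ler01 (dd f) t0i.
  apply: (@derive_val _ _ _ _ _ _ _ (h _)) => t; rewrite in_itv/= => /andP[h1 h2].
  by rewrite (kO t0 t01).2 (kO t _).2// !ltW.
(* A derivative in the kernels of phi and f would point along the leaf. *)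
have g'0 : ev phi ('D_1 k t0) != 0.
  apply/eqP => p0.
  have [Ot _] : Om (k t0) /\ ev phi (k t0) = 0 by split; [exact: kO|].
  have [u u0 [fu pu]] := line_dir f phi.
  have [d d0 Od] := Om_dir dX Ot fu.
  have Ld : L (k t0 + d *: u).
    rewrite LE; split; first by apply: Od; rewrite ger0_norm// ltW.
    by rewrite evDr evZr pu mulr0 addr0.
  have fd : ev f (k t0 + d *: u) = 1 by rewrite evDr evZr fu mulr0 addr0; case: Ot.
  have yd : k t0 != k t0 + d *: u.
    by rewrite -subr_eq0 opprD addrA subrr add0r oppr_eq0 scaler_eq0 negb_or u0 gt_eqF.
  have [c hc] : exists c, k t0 + 'D_1 k t0 = seg (k t0) (k t0 + d *: u) c.
    apply: (line_mem Ot.2 fd yd dL.1) => //.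
    - by rewrite evDr evZr pu mulr0 addr0.
    - by rewrite evDr f0 addr0; case: Ot.
    - by rewrite evDr p0 addr0.
  apply: (ktr L t0 lL t01 Lt _ c Ld).
  by rewrite derive1E; apply: (addrI (k t0)); rewrite hc segE.
(* If g 1 > 0, a negative value of g would produce a zero on each side of it, while t0 is the only
   zero. So t0 would be an interior minimum, with derivative 0. *)
have g1n : g 1 < 0.
  have cg (a b : R) : 0 <= a -> b <= 1 -> {within `[a, b], continuous g}.
    by move=> *; exact: ev_path_continuous.
  rewrite lt_neqAle g1 leNgt; apply/negP => h1.
  move: g'0; rewrite -dg => /eqP; apply.
  apply: (@derive_val _ _ _ _ _ _ _ (derive1_at_min ler01 (dd phi) t0i _)) => t.
  rewrite -/(g t) -/(g t0) gt0 in_itv/= => /andP[t0' t1'].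
  rewrite leNgt; apply/negP => gt.
  have [c c1 gc] : exists2 c, 0 <= c <= t & g c = 0.
    by apply: IVT0; [exact: ltW|apply: cg => //; exact: ltW|right; rewrite !ltW].
  have [c' c'1 gc'] : exists2 c, t <= c <= 1 & g c = 0.
    by apply: IVT0; [exact: ltW|apply: cg => //; exact: ltW|left; rewrite !ltW].
  have E1 : c = t0 by apply: gO => //; case/andP: c1 => -> ct; rewrite (le_trans ct (ltW t1')).
  have E2 : c' = t0 by apply: gO => //; case/andP: c'1 => tc ->; rewrite (le_trans (ltW t0') tc).
  have tt : t = t0.
    by apply/eqP; rewrite eq_le -{1}E2 -E1; case/andP: c1 => _ ->; case/andP: c'1 => ->.
  by rewrite tt gt0 ltxx in gt.
have [[Hq0 Oq0 _] Qq0] := qplusP O0; have [[Hq1 Oq1 _] Qq1] := qplusP O1.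
pose r := g 0 / (g 0 - g 1).
have d : 0 < g 0 - g 1 by rewrite subr_gt0 (lt_trans g1n).
have r01 : 0 < r < 1.
  by apply/andP; split; [rewrite divr_gt0|rewrite ltr_pdivrMr// mul1r ltrDl oppr_gt0].
have gg : g 0 - g 1 != 0 by rewrite gt_eqF.
have Hy : H (seg (qplus D (k 0)) (qplus D (k 1)) r).
  by apply: hull_seg => //; case/andP: r01 => *; rewrite !ltW.
have Oy : Om (Q (seg (qplus D (k 0)) (qplus D (k 1)) r)).
  by rewrite Q_seg; apply: (Om_seg dX Oq0 (Om_cl Oq1)); case/andP: r01 => *; rewrite ltW.
have Dy : D (seg (qplus D (k 0)) (qplus D (k 1)) r).
  apply: (supp_sheet s0 Hy Oy); rewrite seg_ev -[X in _ + _ * X]E.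
  by case: s0 => _ _ ->; case: s1 => _ _ ->; ring.
have [] := face _ _ _ _ Dy _ Hq0 Hq1 r01 erefl.
  by rewrite LE; split => //; rewrite Q_seg seg_ev Qq0 Qq1 -/(g 0) -/(g 1) /r; field.
by rewrite Qq0 => h _; move: g0; rewrite h ltxx.
Qed.

End Cocycle.

(** * Norms and identities for cross products *)

Section CrossNorm.
Context {R : realType}.

Lemma cross_norm (u v : 'cV[R]_3) : `|cross u v| <= 2 * `|u| * `|v|.
Proof.
have h (i j k l : 'I_3) : `|u i 0 * v j 0 - u k 0 * v l 0| <= 2 * `|u| * `|v|.
  apply: le_trans (ler_normB _ _) _; rewrite !normrM mulr2n mulrDl mul1r mulrDl.
  by apply: lerD; apply: ler_pM => //; exact: coord_le_norm.
apply: norm_le_coord => [|i j]; first by rewrite !mulr_ge0.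
by rewrite ord1 {j}; move: i; apply: ord3; rewrite mxE/=; exact: h.
Qed.

Lemma cross_cross (a b c : 'cV[R]_3) :
  cross a (cross b c) = ev a^T c *: b - ev a^T b *: c.
Proof.
apply/matrixP => i j; rewrite ord1 {j}; move: i.
by apply: ord3; rewrite ?mxE/= ?mxE/= ?ev3 ?mxE/=; ring.
Qed.

Lemma crossDr (a b c : 'cV[R]_3) : cross a (b + c) = cross a b + cross a c.
Proof.
apply/matrixP => i j; rewrite ord1 {j}; move: i.
by apply: ord3; rewrite !mxE/=; ring.
Qed.

Lemma crossZr (a b : 'cV[R]_3) t : cross a (t *: b) = t *: cross a b.
Proof.
apply/matrixP => i j; rewrite ord1 {j}; move: i.
by apply: ord3; rewrite !mxE/=; ring.
Qed.

Lemma crossZl (a b : 'cV[R]_3) t : cross (t *: a) b = t *: cross a b.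
Proof.
apply/matrixP => i j; rewrite ord1 {j}; move: i.
by apply: ord3; rewrite !mxE/=; ring.
Qed.

End CrossNorm.

(** * Functionals nonnegative on a contact set are nearly parallel *)

Section Estimate.
Context {R : realType} {G : groupType}.
Local Notation e4 := (@e4 R).
Variables (eta : G -> 'M[R]_(3 + 1)) (X : set 'cV[R]_3) (f : 'rV[R]_3).
Local Notation Om := (in_chart f X).
Local Notation cOm := (cl_chart X f).
Local Notation bOm := (bd_chart X f).
Local Notation Lam := (limit_curve eta X `&` chart4 f).
Local Notation H := (convex_hull Lam).
Hypothesis (dX : convex_domain X f) (gL : limit_graph X f Lam).
Variables (e : R).
Hypothesis (e1 : e = 1 \/ e = -1).
Local Notation D := (sheet X f Lam e).

Lemma bd_closed : closed bOm.
Proof.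
have -> : bOm = cOm `&` ~` X.
  apply/seteqP; split=> v.
    by move=> bv; split; [exact: bd_cl|case: bv => -[]].
  by move=> [cv nX]; have [[]|] := cl_cases cv.
apply: closedI; first exact: cl_chart_closed.
by apply: open_closedC; exact: (domain_open dX).
Qed.

Lemma bd_compact : compact bOm.
Proof.
apply: (subclosed_compact bd_closed (cl_chart_compact dX)).
by move=> v; exact: bd_cl.
Qed.

Lemma bd_dist K : compact K -> K `<=` Om ->
  exists2 r : R, 0 < r & forall x v, K x -> bOm v -> r <= `|v - x|.
Proof.
move=> cK KO; have [E0|/set0P E0] := eqVneq (K `*` bOm) set0.
  exists 1 => // x v Kx bv; have : (K `*` bOm) (x, v) by [].
  by rewrite E0.
have [[x v] /set_mem [/= Kx bv] xm] : exists2 c, c \in K `*` bOm &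
    forall t, t \in K `*` bOm -> `|c.2 - c.1| <= `|t.2 - t.1|.
  apply: compact_EVT_min => //; first by apply: compact_setX => //; exact: bd_compact.
  apply: continuous_subspaceT => z.
  apply: (@cvg_norm _ _ _ (nbhs z) _ (fun t : 'cV[R]_3 * 'cV[R]_3 => t.2 - t.1)).
  by apply: cvgB; [exact: cvg_snd|exact: cvg_fst].
exists (`|v - x|).
  by rewrite normr_gt0 subr_eq0; apply: contra_notN (bd_notin bv) => /eqP ->; exact: KO.
by move=> y w Ky bw; apply: (xm (y, w)); rewrite inE.
Qed.

(** With m the cross product of phi and psi, y x m = psi(y) phi - phi(y) psi for every y. At y = x
    this is small, so m is nearly mu x. At contact points it bounds mu |y - x| in terms of phi(y)
    and psi(y), and averaging over the contact points to x bounds mu. *)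
Lemma cross_estimate K : compact K -> K `<=` Om ->
  exists2 C : R, 0 <= C & forall x a (phi psi : 'rV[R]_3) d, K x ->
    supp eta X f e x a -> 0 <= d ->
    (forall w, Lam w -> ev a w = 0 -> 0 <= ev phi (Q w)) ->
    (forall w, Lam w -> ev a w = 0 -> 0 <= ev psi (Q w)) ->
    ev phi x <= d * `|phi| -> ev psi x <= d * `|psi| ->
    `|cross phi^T psi^T| <= C * d * `|phi| * `|psi|.
Proof.
move=> cK KO; have [r r0 rK] := bd_dist cK KO.
have [M0 [_ M0b]] := compact_bounded (cl_chart_compact dX).
pose M : R := `|M0| + 1; have M_ge0 : 0 <= M by rewrite addr_ge0.
have cM v : cOm v -> `|v| <= M.
  by move=> cv; apply: M0b => //; rewrite /M; have := ler_norm M0; lra.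
pose F : R := `|f|; have F0 : 0 <= F by exact: normr_ge0.
have E0 : 0 <= 4 * F + 16 * M * F ^+ 2 by have := mulr_ge0 M_ge0 (sqr_ge0 F); lra.
(* r is the distance from K to the boundary, M bounds the chart closure, F is the norm of f. The
   first term comes from mu x, the second from m'. *)
exists ((4 * F + 16 * M * F ^+ 2) * M / r + 4 * F).
  by apply: addr_ge0; [exact: divr_ge0 (mulr_ge0 E0 M_ge0) (ltW r0)|lra].
move=> x a phi psi d Kx sa d0 phiC psiC phid psid.
have Ox := KO _ Kx; have [[Hq Oq _] Qq] := qplusP dX gL e1 Ox.
have [aL _ aq] := sa.
have phix : 0 <= ev phi x by rewrite -Qq; exact: (contact_ge0 aL phiC Hq aq).
have psix : 0 <= ev psi x by rewrite -Qq; exact: (contact_ge0 aL psiC Hq aq).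
set N1 := `|phi| in phid *; set N2 := `|psi| in psid *.
have N10 : 0 <= N1 by exact: normr_ge0.
have N20 : 0 <= N2 by exact: normr_ge0.
pose T : R := d * N1 * N2; have T0 : 0 <= T by rewrite !mulr_ge0.
have trn (b : 'rV[R]_3) : `|b^T| <= `|b| by exact: trmx_norm.
set m := cross phi^T psi^T; pose mu := ev f m; pose m' := m - mu *: x.
have crm y : 0 <= ev phi y -> 0 <= ev psi y ->
    `|cross y m| <= ev psi y * N1 + ev phi y * N2.
  move=> p1 p2; rewrite /m cross_cross.
  rewrite (ev_trC y psi^T) (ev_trC y phi^T) !trmxK.
  apply: le_trans (ler_normB _ _) _; rewrite !normrZ !ger0_norm//.
  by apply: lerD; apply: ler_wpM2l.
have m'n : `|m'| <= 4 * F * T.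
  have -> : m' = - cross f^T (cross x m).
    by rewrite cross_cross trmxK Ox.2 scale1r opprB.
  rewrite normrN; apply: le_trans (cross_norm _ _) _.
  have h1 : `|cross x m| <= 2 * T.
    apply: le_trans (crm _ phix psix) _; rewrite /T; nra.
  have := trn f; rewrite -/F => h2.
  apply: le_trans (_ : 2 * F * (2 * T) <= _); last by lra.
  by apply: ler_pM => //; rewrite ?mulr_ge0// ler_wpM2l.
have mE : m = mu *: x + m' by rewrite /m' addrC subrK.
(* The bound at contact points, with |y - x| replaced by r, written as nonnegativity of a linear
   functional; f carries the constants. The factor 16 is 2 . 2 . 4: two uses of [cross_norm] and the
   bound on m'. *)
pose c : 'rV[R]_3 := (2 * F * N1) *: psi + (2 * F * N2) *: phi +
  (16 * M * F ^+ 2 * T - `|mu| * r) *: f.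
have cC w : Lam w -> ev a w = 0 -> 0 <= ev c (Q w).
  move=> Lw aw; have bw := graph_bd gL Lw; have cw := cM _ (bd_cl bw).
  rewrite /c !evDl !evZl bw.2 mulr1.
  set y := Q w in bw cw *.
  have p1 : 0 <= ev phi y by exact: phiC. have p2 : 0 <= ev psi y by exact: psiC.
  have h1 : `|mu| * r <= `|mu| * `|y - x| by rewrite ler_wpM2l// rK.
  have h2 : `|mu| * `|y - x| <= 2 * F * `|mu *: cross y x|.
    have -> : y - x = cross f^T (cross y x).
      by rewrite cross_cross trmxK bw.2 Ox.2 !scale1r.
    rewrite normrZ mulrCA ler_wpM2l//; apply: le_trans (cross_norm _ _) _.
    by rewrite ler_wpM2r// ler_wpM2l// trn.
  have h3 : `|mu *: cross y x| <= ev psi y * N1 + ev phi y * N2 + 2 * M * (4 * F * T).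
    have -> : mu *: cross y x = cross y m - cross y m'.
      by rewrite [in cross y m]mE crossDr crossZr addrK.
    apply: le_trans (ler_normB _ _) _; apply: lerD; first exact: crm.
    apply: le_trans (cross_norm _ _) _.
    by apply: ler_pM => //; rewrite ?mulr_ge0// ler_wpM2l.
  have h4 : 2 * F * `|mu *: cross y x| <=
      2 * F * (ev psi y * N1 + ev phi y * N2 + 2 * M * (4 * F * T)).
    by rewrite ler_wpM2l// mulr_ge0.
  have := le_trans h1 (le_trans h2 h4).
  set z := _ * r; set p := ev phi y; set q := ev psi y => h.
  rewrite -subr_ge0 in h.
  by apply: le_trans h _; rewrite le_eqVlt; apply/orP; left; apply/eqP; ring.
have := contact_ge0 aL cC Hq aq; rewrite Qq /c !evDl !evZl Ox.2 mulr1 => h.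
have h5 : `|mu| * r <= (4 * F + 16 * M * F ^+ 2) * T.
  have e3 : 2 * F * N1 * ev psi x <= 2 * F * T.
    by rewrite -mulrA ler_wpM2l ?mulr_ge0// /T; nra.
  have e4 : 2 * F * N2 * ev phi x <= 2 * F * T.
    by rewrite -mulrA ler_wpM2l ?mulr_ge0// /T; nra.
  lra.
have h6 : `|mu| <= (4 * F + 16 * M * F ^+ 2) * T / r by rewrite ler_pdivlMr.
rewrite mE; apply: le_trans (ler_normD _ _) _; rewrite normrZ.
have -> : ((4 * F + 16 * M * F ^+ 2) * M / r + 4 * F) * d * N1 * N2 =
  (4 * F + 16 * M * F ^+ 2) * T / r * M + 4 * F * T.
  by rewrite /T; field; rewrite gt_eqF.
by apply: lerD => //; apply: ler_pM => //; exact: cM (Om_cl Ox).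
Qed.

End Estimate.

(** * Riemannian and hyperbolic distances *)

Section Riemannian.
Context {R : realType}.

Lemma seg_is_derive m n (p q : 'M[R]_(m, n)) (t : R) :
  derivable (seg p q) t 1 /\ derive1 (seg p q) t = q - p.
Proof.
have h : (fun h => h^-1 *: ((seg p q \o shift t) (h *: 1) - seg p q t)) @ 0^' --> q - p.
  apply: cvg_trans (@cvg_cst _ (q - p) _ (0^') _); apply: near_eq_cvg.
  near=> h; have h0 : h != 0 by near: h; exact: nbhs_dnbhs_neq.
  rewrite /= !segE opprD addrACA subrr add0r -scalerBl /shift/= addrK.
  by rewrite scalerA [h *: 1]mulr1 mulVf// scale1r.
split; first by apply/cvg_ex; exists (q - p).
by rewrite derive1E; apply/cvg_lim.
Unshelve. all: by end_near. Qed.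

Lemma norm_sq_ge (u : 'cV[R]_3) : `|u| ^+ 2 <= ev u^T u.
Proof.
rewrite -[ev _ _]sqr_sqrtr ?ev_tr_ge0// ler_pXn2r ?nnegrE ?sqrtr_ge0//.
apply: norm_le_coord => [|i j]; first exact: sqrtr_ge0.
rewrite ord1 -sqrtr_sqr ler_wsqrtr// ev_tr (bigD1 i)//= expr2 lerDl.
by apply: sumr_ge0 => k _; rewrite -expr2 sqr_ge0.
Qed.

Lemma norm_sq_le (u : 'cV[R]_3) : ev u^T u <= 3 * `|u| ^+ 2.
Proof.
rewrite ev_tr sum3; have h i : u i 0 * u i 0 <= `|u| ^+ 2.
  by rewrite -expr2 -[u i 0 ^+ 2]real_normK ?num_real// ler_pXn2r ?nnegrE// coord_le_norm.
have := h o0; have := h o1; have := h o2; lra.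
Qed.

Lemma cross_normsq (u v : 'cV[R]_3) :
  ev (cross u v)^T (cross u v) = ev u^T u * ev v^T v - ev u^T v ^+ 2.
Proof. by rewrite !ev3 !mxE/=; ring. Qed.

Lemma quad_bound (B : 'M[R]_3) (u : 'rV[R]_3) M : (forall i j, `|B i j| <= M) ->
  `|quad B u| <= 9 * M * `|u| ^+ 2.
Proof.
move=> BM; have M0 : 0 <= M by exact: le_trans (BM o0 o0).
rewrite /quad mxE; apply: le_trans (ler_norm_sum _ _ _) _.
have h k : `|(u *m B) 0 k * u^T k 0| <= 3 * M * `|u| ^+ 2.
  rewrite normrM [u^T _ _]mxE expr2 mulrA; apply: ler_pM => //; last exact: coord_le_norm.
  rewrite mxE; apply: le_trans (ler_norm_sum _ _ _) _.
  have h2 j : `|u 0 j * B j k| <= M * `|u|.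
    by rewrite normrM mulrC; apply: ler_pM => //; exact: coord_le_norm.
  by rewrite sum3; have := h2 o0; have := h2 o1; have := h2 o2; lra.
by rewrite sum3; have := h o0; have := h o1; have := h o2; lra.
Qed.

Lemma Rint01_cst (c : R) : \int[@lebesgue_measure R]_(t in `[0, 1]) c = c.
Proof.
rewrite Rintegral_cst//.
have -> : fine (@lebesgue_measure R `[0, 1]%classic) = 1.
  by rewrite lebesgue_measure_itv/= lte_fin ltr01/= oppr0 addr0.
by rewrite mulr1.
Qed.

(** The distance is at most the length of the straight segment between Euclidean unit
    representatives of the two points, and that chord is controlled by the sine of the angle, the
    norm of the cross product. *)
Lemma riemannian_bound (dP : 'rV[R]_3 -> 'rV[R]_3 -> R) : riemannian_distance dP ->
  exists2 C : R, 0 <= C & forall p q, p != 0 -> q != 0 ->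
    dP p q <= C * (`|cross p^T q^T| / (`|p| * `|q|)).
Proof.
move=> [B [Bs _ Bq _ _] dPE].
pose N (c : 'rV[R]_3) := ev c c^T.
have N0 c : 0 <= N c by rewrite /N -{1}[c]trmxK ev_tr_ge0.
have N_eq0 c : N c = 0 -> c = 0.
  by rewrite /N -{1}[c]trmxK => /ev_tr_eq0 /eqP; rewrite trmx_eq0 => /eqP.
have Ncont : continuous N.
  move=> x; apply: (@cvg_ev _ _ _ (nbhs x) _ id trmx); first exact: cvg_id.
  exact: trmx_continuous.
have Nn c : `|c| ^+ 2 <= N c.
  rewrite /N -{2}[c]trmxK; apply: le_trans (norm_sq_ge _).
  rewrite ler_pXn2r ?nnegrE//; rewrite -{1}[c]trmxK; exact: trmx_norm.
(* A segment between unit vectors at an acute or right angle stays in this shell, which is compact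
   and avoids 0, so the metric is bounded there. *)
pose A := [set c | 1 / 2 <= N c] `&` [set c | N c <= 1].
have Ac : compact A.
  apply: bounded_closed_compact.
    exists 1; split => // x x1 c [_ /= c1]; apply: le_trans (ltW x1).
    by rewrite -(@ler_pXn2r _ 2) ?nnegrE// expr1n (le_trans (Nn c) c1).
  apply: closedI.
    by apply: (@preimage_closed _ _ N [set x | 1 / 2 <= x]); [move=> ? _; exact: Ncont|exact: closed_ge].
  by apply: (@preimage_closed _ _ N [set x | x <= 1]); [move=> ? _; exact: Ncont|exact: closed_le].
have A0 c : A c -> c != 0.
  by move=> [/= h _]; apply: contraTneq h => ->; rewrite /N ev0l; lra.
have BA i j : exists M, forall c, A c -> `|B c i j| <= M.
  have cB : {within A, continuous (fun c => B c i j)}.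
    by apply: continuous_in_subspaceT => c /set_mem Ac'; apply: (Bs i j 0%N); exact: A0.
  have [M [_ bM]] := compact_bounded (continuous_compact cB Ac).
  exists (`|M| + 1) => c Ac'; apply: bM; last by exists c.
  by have := ler_norm M; lra.
have [M BM] : exists M, forall c, A c -> forall i j, `|B c i j| <= M.
  have /choice [g gP] : forall ij : 'I_3 * 'I_3, exists M, forall c, A c -> `|B c ij.1 ij.2| <= M.
    by move=> ij; exact: BA.
  exists (\sum_ij `|g ij|) => c Ac' i j; apply: le_trans (gP (i, j) _ Ac') _.
  rewrite (bigD1 (i, j))//=; apply: le_trans (ler_norm _) _.
  by rewrite lerDl sumr_ge0.
pose C1 := Num.sqrt (9 * `|M|).
have C10 : 0 <= C1 by exact: sqrtr_ge0.
exists (C1 * 3); first by rewrite mulr_ge0.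
move=> p q p0 q0; rewrite dPE//.
have Np : 0 < N p by rewrite lt_neqAle N0 andbT eq_sym; apply: contra_neq p0; exact: N_eq0.
have Nq : 0 < N q by rewrite lt_neqAle N0 andbT eq_sym; apply: contra_neq q0; exact: N_eq0.
pose a := Num.sqrt (N p); pose b0 := Num.sqrt (N q).
have a0 : 0 < a by rewrite sqrtr_gt0. have b00 : 0 < b0 by rewrite sqrtr_gt0.
have a2 : a ^+ 2 = N p by rewrite sqr_sqrtr. have b02 : b0 ^+ 2 = N q by rewrite sqr_sqrtr.
pose ip := ev p q^T.
(* The sign of the representative of q is free; it is chosen so that the angle with p' is at most a
   right angle. *)
have [b [bn0 bE bip]] : exists b : R, [/\ b != 0, b ^+ 2 = N q & 0 <= ip / (a * b)].
  have [h|h] := leP 0 ip.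
    by exists b0; split=> //; [rewrite gt_eqF|rewrite divr_ge0// mulr_ge0// ltW].
  exists (- b0); split; [by rewrite oppr_eq0 gt_eqF|by rewrite sqrrN|].
  by rewrite mulrN invrN mulrN -mulNr divr_ge0 ?mulr_ge0 ?oppr_ge0// ltW.
have an0 : a != 0 by rewrite gt_eqF.
pose p' := a^-1 *: p; pose q' := b^-1 *: q; pose co := ip / (a * b).
have Np' : N p' = 1.
  by rewrite /N /p' linearZ/= evZl evZr -/(N p) -a2; field.
have Nq' : N q' = 1.
  by rewrite /N /q' linearZ/= evZl evZr -/(N q) -bE; field.
have ipE : ev p' q'^T = co.
  by rewrite /p' /q' linearZ/= evZl evZr -/ip /co; field; rewrite an0 bn0.
have ipC : ev q' p'^T = co.
  by rewrite -ipE -{1}[q']trmxK ev_trC trmxK.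
have Ep : ev p' p'^T = 1 by exact: Np'.
have Eq : ev q' q'^T = 1 by exact: Nq'.
have NSg (x y : 'rV[R]_3) (c t : R) : ev x x^T = 1 -> ev y y^T = 1 -> ev x y^T = c ->
    ev y x^T = c -> N (seg x y t) = 1 - 2 * t * (1 - t) * (1 - c).
  move=> xx yy xy yx.
  have sT : (seg x y t)^T = (1 - t) *: x^T + t *: y^T by apply/matrixP => i j; rewrite !mxE.
  by rewrite /N sT /seg !evDl !evZl !evDr !evZr xx yy xy yx; ring.
have NS t : N (seg p' q' t) = 1 - 2 * t * (1 - t) * (1 - co) by exact: NSg.
have crE : ev (cross p'^T q'^T)^T (cross p'^T q'^T) = 1 - co ^+ 2.
  by rewrite cross_normsq !trmxK Ep Eq ipE mulr1.
have co1 : co <= 1.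
  rewrite leNgt; apply/negP => h; have := ev_tr_ge0 (cross p'^T q'^T).
  by rewrite crE; nra.
have cA t : 0 <= t <= 1 -> A (seg p' q' t).
  move=> t01; rewrite /A /= !NS.
  have h1 : t * (1 - t) <= 1 / 4 by have := sqr_ge0 (t - 1 / 2); nra.
  have h2 : 0 <= t * (1 - t) by case/andP: t01 => *; rewrite mulr_ge0// subr_ge0.
  have h3 : 0 <= t * (1 - t) * (1 - co) by rewrite mulr_ge0// subr_ge0.
  have h4 : t * (1 - t) * (1 - co) <= 1 / 4 * 1 by apply: ler_pM => //; [rewrite subr_ge0|rewrite /co lerBlDr lerDl].
  have -> : 2 * t * (1 - t) * (1 - co) = 2 * (t * (1 - t) * (1 - co)) by ring.
  by clear -h3 h4; split; lra.
pose u := q' - p'.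
pose len := \int[@lebesgue_measure R]_(t in `[0, 1])
  Num.sqrt (quad (B (seg p' q' t)) (derive1 (seg p' q') t)).
have lenE : len = \int[@lebesgue_measure R]_(t in `[0, 1]) Num.sqrt (quad (B (seg p' q' t)) u).
  by apply: eq_Rintegral => t _; rewrite (seg_is_derive p' q' t).2.
have hlen : inf [set len | exists c : R -> 'rV[R]_3,
        [/\ C1_path c, forall t, 0 <= t <= 1 -> c t != 0, same_pt p (c 0), same_pt q (c 1) &
            len = \int[@lebesgue_measure R]_(t in `[0, 1])
                    Num.sqrt (quad (B (c t)) (derive1 c t))]] <= len.
  apply: ge_inf.
    exists 0 => _ [c [_ _ _ _ ->]]; apply: Rintegral_ge0 => t _; exact: sqrtr_ge0.
  exists (seg p' q'); split; last by [].
  - split=> [t _|]; first exact: (seg_is_derive p' q' t).1.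
    apply: continuous_subspaceT => t.
    have -> : derive1 (seg p' q') = cst u by apply/funext => s; exact: (seg_is_derive p' q' s).2.
    exact: cvg_cst.
  - by move=> t t01; apply: A0; exact: cA.
  - by exists a^-1; rewrite invr_eq0 seg0.
  - by exists b^-1; rewrite invr_eq0 seg1.
apply: le_trans hlen _; rewrite lenE.
have cu (t : R) : 0 <= t <= 1 -> Num.sqrt (quad (B (seg p' q' t)) u) <= C1 * `|u|.
  move=> t01; apply: le_trans (_ : Num.sqrt (9 * `|M| * `|u| ^+ 2) <= _); last first.
    by rewrite sqrtrM ?mulr_ge0// sqrtr_sqr normr_id.
  apply: ler_wsqrtr; apply: le_trans (ler_norm _) _; apply: quad_bound => i j.
  exact: le_trans (BM _ (cA _ t01) i j) (ler_norm _).
have segc (t : R) : seg p' q' @ t --> seg p' q' t.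
  by apply: path_continuous; exact: (seg_is_derive p' q' t).1.
have int1 : (@lebesgue_measure R).-integrable `[0, 1]
    (EFin \o (fun t => Num.sqrt (quad (B (seg p' q' t)) u))).
  apply: continuous_compact_integrable; first exact: segment_compact.
  apply: continuous_in_subspaceT => t /set_mem; rewrite /= in_itv/= => t01.
  apply: (@cvg_comp _ _ _ (fun t => quad (B (seg p' q' t)) u) Num.sqrt _ (nbhs (quad (B (seg p' q' t)) u)) _ _); last exact: sqrt_continuous.
  apply: cvg_coord; apply: cvg_mulmx; last exact: cvg_cst.
  apply: cvg_mulmx; first exact: cvg_cst.
  apply: cvg_mx => i j.
  have Bc : {for seg p' q' t, continuous (fun c => B c i j)}.
    by apply: (Bs i j 0%N); apply: A0; exact: cA.
  by move=> V /Bc nV; exact: (segc t _ nV).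
apply: le_trans (_ : \int[@lebesgue_measure R]_(t in `[0, 1]) (C1 * `|u|) <= _).
  apply: le_Rintegral => //.
    apply: continuous_compact_integrable; first exact: segment_compact.
    by apply: continuous_subspaceT => t; exact: cvg_cst.
rewrite Rint01_cst -mulrA ler_wpM2l//.
have ncr : `|cross p'^T q'^T| <= `|cross p^T q^T| / (`|p| * `|q|).
  rewrite /p' /q' !linearZ/= crossZl crossZr !normrZ mulrA mulrC.
  rewrite ler_wpM2l// -normrM -invfM normfV lef_pV2 ?posrE ?mulr_gt0 ?normr_gt0 ?mulf_neq0//.
  rewrite normrM; have sq (c : 'rV[R]_3) (s : R) : s ^+ 2 = N c -> `|c| <= `|s|.
    move=> sE; have := Nn c; rewrite -sE -[s ^+ 2]real_normK ?num_real//.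
    by rewrite ler_pXn2r ?nnegrE.
  by rewrite mulrC [`|a| * _]mulrC ler_pM// sq.
apply: le_trans (_ : 3 * `|cross p'^T q'^T| <= _); last by rewrite ler_wpM2l.
(* As co >= 0, the squared chord 2 (1 - co) is at most 2 (1 - co^2). The squared Euclidean norm 1 -
   co^2 of the cross product is at most 3 times its squared sup norm, and 6 <= 9. *)
suff h : `|u| ^+ 2 <= (3 * `|cross p'^T q'^T|) ^+ 2.
  by move: h; rewrite ler_pXn2r ?nnegrE ?mulr_ge0 ?normr_ge0.
apply: le_trans (Nn u) _.
have -> : N u = 2 - 2 * co.
  have sT : u^T = q'^T - p'^T by rewrite linearB.
  by rewrite /N sT /u !evBl !evBr Ep Eq ipE ipC; ring.
have cc : 0 <= co * (1 - co) by rewrite mulr_ge0// subr_ge0.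
have c2 : 0 <= `|cross p'^T q'^T| ^+ 2 by exact: sqr_ge0.
have := norm_sq_le (cross p'^T q'^T); rewrite crE [(3 * _) ^+ 2]exprMn.
have -> : 1 - co ^+ 2 = 1 - co + co * (1 - co) by ring.
have -> : 3 ^+ 2 = 9 :> R by ring.
clear -cc c2; lra.
Qed.

End Riemannian.

Section Hyperbolic.
Context {R : realType}.

(** Apply v / (1 + v) <= ln (1 + v) <= v to v = s + sqrt (s^2 + 2 s), which is at least sqrt (2
    s). *)
Lemma acosh_bounds (s : R) : 0 <= s ->
  Num.sqrt (2 * s) / (1 + s + Num.sqrt (s ^+ 2 + 2 * s)) <= acosh (1 + s) /\
  acosh (1 + s) <= s + Num.sqrt (s ^+ 2 + 2 * s).
Proof.
move=> s0; rewrite /acosh; have -> : (1 + s) ^+ 2 - 1 = s ^+ 2 + 2 * s by ring.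
set w := Num.sqrt (s ^+ 2 + 2 * s); have w0 : 0 <= w by exact: sqrtr_ge0.
pose v := s + w; have v0 : 0 <= v by rewrite addr_ge0.
have vw : Num.sqrt (2 * s) <= v.
  by apply: le_trans (_ : w <= _); [apply: ler_wsqrtr; rewrite lerDr sqr_ge0|rewrite /v lerDr].
have v1 : 0 < 1 + v by lra.
rewrite -[1 + s + w]addrA -/v; split.
  apply: le_trans (_ : v / (1 + v) <= _); first by rewrite ler_wpM2r// invr_ge0 ltW.
  rewrite -ler_expR lnK ?posrE// -lef_pV2 ?posrE ?expR_gt0// -expRN.
  apply: le_trans (expR_ge1Dx _); rewrite le_eqVlt; apply/orP; left; apply/eqP.
  by field; rewrite gt_eqF.
rewrite -ler_expR lnK ?posrE//; exact: expR_ge1Dx.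
Qed.

Lemma rV2E (u : 'rV[R]_2) : u = u 0 0 *: delta_mx 0 0 + u 0 1 *: delta_mx 0 1.
Proof.
rewrite [LHS]row_sum_delta !big_ord_recl big_ord0 addr0.
by have -> : lift ord0 ord0 = 1 :> 'I_2 by exact: val_inj.
Qed.

(** Mean value theorem along the segment, with the partial derivatives bounded on A. *)
Lemma deriv_bound (g : 'rV[R]_2 -> R) (U A : set 'rV[R]_2) :
  compact A -> convex_set A -> A `<=` U -> Ck 1 U g ->
  exists2 C : R, 0 <= C & forall z w, A z -> A w -> `|g z - g w| <= C * `|z - w|.
Proof.
move=> cA /convexP vA AU [gd gc].
have bd j : exists2 M, 0 <= M & forall z, A z -> `|'D_(delta_mx 0 j) g z| <= M.
  have cj : {within A, continuous (fun z => 'D_(delta_mx 0 j) g z)}.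
    by apply: continuous_in_subspaceT => z /set_mem Az; apply: gc; exact: AU.
  have [M [_ bM]] := compact_bounded (continuous_compact cj cA).
  exists (`|M| + 1) => [|z Az]; first by rewrite addr_ge0.
  by apply: bM; [have := ler_norm M; lra|exists z].
have [M0 M00 B0] := bd 0; have [M1 M10 B1] := bd 1.
exists (M0 + M1) => [|z w Az Aw]; first exact: addr_ge0.
pose h (t : R) := g (seg w z t).
have Ah (t : R) : 0 <= t <= 1 -> A (seg w z t) by move=> t01; exact: vA.
have hd (t : R) : 0 <= t <= 1 -> is_derive t 1 h ('D_(z - w) g (seg w z t)).
  move=> t01; have dg := gd _ (AU _ (Ah _ t01)).
  have [ds dsE] := seg_is_derive w z t.
  have dsd : differentiable (seg w z) t by apply/derivable1_diffP.
  have dh : differentiable (g \o seg w z) t by exact: differentiable_comp.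
  apply: DeriveDef; first by apply/derivable1_diffP.
  rewrite (deriveE _ dh) diff_comp// (deriveE _ dg) /=; congr ('d g _ _).
  by rewrite -(deriveE _ dsd) -derive1E dsE.
have hc : {within `[0, 1], continuous h}.
  apply: continuous_in_subspaceT => t /set_mem; rewrite /= in_itv/= => t01.
  by have [dh _] := hd t t01; apply/differentiable_continuous/derivable1_diffP.
have hd' (t : R) : t \in `]0, 1[%R -> is_derive t 1 h ('D_(z - w) g (seg w z t)).
  by rewrite in_itv/= => /andP[? ?]; apply: hd; rewrite !ltW.
have [t t01 E] := MVT_segment ler01 hd' hc.
move: E; rewrite /h seg0 seg1 subr0 mulr1 => ->.
rewrite in_itv/= in t01; have dg := gd _ (AU _ (Ah _ t01)).
rewrite {1}[z - w]rV2E.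
set u := z - w; rewrite (deriveE _ dg) linearD !linearZ/= -!(deriveE _ dg).
apply: le_trans (ler_normD _ _) _; rewrite !normrM mulrDl.
apply: lerD; rewrite mulrC; apply: ler_pM => //.
- exact: B0 (Ah _ t01).
- exact: coord_le_norm.
- exact: B1 (Ah _ t01).
- exact: coord_le_norm.
Qed.

(** On a compact part of the half plane, [half_plane_dist] dominates a multiple of the Euclidean
    distance and is bounded. The inverse [sec] of the developing map is Lipschitz there, which
    brings the comparison back to the chart. *)
Lemma hyperbolic_bounds (G : groupType) (rho : G -> 'M[R]_3) (X : set 'cV[R]_3)
    (f : 'rV[R]_3) (dS : 'cV[R]_3 -> 'cV[R]_3 -> R) (K : set 'cV[R]_3) :
  convex_domain X f -> lifted_hyperbolic_distance rho X dS -> compact K ->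
  K `<=` in_chart f X -> exists C M : R, [/\ 0 <= C, 0 <= M &
    forall x y, K x -> K y -> `|x - y| <= C * dS x y /\ dS x y <= M].
Proof.
move=> dX [dev [sec [[devS devH devZ] [secS secX secP] _ dSE]]] cK KO.
have KX x : K x -> X x by move=> /KO [].
pose K' := dev @` K.
have cK' : compact K'.
  apply: continuous_compact => //; apply: continuous_in_subspaceT => x /set_mem Kx.
  by apply: (@cvg_mx _ _ 1 2 (nbhs x)) => i j; rewrite ord1; apply: (devS j 0%N); exact: KX.
have K'H z : K' z -> 0 < z 0 1 by move=> [x /KX /devH h <-].
have [A [A0 AK]] : exists A : R, 0 <= A /\ forall z, K' z -> `|z| <= A.
  have [M [_ bM]] := compact_bounded cK'; exists (`|M| + 1); split=> [|z Kz].
    by rewrite addr_ge0.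
  by apply: bM => //; have := ler_norm M; lra.
have [K0|/set0P K0] := eqVneq K' set0.
  exists 0, 0; split => // x y Kx; have : K' (dev x) by exists x.
  by rewrite K0.
have [z0 /set_mem Kz0 zmin] : exists2 c, c \in K' & forall t, t \in K' -> c 0 1 <= t 0 1.
  by apply: compact_EVT_min => //; apply: continuous_subspaceT; exact: coord_continuous.
pose ep := z0 0 1; have ep0 : 0 < ep by exact: K'H.
have epK z : K' z -> ep <= z 0 1 by move=> Kz; apply: zmin; exact: mem_set.
(* The image of K need not be convex, as [deriv_bound] demands; this convex compact set of the half
   plane contains it. *)
pose Bx := [set z : 'rV[R]_2 | `|z| <= A] `&` [set z | ep <= z 0 1].
have Bc : compact Bx.
  apply: bounded_closed_compact.
    by exists A; split; [exact: num_real|move=> x x1 c [/= c1 _]; apply: le_trans c1 (ltW x1)].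
  apply: closedI.
    by apply: (@preimage_closed _ _ (fun z : 'rV[R]_2 => `|z|) [set x | x <= A]);
      [move=> ? _; exact: norm_continuous|exact: closed_le].
  by apply: (@preimage_closed _ _ (fun z : 'rV[R]_2 => z 0 1) [set x | ep <= x]);
    [move=> ? _; exact: coord_continuous|exact: closed_ge].
have Bv : convex_set Bx.
  apply/convexP => z w s [/= z1 z2] [/= w1 w2] /andP[s0 s1]; split.
    rewrite /= /seg; apply: le_trans (ler_normD _ _) _; rewrite !normrZ !ger0_norm ?subr_ge0//.
    by nra.
  by rewrite /= !mxE; nra.
have BH : Bx `<=` half_plane by move=> z [_ /= h]; rewrite /half_plane/=; exact: lt_le_trans h.
have K'B z : K' z -> Bx z by move=> Kz; split; [exact: AK|exact: epK].
have [Ls Ls0 LsB] : exists2 L : R, 0 <= L & forall z w, Bx z -> Bx w ->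
    `|sec z - sec w| <= L * `|z - w|.
  have hi i : exists2 L : R, 0 <= L & forall z w, Bx z -> Bx w ->
      `|sec z i 0 - sec w i 0| <= L * `|z - w|.
    exact: (deriv_bound Bc Bv BH (secS i 1%N)).
  have [l0 l00 h0] := hi o0; have [l1 l10 h1] := hi o1; have [l2 l20 h2] := hi o2.
  exists (l0 + l1 + l2); first by rewrite !addr_ge0.
  move=> z w Bz Bw; have n0 := normr_ge0 (z - w).
  have := mulr_ge0 l00 n0; have := mulr_ge0 l10 n0; have := mulr_ge0 l20 n0 => p2 p1 p0.
  apply: norm_le_coord; first by rewrite !mulrDl; lra.
  move=> i j; rewrite ord1 {j} !mxE; move: i; apply: ord3.
  - by have := h0 _ _ Bz Bw; rewrite !mulrDl; lra.
  - by have := h1 _ _ Bz Bw; rewrite !mulrDl; lra.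
  - by have := h2 _ _ Bz Bw; rewrite !mulrDl; lra.
have secC : {within Bx, continuous sec}.
  apply: continuous_in_subspaceT => z /set_mem Bz.
  by apply: (@cvg_mx _ _ 3 1 (nbhs z)) => i j; rewrite ord1; apply: (secS i 0%N); exact: BH.
have [Sm [Sm0 SmB]] : exists A : R, 0 <= A /\ forall z, Bx z -> `|sec z| <= A.
  have [M [_ bM]] := compact_bounded (continuous_compact secC Bc).
  exists (`|M| + 1); split=> [|z Bz]; first by rewrite addr_ge0.
  by apply: bM; [have := ler_norm M; lra|exists z].
have fsec z : half_plane z -> ev f (sec z) != 0.
  move=> /secX [Xs _]; apply: (domain_chart dX); first exact: subset_closure.
  exact: (domain_projective dX).1.
have [c [c0 cB]] : exists c : R, 0 < c /\ forall z, Bx z -> c <= `|ev f (sec z)|.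
  have [||z1 /set_mem Bz1 z1m] := @compact_EVT_min _ R (fun z => `|ev f (sec z)|) Bx _ Bc.
  - by exists z0; exact: K'B.
  - move=> z; apply: cvg_norm; apply: (@cvg_ev _ _ _ (nbhs z) _ (fun=> f)).
      exact: cvg_cst.
    exact: secC.
  - exists `|ev f (sec z1)|; split; first by rewrite normr_gt0 fsec//; exact: BH.
    by move=> z Bz; apply: z1m; exact: mem_set.
(* [sec] returns some representative of the projective point; f normalises it. *)
have xE x : K x -> x = (ev f (sec (dev x)))^-1 *: sec (dev x).
  move=> Kx; have [t [t0 st]] := secP _ (KX _ Kx).
  by rewrite st evZr (KO _ Kx).2 mulr1 scalerA mulVf// scale1r.
pose F : R := 3 * `|f|.
have F0 : 0 <= F by rewrite mulr_ge0.
pose L1 := Ls / c + Sm * (F * Ls) / c ^+ 2.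
have L10 : 0 <= L1.
  apply: addr_ge0; first exact: divr_ge0 Ls0 (ltW c0).
  by apply: divr_ge0; [rewrite !mulr_ge0|rewrite exprn_ge0 ?ltW].
have lip x y : K x -> K y -> `|x - y| <= L1 * `|dev x - dev y|.
  move=> Kx Ky; set z := dev x; set w := dev y.
  have Bz : Bx z by apply: K'B; exists x.
  have Bw : Bx w by apply: K'B; exists y.
  rewrite (xE _ Kx) (xE _ Ky) -/z -/w; set a := ev f (sec z); set b := ev f (sec w).
  have a0 : a != 0 by apply: fsec; exact: BH.
  have b0 : b != 0 by apply: fsec; exact: BH.
  have -> : a^-1 *: sec z - b^-1 *: sec w =
    a^-1 *: (sec z - sec w) + ((b - a) / (a * b)) *: sec w.
    by apply/matrixP => i j; rewrite !mxE; field; rewrite a0 b0.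
  have n0 := normr_ge0 (z - w).
  apply: le_trans (ler_normD _ _) _; rewrite !normrZ /L1 mulrDl; apply: lerD.
    rewrite mulrAC mulrC normfV; apply: ler_pM => //; rewrite ?invr_ge0//; first exact: LsB.
    by rewrite lef_pV2 ?posrE ?normr_gt0//; exact: cB.
  have h1 : `|b - a| <= F * Ls * `|z - w|.
    rewrite /a /b -evBr distrC; apply: le_trans (ev_bound _ _) _.
    by rewrite -/F -mulrA ler_wpM2l// LsB.
  have h2 : `|a * b|^-1 <= (c ^+ 2)^-1.
    rewrite lef_pV2 ?posrE ?exprn_gt0 ?normr_gt0 ?mulf_neq0// normrM expr2.
    by apply: ler_pM; rewrite ?(ltW c0)//; exact: cB.
  rewrite normfV.
  have -> : Sm * (F * Ls) / c ^+ 2 * `|z - w| = (F * Ls * `|z - w|) * (c ^+ 2)^-1 * Sm by ring.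
  apply: ler_pM; [exact: divr_ge0|exact: normr_ge0| |exact: SmB].
  by apply: ler_pM => //; rewrite ?invr_ge0.
(* Bound for s = cosh(distance) - 1: each coordinate difference is at most 2 A and heights are at
   least ep. *)
pose S := (2 * A) ^+ 2 * 2 / (2 * ep * ep).
pose V := S + Num.sqrt (S ^+ 2 + 2 * S).
have S0 : 0 <= S by rewrite divr_ge0 ?mulr_ge0 ?exprn_ge0 ?mulr_ge0 ?(ltW ep0).
have V0 : 0 <= V by rewrite addr_ge0// sqrtr_ge0.
have A10 : 0 < A + 1 by lra.
have hyp z w : K' z -> K' w -> `|z - w| <= (A + 1) * (1 + V) * half_plane_dist z w /\
    half_plane_dist z w <= V.
  move=> Kz Kw; rewrite /half_plane_dist.
  set a := z 0 0 - w 0 0; set b := z 0 1 - w 0 1; set s := (_ + _) / _.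
  have z1 := K'H _ Kz; have w1 := K'H _ Kw.
  have zA : z 0 1 <= A by apply: le_trans (ler_norm _) (le_trans (coord_le_norm _ _ _) (AK _ Kz)).
  have wA : w 0 1 <= A by apply: le_trans (ler_norm _) (le_trans (coord_le_norm _ _ _) (AK _ Kw)).
  have d0 : 0 < 2 * z 0 1 * w 0 1 by rewrite !mulr_gt0.
  have nzw : `|z - w| <= 2 * A.
    by apply: le_trans (ler_normB _ _) _; have := AK _ Kz; have := AK _ Kw; lra.
  have na : `|a| <= `|z - w| by have := coord_le_norm (z - w) 0 0; rewrite !mxE.
  have nb : `|b| <= `|z - w| by have := coord_le_norm (z - w) 0 1; rewrite !mxE.
  have a2 : a ^+ 2 <= `|z - w| ^+ 2 by rewrite -[a ^+ 2]real_normK ?num_real// ler_pXn2r ?nnegrE.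
  have b2 : b ^+ 2 <= `|z - w| ^+ 2 by rewrite -[b ^+ 2]real_normK ?num_real// ler_pXn2r ?nnegrE.
  have n2 : `|z - w| ^+ 2 <= (2 * A) ^+ 2 by rewrite ler_pXn2r ?nnegrE// mulr_ge0.
  have s0 : 0 <= s by rewrite divr_ge0 ?addr_ge0 ?sqr_ge0// ltW.
  have sS : s <= S.
    rewrite /s /S; apply: ler_pM; rewrite ?invr_ge0 ?addr_ge0 ?sqr_ge0 ?(ltW d0)//; first lra.
    rewrite lef_pV2 ?posrE ?mulr_gt0// -!mulrA ler_wpM2l//.
    by apply: ler_pM; rewrite ?(ltW ep0)//; exact: epK.
  have n2s : `|z - w| ^+ 2 <= a ^+ 2 + b ^+ 2.
    have [i hi] : exists i, `|z - w| <= `|(z - w) 0 i|.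
      have [ab|ba] := leP `|a| `|b|.
        exists 1; apply: norm_le_coord => // i j; rewrite ord1 {i}.
        have [->|->] : j = 0 \/ j = 1 by case: j => -[|[|//]] h; [left|right]; exact: val_inj.
          by move: ab; rewrite !mxE.
        by [].
      exists 0; apply: norm_le_coord => // i j; rewrite ord1 {i}.
      have [->|->] : j = 0 \/ j = 1 by case: j => -[|[|//]] h; [left|right]; exact: val_inj.
        by [].
      by move: ba; rewrite !mxE => /ltW.
    apply: le_trans (_ : `|(z - w) 0 i| ^+ 2 <= _); first by rewrite ler_pXn2r ?nnegrE.
    rewrite real_normK ?num_real//.
    have [->|->] : i = 0 \/ i = 1 by case: (i) => -[|[|//]] h; [left|right]; exact: val_inj.
      by rewrite !mxE -/a lerDl sqr_ge0.
    by rewrite !mxE -/b lerDr sqr_ge0.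
  have s2 : (`|z - w| / (A + 1)) ^+ 2 <= 2 * s.
    have -> : 2 * s = (a ^+ 2 + b ^+ 2) / (z 0 1 * w 0 1).
      by rewrite /s; field; rewrite !gt_eqF.
    rewrite expr_div_n; apply: ler_pM; rewrite ?sqr_ge0 ?invr_ge0 ?sqr_ge0//.
    rewrite lef_pV2 ?posrE ?mulr_gt0 ?exprn_gt0// expr2.
    by apply: ler_pM; rewrite ?(ltW z1) ?(ltW w1)//; [apply: le_trans zA _|apply: le_trans wA _]; rewrite lerDl.
  have [lo hi] := acosh_bounds s0.
  have sqS : Num.sqrt (s ^+ 2 + 2 * s) <= Num.sqrt (S ^+ 2 + 2 * S).
    apply: ler_wsqrtr; apply: lerD; last by rewrite ler_wpM2l.
    by rewrite ler_pXn2r ?nnegrE.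
  have q0 := sqrtr_ge0 (s ^+ 2 + 2 * s).
  split; last by apply: le_trans hi _; exact: lerD.
  have h1 : `|z - w| / (A + 1) <= Num.sqrt (2 * s).
    rewrite -[leLHS]ger0_norm ?divr_ge0 ?(ltW A10)// -sqrtr_sqr; exact: ler_wsqrtr.
  have h2 : Num.sqrt (2 * s) <= (1 + V) * acosh (1 + s).
    have dd : 0 < 1 + s + Num.sqrt (s ^+ 2 + 2 * s) by rewrite !ltr_wpDr.
    move: lo; rewrite ler_pdivrMr// => lo; apply: le_trans lo _.
    rewrite mulrC ler_wpM2r//; last by rewrite /V -addrA lerD2l lerD.
    apply: le_trans (_ : 0 <= Num.sqrt (2 * s) / (1 + s + Num.sqrt (s ^+ 2 + 2 * s))) _.
      by rewrite divr_ge0 ?sqrtr_ge0// ltW.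
    by have [] := acosh_bounds s0.
  rewrite -mulrA -ler_pdivrMl// mulrC; exact: le_trans h1 h2.
exists (L1 * ((A + 1) * (1 + V))), V; split => //.
  by rewrite mulr_ge0// mulr_ge0//; lra.
move=> x y Kx Ky; rewrite dSE; [|exact: KX|exact: KX].
have [h1 h2] := hyp (dev x) (dev y) (ex_intro2 _ _ x Kx erefl) (ex_intro2 _ _ y Ky erefl).
split => //; apply: le_trans (lip _ _ Kx Ky) _.
by rewrite -mulrA ler_wpM2l.
Qed.

End Hyperbolic.

(** * Normalised limits of matrices *)

Section Compactness.
Context {R : realType}.

Lemma compact_mx m n (A : set 'M[R]_(m, n)) : bounded_set A -> closed A -> compact A.
Proof.
move=> [M [Mr AM]] Ac.
have vc : continuous (@vec_mx R m n).
  move=> x; apply: (@cvg_mx _ _ m n (nbhs x)) => i j; rewrite mxE.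
  have -> : (fun t : 'rV[R]_(m * n) => vec_mx t i j) = (fun t => t 0 (mxvec_index i j)).
    by apply/funext => t; rewrite mxE.
  exact: coord_continuous.
have -> : A = vec_mx @` (vec_mx @^-1` A : set 'rV[R]_(m * n)).
  apply/seteqP; split=> [v Av|_ [v Av <-]//].
  by exists (mxvec v); rewrite /= mxvecK.
apply: continuous_compact; first exact: continuous_subspaceT.
apply: bounded_closed_compact; last by apply: preimage_closed => // v _; exact: vc.
exists M; split=> // x Mx v /= Av; apply: le_trans (AM x Mx _ Av).
apply: norm_le_coord => // i j; rewrite ord1; case/mxvec_indexP: j => i' j'.
have -> : v 0 (mxvec_index i' j') = vec_mx v i' j' by rewrite mxE.
exact: coord_le_norm.
Qed.

Lemma cvg_near_eq (T : Type) (V : topologicalType) (F : set_system T) (FF : Filter F)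
    (u w : T -> V) (l : V) : (\forall t \near F, u t = w t) -> u @ F --> l -> w @ F --> l.
Proof. by move=> uw ul A /ul h; move: uw h; apply: filterS2 => t /= <-. Qed.

Lemma mx_lim_unique (T : Type) (F : set_system T) (FF : ProperFilter F) m n
    (u : T -> 'M[R]_(m, n)) (l k : 'M[R]_(m, n)) : u @ F --> l -> u @ F --> k -> l = k.
Proof. apply: lim_unique; exact: norm_hausdorff. Qed.

Lemma normalized_lim (U : set_system nat) (UU : UltraFilter U) m n (A : nat -> 'M[R]_(m, n)) :
  (forall k, A k != 0) -> exists2 M : 'M[R]_(m, n), `|M| = 1 &
    (fun k => `|A k|^-1 *: A k) @ U --> M.
Proof.
move=> A0.
have Sc : compact [set M : 'M[R]_(m, n) | `|M| = 1].
  apply: compact_mx; first by exists 1; split => // x x1 c /= ->; exact: ltW.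
  apply: (@preimage_closed _ _ (fun M : 'M[R]_(m, n) => `|M|) [set x : R | x = 1]); last exact: closed_eq.
  by move=> ? _; exact: norm_continuous.
have [|M M1 MA] := ultra_lim UU (u := fun k => `|A k|^-1 *: A k) Sc; last by exists M.
apply: nearW => k /=; rewrite normrZ normfV normr_id mulVf// normr_eq0; exact: A0.
Qed.

Lemma cvg_det (T : Type) n (F : set_system T) (FF : Filter F) (u : T -> 'M[R]_n) l :
  u @ F --> l -> (fun t => \det (u t)) @ F --> \det l.
Proof.
move=> ul; rewrite /determinant; apply: cvg_big => [|s _]; first exact: add_continuous.
apply: cvgM; first exact: cvg_cst.
by apply: cvg_big => [|i _]; [exact: mul_continuous|exact: cvg_coord].
Qed.

Lemma compact_nbhd n (X : set 'cV[R]_n.+1) x : open X -> X x ->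
  exists K, [/\ compact K, K `<=` X & nbhs x K].
Proof.
move=> Xo Xx; have /nbhs_closedballP [r rX] : nbhs x X by exact: open_nbhs_nbhs.
exists (closed_ball x r%:num); split => //; last by apply/nbhs_closedballP; exists r.
apply: compact_cV; last exact: closed_ball_closed.
rewrite closed_ballE//; exists (`|x| + r%:num); split; first exact: num_real.
move=> y ry v; rewrite /closed_ball_/= => xv.
have -> : v = x - (x - v) by rewrite subKr.
by apply: le_trans (ler_normB _ _) _; apply: le_trans (ltW ry); rewrite lerD2l.
Qed.

Lemma convex_sign n (C : set 'cV[R]_n) (a : 'rV[R]_n) : convex_set C ->
  (forall y, C y -> ev a y != 0) ->
  (forall y, C y -> 0 < ev a y) \/ (forall y, C y -> ev a y < 0).
Proof.
move=> /convexP vC a0; apply: contrapT => /not_orP [/existsNP [y /not_implyP [Cy /negP]]].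
rewrite -leNgt => y0 /existsNP [z /not_implyP [Cz /negP]]; rewrite -leNgt => z0.
have yn : ev a y < 0 by rewrite lt_neqAle a0.
have zp : 0 < ev a z by rewrite lt_neqAle eq_sym a0.
pose s : R := ev a y / (ev a y - ev a z).
have d : ev a y - ev a z < 0 by lra.
have s01 : 0 <= s <= 1.
  by rewrite /s; apply/andP; split; [rewrite ler_ndivlMr// mul0r; lra|rewrite ler_ndivrMr// mul1r; lra].
have /eqP := a0 _ (vC _ _ _ Cy Cz s01); apply; rewrite seg_ev /s.
by field; rewrite lt_eqF.
Qed.

End Compactness.

(** * Dynamics on the boundary of the domain *)

Section Dynamics.
Context {R : realType} {G : groupType}.
Variables (rho : G -> 'M[R]_3) (X : set 'cV[R]_3) (f : 'rV[R]_3).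
Variables (g : nat) (S : topologicalType).
Local Notation Om := (in_chart f X).
Local Notation cOm := (cl_chart X f).
Local Notation bOm := (bd_chart X f).
Hypotheses (rho1 : rho 1%g = 1%:M) (rhoM : forall x y, rho (x * y)%g = rho x *m rho y).
Hypothesis (rho_det : forall x, \det (rho x) = 1).
Hypothesis (HS : @closed_orientable_surface R g S) (HH : Hitchin S rho X).
Hypothesis (fX : chart_of X f).
Variables (U : set_system nat) (UU : UltraFilter U) (Uoo : \oo `<=` U).

Lemma rhoVK x : rho x^-1%g *m rho x = 1%:M.
Proof. by rewrite -rhoM mulVg. Qed.

Lemma rho_neq0 x : rho x != 0.
Proof. by apply: contra_eq_neq (rho_det x) => ->; rewrite det0 eq_sym oner_neq0. Qed.

Lemma rho_X x v : X v -> X (rho x *m v).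
Proof. by case: HH => _ _ h _ _; exact: h. Qed.

Lemma rho_inj x (v w : 'cV[R]_3) : rho x *m v = rho x *m w -> v = w.
Proof. by move=> e; rewrite -[v]mul1mx -[w]mul1mx -(rhoVK x) -!mulmxA e. Qed.

Lemma rho_bd x v : proj_boundary X v -> proj_boundary X (rho x *m v).
Proof.
move=> [v0 Xv nXv]; split.
- by apply: contra_neq v0 => h; apply: (@rho_inj x); rewrite h mulmx0.
- move=> B vB; have /Xv [w [Xw Bw]] : nbhs v [set w | B (rho x *m w)].
    exact: (mulmx_continuous (M := rho x) vB).
  by exists (rho x *m w); split => //; exact: rho_X.
- by move=> /(rho_X x^-1%g); rewrite mulmxA rhoVK mul1mx.
Qed.

Lemma X_f v : X v -> ev f v != 0.
Proof.
case: HH => -[[X0 _] _ _] _ _ _ _ Xv; apply: fX; [exact: subset_closure|exact: X0].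
Qed.

Lemma X_chart v : X v -> Om ((ev f v)^-1 *: v).
Proof.
move=> Xv; have f0 := X_f Xv; case: HH => -[[_ XZ] _ _] _ _ _ _.
by split; [apply: XZ; rewrite ?invr_eq0|rewrite evZr mulVf].
Qed.

Lemma Hitchin_domain : convex_domain X f.
Proof.
case: (HH) => -[XP Xo [v Xv]] [Xpc Xsc _] _ _ _; split => //.
- by exists ((ev f v)^-1 *: v); exact: X_chart.
- exact: in_chart_convex.
Qed.
Let dX := Hitchin_domain.

Lemma bd_nrm v : proj_boundary X v -> ev f v != 0 /\ bOm ((ev f v)^-1 *: v).
Proof.
move=> [v0 cv nv]; have f0 : ev f v != 0 by exact: fX.
have f1 : (ev f v)^-1 != 0 by rewrite invr_eq0.
split => //; split; last by rewrite evZr mulVf.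
have [XP Xo _ _ _ _] := dX.
split; [by rewrite scaler_eq0 negb_or f1|exact: projective_closure|].
by move=> /(XP.2 _ _ f0); rewrite scalerA divff// scale1r.
Qed.

(** S is compact, being the image of the disk, so the projections of the points converge along U.
    The projection of X is open, so near the limit they lift to a compact neighbourhood K of a
    preimage. *)
Lemma cocompact (vs : nat -> 'cV[R]_3) : (forall n, X (vs n)) ->
  exists K gs, [/\ compact K, K `<=` X &
    \forall n \near U, exists2 t : R, t != 0 & K (t *: (rho (gs n) *m vs n))].
Proof.
move=> Xv; case: HS => _ [q [qc qs _]].
have Sc : compact [set: S].
  rewrite -qs; apply: continuous_compact => //.
  apply: (@subclosed_compact (R * R)%type unit_disk (`[-1, 1]%classic `*` `[-1, 1]%classic)).
  - have -> : unit_disk = (fun z : R * R => z.1 ^+ 2 + z.2 ^+ 2) @^-1` [set x | x <= 1] by [].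
    apply: preimage_closed; last exact: closed_le.
    move=> z _; apply: (@cvgD _ _ _ (nbhs z) _ (fun z : R * R => z.1 ^+ 2) (fun z : R * R => z.2 ^+ 2)).
      by rewrite expr2; apply: (@cvgM _ _ (nbhs z) _ fst fst); exact: cvg_fst.
    by rewrite expr2; apply: (@cvgM _ _ (nbhs z) _ snd snd); exact: cvg_snd.
  - by apply: compact_setX; exact: segment_compact.
  - move=> [a b]; rewrite /unit_disk/= => ab; split => /=; rewrite in_itv/=.
      by have := sqr_ge0 b; move: ab => /= *; apply/andP; split; nra.
    by have := sqr_ge0 a; move: ab => /= *; apply/andP; split; nra.
case: (HH) => -[[X0 XZ] Xo _] _ _ _ [p [_ po ps pE]].
have [s _ ps'] := ultra_lim UU (u := p \o vs) Sc filterT.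
have [x Xx px] : (p @` X) s by rewrite ps.
have [K [Kc KX Kx]] := compact_nbhd Xo Xx.
have near_ : \forall n \near U, exists x, exists2 t : R, t != 0 & K (t *: (rho x *m vs n)).
  have o : open (p @` K°) by apply: po; [exact: open_interior|move=> y /interior_subset /KX].
  have ns : nbhs s (p @` K°) by apply: open_nbhs_nbhs; split => //; exists x.
  have nU : \forall n \near U, (p @` K°) (p (vs n)) by exact: (ps' _ ns).
  apply: filterS nU => n [y Ky pyv].
  have Xy : X y by apply: KX; exact: interior_subset.
  have /(pE _ _ (Xv n) Xy) [z [t [t0 yE]]] := esym pyv.
  by exists z, t => //; rewrite -yE; exact: interior_subset.
have /choice [gs gsP] : forall n, exists y,
    (exists x, exists2 t : R, t != 0 & K (t *: (rho x *m vs n))) ->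
    exists2 t : R, t != 0 & K (t *: (rho y *m vs n)).
  move=> n; have [[x' h]|h] := pselect (exists x, exists2 t : R, t != 0 & K (t *: (rho x *m vs n))).
    by exists x'.
  by exists 1%g => /h.
by exists K, gs; split => //; apply: filterS near_ => n; exact: gsP.
Qed.

Definition escapes (gs : nat -> G) := forall x, \forall n \near U, gs n <> x.

Lemma escapes_finite (A : set G) gs : finite_set A -> escapes gs ->
  \forall n \near U, ~ A (gs n).
Proof.
move=> /finite_seqP [s ->] h; elim: s => [|x s IH]; first by apply: nearW => n.
apply: filterS2 (h x) IH => n nx ns; rewrite /= inE => /orP[/eqP//|]; exact: ns.
Qed.

Lemma Om_eq0 m (A : 'M[R]_(m, 3)) : (forall y, Om y -> A *m y = 0) -> A = 0.
Proof.
move=> AO; apply/row_matrixP => i; rewrite row0; have [x Ox] := domain_nonempty dX.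
have h y : Om y -> ev (row i A) y = 0.
  by move=> Oy; rewrite /ev -row_mul (AO _ Oy) row0 mxE.
by apply: (ge0_Om_eq0 dX Ox) => [y Oy|]; rewrite h.
Qed.

Definition scaled (gs : nat -> G) n : 'M[R]_3 := `|rho (gs n)|^-1 *: rho (gs n).

(** v is the attracting point and the kernel of b the repelling line, which misses X. *)
Record attracts (gs : nat -> G) (v : 'cV[R]_3) (b : 'rV[R]_3) : Prop := Attracts {
  at_bd : bOm v;
  at_X x : X x -> ev b x != 0;
  at_lim : scaled gs @ U --> v *m b;
  at_0 : (fun n => `|rho (gs n)|^-1) @ U --> (0 : R) }.

Lemma rnorm_neq0 x : `|rho x|^-1 != 0.
Proof. by rewrite invr_eq0 normr_eq0 rho_neq0. Qed.

Lemma scaled_X gs n y : X y -> X (scaled gs n *m y).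
Proof.
case: HH => -[[_ XZ] _ _] _ _ _ _ Xy; rewrite -scalemxAl.
by apply: XZ; [exact: rnorm_neq0|exact: rho_X].
Qed.

Lemma rank1_det0 (v : 'cV[R]_3) (b : 'rV[R]_3) : \det (v *m b) = 0.
Proof.
apply/eqP; rewrite -[_ == 0]negbK -unitfE -unitmxE; apply/negP => /mxrank_unit h.
have := mxrankM_maxl v b; rewrite h => /leq_trans /(_ (rank_leq_col _)); by [].
Qed.

(* The limit of the normalised matrices maps the domain into its boundary, hence,
   by strict convexity, to a single point. *)
Lemma rank_one gs : escapes gs -> exists v b, attracts gs v b.
Proof.
move=> gse; case: (HH) => -[[X0 XZ] Xo _] _ _ Xpd _.
have [M M1 gM] := normalized_lim UU (fun n => rho_neq0 (gs n)).
have My (y : 'cV[R]_3) : (fun n => scaled gs n *m y) @ U --> M *m y.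
  by apply: (@cvg_mulmx _ _ _ _ _ U _ (scaled gs) (fun=> y)) => //; exact: cvg_cst.
have Mcl y : Om y -> closure X (M *m y).
  move=> [Xy _]; apply: (@lim_closed _ _ U _ (fun n => scaled gs n *m y) _ _ (My y)); first exact: closed_closure.
  by apply: nearW => n; apply: subset_closure; exact: scaled_X.
have MX y : Om y -> ~ X (M *m y).
  move=> [Xy _] XM; have [K1 [K1c K1X K1n]] := compact_nbhd Xo XM.
  have Kc : compact (K1 `|` [set y]) by apply: compactU => //; exact: compact_set1.
  have KX : K1 `|` [set y] `<=` X by move=> z [/K1X//|->].
  have [n [/= h1 h2]] := filter_ex (@filterI _ U _ _ _ (My y _ K1n) (escapes_finite (Xpd _ Kc KX) gse)).
  apply: h2; exists y, (`|rho (gs n)|^-1); split; [by right|exact: rnorm_neq0|].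
  by left; rewrite scalemxAl.
have [y0 Oy0 My0] : exists2 y, Om y & M *m y != 0.
  apply: contrapT => h; suff M0 : M = 0 by move: M1; rewrite M0 normr0 => /eqP; rewrite eq_sym oner_eq0.
  apply: Om_eq0 => y Oy; apply/eqP; apply: contrapT => /negP n0; apply: h; by exists y.
have Mf y : Om y -> M *m y != 0 -> ev f (M *m y) != 0 by move=> /Mcl; exact: fX.
pose sg (s : R) n := forall y, Om y -> 0 < s * ev f (rho (gs n) *m y).
(* For each n the sign of f o rho (gs n) is constant on Om, and the ultrafilter makes it independent
   of n. *)
have [s [s1 sU]] : exists s : R, (s = 1 \/ s = -1) /\ \forall n \near U, sg s n.
  have [h|h] := in_ultra_setVsetC (sg 1) UU; first by exists 1; split; [left|].
  exists (-1); split; first by right.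
  apply: filterS h => n /= h y Oy; have := convex_sign (domain_convex dX) (a := f *m rho (gs n)).
  case=> [z [Xz _]|p|p]; first by rewrite ev_mul; apply: X_f; exact: rho_X.
    by case: h => z Oz; rewrite mul1r -ev_mul; exact: p.
  by rewrite mulN1r oppr_gt0 -ev_mul; exact: p.
have fM y : (fun n => ev f (scaled gs n *m y)) @ U --> ev f (M *m y).
  by apply: (@cvg_ev _ _ _ U _ (fun=> f) (fun n => scaled gs n *m y)) => //; exact: cvg_cst.
pose b := f *m M.
have sb0 y : Om y -> 0 <= ev (s *: b) y.
  move=> Oy; rewrite evZl ev_mul.
  apply: (@lim_ge0 _ _ U _ (fun n => s * ev f (scaled gs n *m y))).
    by apply: (@cvgM _ _ U _ (fun=> s)) => //; exact: cvg_cst.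
  apply: filterS sU => n /(_ _ Oy); rewrite -scalemxAl evZr mulrCA => /ltW.
  by apply: mulr_ge0; rewrite invr_ge0.
have sbp y : Om y -> 0 < ev (s *: b) y.
  move=> Oy; rewrite lt_neqAle sb0// andbT eq_sym; apply/eqP => h.
  have /(congr1 (fun c => ev c y0)) := ge0_Om_eq0 dX Oy sb0 h.
  rewrite ev0l evZl ev_mul => /eqP; rewrite mulf_eq0 (negPf (Mf _ Oy0 My0)) orbF.
  by case: s1 => ->; rewrite ?oppr_eq0 oner_eq0.
have bn0 y : Om y -> ev b y != 0.
  by move=> /sbp; rewrite evZl; apply: contraTneq => ->; rewrite mulr0 ltxx.
pose F y := (ev b y)^-1 *: (M *m y).
have Fbd y : Om y -> bOm (F y).
  move=> Oy; have b0 := bn0 _ Oy; have M0 : M *m y != 0.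
    by apply: contraNneq b0 => M0; rewrite ev_mul M0 ev0r.
  rewrite /F ev_mul; apply: (bd_nrm _).2.
  by split => //; [exact: Mcl|exact: MX].
(* The image of a midpoint lies strictly between F y and F y0 and is itself a boundary point;
   extremality forces F y = F y0. *)
have FE y : Om y -> F y = F y0.
  move=> Oy; pose z := seg y y0 (1 / 2); have Oz : Om z.
    by have /convexP h := domain_convex dX; apply: h => //; apply/andP; split; lra.
  pose A := ev b y; pose B := ev b y0.
  have A0 : A != 0 by exact: bn0. have B0 : B != 0 by exact: bn0.
  have [sA sB] : 0 < s * A /\ 0 < s * B by rewrite -!evZl; split; exact: sbp.
  have AB : A + B != 0.
    by apply: contraTneq (addr_gt0 sA sB) => h; rewrite -mulrDr h mulr0 ltxx.
  have r01 : 0 < B / (A + B) < 1.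
    case: s1 sA sB => ->; rewrite ?mul1r ?mulN1r => sA sB.
      have d : 0 < A + B by lra.
      by apply/andP; split; [rewrite divr_gt0|rewrite ltr_pdivrMr// mul1r; lra].
    have d : A + B < 0 by lra.
    by apply/andP; split; [rewrite ltr_ndivlMr// mul0r; lra|rewrite ltr_ndivrMr// mul1r; lra].
  apply: (bd_extreme dX (bd_cl (Fbd _ Oy)) (bd_cl (Fbd _ Oy0)) r01).
  suff <- : F z = seg (F y) (F y0) (B / (A + B)) by exact: Fbd.
  rewrite /F /z seg_ev -/A -/B /seg mulmxDr -!scalemxAr scalerDr !scalerA.
  have A0' : A + B != 0 := AB.
  by congr (_ *: _ + _ *: _); field; rewrite ?A0 ?B0 AB//.
have ME : M = F y0 *m b.
  apply/eqP; rewrite -subr_eq0; apply/eqP; apply: Om_eq0 => y Oy.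
  rewrite mulmxBl -mulmxA -(FE _ Oy) /F.
  have -> : b *m y = (ev b y)%:M by rewrite [LHS]mx11_scalar.
  by rewrite mul_mx_scalar scalerA divff ?bn0// scale1r subrr.
exists (F y0), b; split.
- exact: Fbd.
- move=> x Xx; have := bn0 _ (X_chart Xx); rewrite evZr mulf_eq0 negb_or => /andP[]; by [].
- by rewrite -ME.
(* The determinant of the rescaled matrix is the cube of the inverse norm, and its limit is the
   determinant of a matrix of rank one. *)
- have d3 : (fun n => `|rho (gs n)|^-1 ^+ 3) @ U --> (0 : R).
    have -> : 0 = \det M :> R by rewrite ME rank1_det0.
    have -> : (fun n => `|rho (gs n)|^-1 ^+ 3) = (fun n => \det (scaled gs n)).
      by apply/funext => n; rewrite /scaled detZ rho_det mulr1.
    exact: cvg_det.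
  apply/cvgrPdist_lt => e e0; have e3 : 0 < e ^+ 3 by rewrite exprn_gt0.
  move/cvgrPdist_lt: d3 => /(_ _ e3); apply: filterS => n.
  rewrite !sub0r !normrN normrX ltr_pXn2r// nnegrE//; exact: ltW.
Qed.

Lemma cvg_nrm (A : nat -> 'M[R]_3) (k : nat -> 'cV[R]_3)
    (A' : 'M[R]_3) (k' : 'cV[R]_3) :
  A @ U --> A' -> k @ U --> k' -> ev f (A' *m k') != 0 ->
  (fun n => (ev f (A n *m k n))^-1 *: (A n *m k n)) @ U --> (ev f (A' *m k'))^-1 *: (A' *m k').
Proof.
move=> hA hk n0.
have h : (fun n => A n *m k n) @ U --> A' *m k' by exact: cvg_mulmx.
have hf : (fun n => ev f (A n *m k n)) @ U --> ev f (A' *m k').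
  by apply: (@cvg_ev _ _ _ U _ (fun=> f)) => //; exact: cvg_cst.
by apply: (@cvgZ _ _ _ U _ (fun n => (ev f (A n *m k n))^-1)) => //; exact: cvgV.
Qed.

Lemma nrmZ (t : R) (w : 'cV[R]_3) : t != 0 -> (ev f (t *: w))^-1 *: (t *: w) = (ev f w)^-1 *: w.
Proof.
by move=> t0; rewrite evZr scalerA invfM mulrAC mulVf// mul1r.
Qed.

Lemma rank1_mul (v : 'cV[R]_3) (b : 'rV[R]_3) (w : 'cV[R]_3) : v *m b *m w = ev b w *: v.
Proof.
rewrite -mulmxA; have -> : b *m w = (ev b w)%:M by rewrite [LHS]mx11_scalar.
by rewrite mul_mx_scalar.
Qed.

Lemma cvg_attract gs v b (k : nat -> 'cV[R]_3) (k' : 'cV[R]_3) : attracts gs v b -> k @ U --> k' ->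
  ev b k' != 0 ->
  (fun n => (ev f (rho (gs n) *m k n))^-1 *: (rho (gs n) *m k n)) @ U --> v.
Proof.
move=> [bv _ gl _] kk b0.
have -> : (fun n => (ev f (rho (gs n) *m k n))^-1 *: (rho (gs n) *m k n)) =
    (fun n => (ev f (scaled gs n *m k n))^-1 *: (scaled gs n *m k n)).
  by apply/funext => n; rewrite -scalemxAl nrmZ// rnorm_neq0.
have -> : v = (ev f (v *m b *m k'))^-1 *: (v *m b *m k').
  by rewrite rank1_mul evZr bv.2 mulr1 scalerA mulVf// scale1r.
by apply: cvg_nrm => //; rewrite rank1_mul evZr bv.2 mulr1.
Qed.

(** Approach v by interior points and bring them back to a compact set by cocompactness. The inverse
    elements then push points of a compact set of X to v, so their attracting point is v. *)
Lemma bd_attracting v : bOm v -> exists gs b, attracts gs v b /\ escapes gs.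
Proof.
move=> bv; have [x0 Ox0] := domain_nonempty dX; case: (HH) => -[[X0 XZ] Xo _] _ _ _ _.
pose vs (n : nat) := seg x0 v (1 - n.+1%:R^-1).
have Ov n : Om (vs n).
  apply: (Om_seg dX) => //; first exact: bd_cl.
  have n0 : 0 < n.+1%:R^-1 :> R by rewrite invr_gt0 ltr0n.
  have n1 : n.+1%:R^-1 <= 1 :> R by rewrite invf_le1 ?ltr0n// ler1n.
  by apply/andP; split; [rewrite subr_ge0|rewrite ltrBlDr ltrDl].
have vv : vs @ U --> v.
  have h0 : (fun n : nat => n.+1%:R^-1 : R) @ U --> (0 : R).
    by move=> A hA; apply: Uoo; exact: (@cvg_harmonic R A hA).
  have -> : v = (1 - (1 - 0)) *: x0 + (1 - 0) *: v.
    by rewrite subr0 subrr scale0r add0r scale1r.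
  have h1 : (fun n : nat => 1 - n.+1%:R^-1 : R) @ U --> (1 - 0 : R).
    by apply: (@cvgB R R^o nat U _ (fun=> 1)) => //; exact: cvg_cst.
  apply: (@cvgD _ _ _ U _ (fun n => (1 - (1 - n.+1%:R^-1)) *: x0)).
    apply: (@cvgZ _ _ _ U _ (fun n : nat => 1 - (1 - n.+1%:R^-1)) (fun=> x0)).
      by apply: (@cvgB R R^o nat U _ (fun=> 1)) => //; exact: cvg_cst.
    exact: cvg_cst.
  apply: (@cvgZ _ _ _ U _ (fun n : nat => 1 - n.+1%:R^-1) (fun=> v)) => //.
  exact: cvg_cst.
have [K [gs [Kc KX gsP]]] := cocompact (fun n => (Ov n).1).
have [ts tsP] : exists ts : nat -> R, \forall n \near U, ts n != 0 /\ K (ts n *: (rho (gs n) *m vs n)).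
  have /choice [ts h] : forall n, exists t : R,
      (exists2 t : R, t != 0 & K (t *: (rho (gs n) *m vs n))) ->
      t != 0 /\ K (t *: (rho (gs n) *m vs n)).
    move=> n; have [[t t0 Kt]|h] := pselect (exists2 t : R, t != 0 & K (t *: (rho (gs n) *m vs n))).
      by exists t.
    by exists 0 => /h.
  by exists ts; apply: filterS gsP => n; exact: h.
pose ks n := ts n *: (rho (gs n) *m vs n); pose hs n := (gs n)^-1%g.
have [|k Kk kk] := ultra_lim UU (u := ks) Kc; first by apply: filterS tsP => n [].
have vE : \forall n \near U, (ev f (rho (hs n) *m ks n))^-1 *: (rho (hs n) *m ks n) = vs n.
  apply: filterS tsP => n [t0 _]; rewrite /ks /hs -scalemxAr mulmxA rhoVK mul1mx nrmZ//.
  by rewrite (Ov n).2 invr1 scale1r.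
(* If hs were constant along U, v would be the image of an interior point. *)
have he : escapes hs.
  move=> x; apply: contrapT => /(ultra_not UU) hx.
  have Xk : X (rho x *m k) by apply: rho_X; exact: KX.
  have h : (fun n => (ev f (rho x *m ks n))^-1 *: (rho x *m ks n)) @ U -->
      (ev f (rho x *m k))^-1 *: (rho x *m k).
    by apply: (@cvg_nrm (fun=> rho x)) => //; [exact: cvg_cst|exact: X_f].
  have {}h := @cvg_near_eq _ _ U _ _ vs _ _ h.
  have vx : v = (ev f (rho x *m k))^-1 *: (rho x *m k).
    apply: (@mx_lim_unique _ _ U _ _ _ vs) => //.
    apply: h; apply: filterS2 hx vE => n /contrapT hx <-; by rewrite hx.
  by apply: (bd_notin bv); rewrite vx; exact: X_chart.
have [v' [b hv']] := rank_one he.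
suff -> : v = v' by exists hs, b.
apply: (@mx_lim_unique _ _ U _ _ _ vs) => //.
apply: cvg_near_eq vE (cvg_attract hv' kk _).
by apply: (at_X hv'); exact: KX.
Qed.

Lemma bd_other (a : 'rV[R]_3) : a != 0 -> exists2 v, bOm v & ev a v != 0.
Proof.
move=> a0; apply: contrapT => h; have [x Ox] := domain_nonempty dX.
have az v : bOm v -> ev a v = 0.
  by move=> bv; apply/eqP; apply: contrapT => /negP n; apply: h; exists v.
have [u u0 [fu _]] := line_dir f f.
have ge y : Om y -> 0 <= ev a y.
  by move=> Oy; apply: (ge0_bd_Om dX) => // [v /az ->//|]; exists u.
have le y : Om y -> 0 <= ev (- a) y.
  by move=> Oy; apply: (ge0_bd_Om dX) => // [v /az|]; [rewrite evNl => ->; rewrite oppr0|exists u].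
have /eqP := a0; apply; apply: (ge0_Om_eq0 dX Ox ge).
by have := ge _ Ox; have := le _ Ox; rewrite evNl; lra.
Qed.

Lemma three_bd : exists v1 v2 v3, [/\ bOm v1, bOm v2, bOm v3 & [/\ v1 != v2, v1 != v3 & v2 != v3]].
Proof.
have f0 : f != 0.
  by have [x [_ fx]] := domain_nonempty dX; apply: contra_eq_neq fx => ->; rewrite ev0l eq_sym oner_neq0.
have [v1 b1 _] := bd_other f0.
have [a [a0 av]] : exists a : 'rV[R]_3, a != 0 /\ ev a v1 = 0.
  have [u u0 [u1 _]] := line_dir v1^T v1^T; exists u^T; split; first by rewrite trmx_eq0.
  by rewrite ev_trC.
have [v2 b2 a2] := bd_other a0.
have v12 : v1 != v2 by apply: contraNneq a2 => <-; rewrite av.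
have [c c0 [c1 c2]] := line_ex b1.2 b2.2 v12.
have [v3 b3 c3] := bd_other c0.
exists v1, v2, v3; split => //; split => //.
  by apply: contraNneq c3 => <-; rewrite c1.
by apply: contraNneq c3 => <-; rewrite c2.
Qed.

Lemma support_zero (b : 'rV[R]_3) u v : (forall x, X x -> ev b x != 0) -> bOm u -> bOm v ->
  ev b u = 0 -> ev b v = 0 -> u = v.
Proof.
move=> bX bu bv u0 v0; apply/eqP; apply: contrapT => /negP uv.
have h : 0 < (1 / 2 : R) < 1 by apply/andP; split; lra.
have [Xm _] := strict_seg dX (bd_cl bu) (bd_cl bv) uv h.
by have := bX _ Xm; rewrite seg_ev u0 v0 !mulr0 addr0 eqxx.
Qed.

Definition push x (w : 'cV[R]_3) := (ev f (rho x *m w))^-1 *: (rho x *m w).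

Lemma push_bd x w : bOm w -> ev f (rho x *m w) != 0 /\ bOm (push x w).
Proof. by move=> [/(rho_bd x) /bd_nrm]. Qed.

Lemma push_inj x v w : bOm v -> bOm w -> push x v = push x w -> v = w.
Proof.
move=> bv bw; have [v0 _] := push_bd x bv; have [w0 _] := push_bd x bw.
rewrite /push !scalemxAr => /rho_inj /(congr1 (fun z => (z, ev f z))) [].
rewrite !evZr bv.2 bw.2 !mulr1 => e2 e1; move: e2; rewrite e1.
by move/(scalerI _); apply; rewrite invr_eq0.
Qed.

(** Two distinct points off the repelling line are pushed to w. Their images stay distinct, so at
    least one of the two sequences avoids w along U. *)
Lemma bd_dense w : bOm w -> exists ws : nat -> 'cV[R]_3,
  (\forall n \near U, bOm (ws n) /\ ws n <> w) /\ ws @ U --> w.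
Proof.
move=> bw; have [gs [b [hb _]]] := bd_attracting bw.
have [w1 [w2 [b1 b2 w12 [n1 n2]]]] : exists w1 w2, [/\ bOm w1, bOm w2, w1 != w2 &
    ev b w1 != 0 /\ ev b w2 != 0].
  have [v1 [v2 [v3 [b1 b2 b3 [v12 v13 v23]]]]] := three_bd.
  have sz := support_zero (at_X hb).
  have [z1|n1] := eqVneq (ev b v1) 0; last have [z2|n2] := eqVneq (ev b v2) 0.
  - exists v2, v3; split => //; split; apply/eqP => z.
      by move: v12; rewrite (sz _ _ b1 b2 z1 z) eqxx.
    by move: v13; rewrite (sz _ _ b1 b3 z1 z) eqxx.
  - exists v1, v3; split => //; split => //; apply/eqP => z.
    by move: v23; rewrite (sz _ _ b2 b3 z2 z) eqxx.
  - by exists v1, v2.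
have lim1 : (fun n => push (gs n) w1) @ U --> w by apply: (@cvg_attract _ _ _ (fun=> w1) w1 hb) => //; exact: cvg_cst.
have lim2 : (fun n => push (gs n) w2) @ U --> w by apply: (@cvg_attract _ _ _ (fun=> w2) w2 hb) => //; exact: cvg_cst.
have [h|h] := in_ultra_setVsetC [set n | push (gs n) w1 = w] UU.
  exists (fun n => push (gs n) w2); split => //; apply: filterS h => n /= e1.
  split; first exact: (push_bd _ b2).2.
  move=> e2; move: w12; rewrite (push_inj b1 b2 (etrans e1 (esym e2))) eqxx; by [].
exists (fun n => push (gs n) w1); split => //; apply: filterS h => n /= e1.
by split => //; exact: (push_bd _ b1).2.
Qed.

Lemma prop_of_ker n (p v : 'cV[R]_n) : p != 0 ->
  (forall a : 'rV[R]_n, ev a p = 0 -> ev a v = 0) -> exists t : R, v = t *: p.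
Proof.
move=> p0 h; pose c := ev p^T v / ev p^T p; pose w := v - c *: p.
have pp : ev p^T p != 0 by apply: contra_neq p0; exact: ev_tr_eq0.
have wp : ev w^T p = 0 by rewrite ev_trC /w evBr evZr /c; field.
have ww : ev w^T w = 0 by rewrite {2}/w evBr evZr (h _ wp) wp mulr0 subr0.
by exists c; apply/eqP; rewrite -subr_eq0; apply/eqP; exact: ev_tr_eq0.
Qed.

Lemma cross0_prop (p q : 'cV[R]_3) : p != 0 -> cross p q = 0 -> exists t : R, q = t *: p.
Proof.
move=> p0 c0; apply: prop_of_ker => // a ap.
have pp : ev p^T p != 0 by apply: contra_neq p0; exact: ev_tr_eq0.
have := cross_normsq p q; rewrite c0 ev0r => /esym/eqP; rewrite subr_eq0 => /eqP h.
pose c := ev p^T q / ev p^T p; pose w := q - c *: p.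
have ww : ev w^T w = 0.
  have -> : ev w^T w = ev w^T q - c * ev w^T p by rewrite {2}/w evBr evZr.
  have -> : ev w^T p = 0 by rewrite ev_trC /w evBr evZr /c; field.
  have -> : ev w^T q = ev q^T q - c * ev p^T q.
    by rewrite [ev w^T q]ev_trC /w evBr evZr [ev q^T p]ev_trC.
  rewrite mulr0 subr0 /c; apply: (mulfI pp); rewrite mulr0 mulrBr h.
  by field.
move: (ev_tr_eq0 ww) => /eqP; rewrite /w subr_eq0 => /eqP ->.
by rewrite evZr ap mulr0.
Qed.

Lemma ann_prop (p q : 'cV[R]_3) (a c : 'rV[R]_3) : cross p q != 0 ->
  ev a p = 0 -> ev a q = 0 -> ev c p = 0 -> ev c q = 0 ->
  forall x y, ev a x * ev c y = ev a y * ev c x.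
Proof.
move=> n0 ap aq cp cq x y; set N := ev (cross p q)^T (cross p q).
have N0 : N != 0 by apply: contra_neq n0; exact: ev_tr_eq0.
have h (d : 'rV[R]_3) z : ev d p = 0 -> ev d q = 0 ->
    N * ev d z = ev (cross p q)^T z * ev d (cross p q).
  move=> dp dq; have [al [be E]] := cross_lagrange p q z.
  by rewrite -evZr E !evDr !evZr dp dq !mulr0 !add0r.
apply: (mulfI N0); apply: (mulfI N0).
have -> : N * (N * (ev a x * ev c y)) = (N * ev a x) * (N * ev c y) by ring.
have -> : N * (N * (ev a y * ev c x)) = (N * ev a y) * (N * ev c x) by ring.
by rewrite !h//; ring.
Qed.

(** Here the boundary is C^1: a supporting functional at p is positive, up to a sign, wherever the
    differential of the defining function F is, hence proportional to it. *)
Lemma supporting_unique p (b b' : 'rV[R]_3) : bOm p ->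
  (forall x, X x -> ev b x != 0) -> (forall x, X x -> ev b' x != 0) ->
  ev b p = 0 -> ev b' p = 0 -> exists c : R, b' = c *: b.
Proof.
move=> [bp fp] bX b'X pb pb'; case: (HH) => _ [_ _ /(_ _ bp)] + _ _ _.
move=> [V [F [Vo Vp [Fd _] [u Du] VF]]]; have dF := Fd _ Vp.
have [_ cp np] := bp.
have F0 : F p = 0.
  apply/eqP; rewrite eq_le; apply/andP; split.
    by rewrite leNgt; apply/negP => /(VF _ Vp).
  rewrite leNgt; apply/negP => Fn.
  have Fc : {for p, continuous F} by exact: differentiable_continuous.
  have h : nbhs p [set v | V v /\ F v < 0].
    apply: filterI; first exact: open_nbhs_nbhs.
    have n0 : nbhs (F p) [set x : R | x < 0] by apply: open_nbhs_nbhs; split => //; exact: open_lt.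
    exact: (Fc _ n0).
  have [v [Xv [Vv Fv]]] := cp _ h.
  by have := (VF _ Vv).1 Xv; rewrite ltNge (ltW Fv).
(* If the differential is positive on w, a short step from p along w enters X, where c has constant
   sign. *)
have key (c : 'rV[R]_3) : (forall x, X x -> ev c x != 0) -> ev c p = 0 ->
    exists2 s : R, s != 0 & forall w, 0 < 'd F p w -> 0 < s * ev c w.
  move=> cX cp0.
  have [s s0 sO] : exists2 s : R, s != 0 & forall y, Om y -> 0 < s * ev c y.
    case: (convex_sign (domain_convex dX) (a := c)) => [y [Xy _]|h|h]; first exact: cX.
      by exists 1 => [|y Oy]; rewrite ?oner_neq0// mul1r; exact: h.
    by exists (-1) => [|y Oy]; rewrite ?oppr_eq0 ?oner_neq0// mulN1r oppr_gt0; exact: h.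
  exists s => // w dw.
  have dq : (fun h : R => h^-1 *: ((F \o shift p) (h *: w) - F p)) @ 0^' --> 'D_w F p.
    exact: (@diff_derivable _ _ _ F p w dF).
  have dgt : \forall h \near (0 : R)^', 0 < h^-1 *: ((F \o shift p) (h *: w) - F p).
    by apply: (cvgr_gt _ dq); rewrite deriveE.
  have lc : (fun h : R => h *: w + p) @ (0 : R) --> p.
    have {2}-> : p = 0 *: w + p by rewrite scale0r add0r.
    apply: cvgD; last exact: cvg_cst.
    by apply: (@cvgZr_tmp _ _ _ (nbhs (0 : R)) _ id _ w); exact: cvg_id.
  have nV : \forall h \near (0 : R), V (h *: w + p) /\ 0 < ev f (h *: w + p).
    apply: filterI; first by apply: lc; exact: open_nbhs_nbhs.
    have fc : (fun h : R => ev f (h *: w + p)) @ (0 : R) --> ev f p.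
      by apply: (@cvg_ev _ _ _ (nbhs (0 : R)) _ (fun=> f)) => //; exact: cvg_cst.
    by apply: (cvgr_gt _ fc); rewrite fp.
  have [h [h0 [dh [Vh fh]]]] : exists h : R, 0 < h /\
      0 < h^-1 *: ((F \o shift p) (h *: w) - F p) /\ V (h *: w + p) /\ 0 < ev f (h *: w + p).
    have nr : \forall h \near (0 : R)^'+, 0 < h /\
      0 < h^-1 *: ((F \o shift p) (h *: w) - F p) /\ V (h *: w + p) /\ 0 < ev f (h *: w + p).
      have dgt' : \forall h \near (0 : R), h != 0 ->
        0 < h^-1 *: ((F \o shift p) (h *: w) - F p) by exact: dgt.
      rewrite /at_right; apply: filterS2 dgt' nV => h h1 h2 h0; split => //; split => //.
      by apply: h1; rewrite gt_eqF.
    by have [h] := filter_ex nr; exists h.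
  have Fh : 0 < F (h *: w + p).
    by move: dh; rewrite /= F0 subr0 /shift/= pmulr_rgt0// invr_gt0.
  have := sO _ (X_chart ((VF _ Vh).2 Fh)).
  rewrite evZr [ev c (_ + _)]evDr [ev c (h *: w)]evZr cp0 addr0 mulrCA pmulr_rgt0 ?invr_gt0//.
  by rewrite mulrCA pmulr_rgt0.
have [u0 du0] : exists u0, 0 < 'd F p u0.
  rewrite deriveE// in Du; have [h|h|/eqP] := ltgtP 0 ('d F p u); first by exists u.
    by exists (- u); rewrite linearN oppr_gt0.
  by rewrite eq_sym (negPf Du).
have lin (c : 'rV[R]_3) : (forall x, X x -> ev c x != 0) -> ev c p = 0 ->
    ev c u0 != 0 /\ forall v, ev c v = 'd F p v / 'd F p u0 * ev c u0.
  move=> cX cp0; have [s s0 sd] := key c cX cp0; have c0 := sd _ du0.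
  have c0' : ev c u0 != 0 by apply: contraTneq c0 => ->; rewrite mulr0 ltxx.
  split => // v; pose w := v - ('d F p v / 'd F p u0) *: u0.
  have dw : 'd F p w = 0.
    rewrite linearB linearZ/= /GRing.scale/=; field; by rewrite gt_eqF.
  suff : s * ev c w = 0.
    move/eqP; rewrite mulf_eq0 (negPf s0)/= /w evBr evZr subr_eq0 => /eqP //.
  apply/eqP; apply: contrapT => /negP n0.
  (* Adding a multiple of w does not change the differential, but this multiple makes c vanish. *)
  have := sd (u0 - ((s * ev c u0) / (s * ev c w)) *: w).
  rewrite linearB linearZ/= dw scaler0 subr0 => /(_ du0).
  have -> : s * ev c (u0 - (s * ev c u0 / (s * ev c w)) *: w) = 0.
    have cw0 : ev c w != 0 by apply: contraNneq n0 => ->; rewrite mulr0.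
    by rewrite evBr evZr; field; rewrite s0 cw0.
  by rewrite ltxx.
have [b0 bl] := lin b bX pb; have [b'0 b'l] := lin b' b'X pb'.
exists (ev b' u0 / ev b u0); apply/eqP; rewrite -subr_eq0; apply/eqP.
apply: ev_eq0 => v; rewrite evBl evZl b'l (bl v); field.
by rewrite b0 gt_eqF.
Qed.

Lemma attracts_line gs v b p : attracts gs v b -> p != 0 ->
  (forall x, exists c : R, rho x *m p = c *: p) -> ev b p != 0 ->
  exists t : R, v = t *: p.
Proof.
move=> hb p0 fixp bp; apply: prop_of_ker => // a ap.
have h : (fun n => ev a (scaled gs n *m p)) @ U --> ev a (v *m b *m p).
  apply: (@cvg_ev _ _ _ U _ (fun=> a)); first exact: cvg_cst.
  by apply: (@cvg_mulmx _ _ _ _ _ U _ _ (fun=> p)); [exact: (at_lim hb)|exact: cvg_cst].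
have h0 : (fun n => ev a (scaled gs n *m p)) @ U --> (0 : R).
  have -> : (fun n => ev a (scaled gs n *m p)) = fun=> 0; last exact: cvg_cst.
  apply/funext => n; have [c cE] := fixp (gs n).
  by rewrite -scalemxAl cE !evZr ap !mulr0.
have E : ev a (v *m b *m p) = 0 by exact: (lim_unique _ (@norm_hausdorff _ R^o) h h0).
move: E; rewrite rank1_mul evZr => /eqP; by rewrite mulf_eq0 (negPf bp) => /eqP.
Qed.

Hypothesis rho_row : forall b : 'rV[R]_3, b != 0 ->
  ~ forall x, exists c : R, b *m rho x = c *: b.

Lemma at_neq0 (b : 'rV[R]_3) : (forall x, X x -> ev b x != 0) -> b != 0.
Proof.
move=> bX; have [x [Xx _]] := domain_nonempty dX.
by apply: contraNneq (bX _ Xx) => ->; rewrite ev0l.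
Qed.

Lemma bd_neq v : bOm v -> exists2 w, bOm w & w != v.
Proof.
move=> bv; have [v1 [v2 [_ [b1 b2 _ [v12 _ _]]]]] := three_bd.
have [e|n] := eqVneq v1 v; last by exists v1.
by exists v2 => //; rewrite -e eq_sym.
Qed.

(** For a boundary point other than p, the repelling functional b must vanish at p. It is then the
    unique support at p, so its line is preserved, against [rho_row]. *)
Lemma bd_fix (p : 'cV[R]_3) : bOm p -> ~ forall x, exists c : R, rho x *m p = c *: p.
Proof.
move=> bp fixp; have p0 := chart_neq0 bp.2; have [v bv vp] := bd_neq bp.
have [gs [b [hb _]]] := bd_attracting bv.
have pb : ev b p = 0.
  apply/eqP; apply: contrapT => /negP bp0; have [t tE] := attracts_line hb p0 fixp bp0.
  move: vp; rewrite tE; have := bv.2; rewrite tE evZr bp.2 mulr1 => ->.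
  by rewrite scale1r eqxx.
apply: (rho_row (at_neq0 (at_X hb))) => x; apply: (supporting_unique bp (at_X hb)) => //.
  by move=> y Xy; rewrite ev_mul; apply: (at_X hb); exact: rho_X.
by have [c cE] := fixp x; rewrite ev_mul cE evZr pb mulr0.
Qed.

Lemma escapesV gs : escapes gs -> escapes (fun n => (gs n)^-1%g).
Proof. by move=> h x; apply: filterS (h x^-1%g) => n nx e; apply: nx; rewrite -e invgK. Qed.

(* The product of the two rescaled sequences is scalar and tends to 0. *)
Lemma inverse_ker gs v b v' b' : attracts gs v b ->
  attracts (fun n => (gs n)^-1%g) v' b' -> ev b' v = 0.
Proof.
move=> hb hb'; have [y [Xy _]] := domain_nonempty dX.
have h1 : (fun n => scaled (fun n => (gs n)^-1%g) n *m (scaled gs n *m y)) @ U -->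
    v' *m b' *m (v *m b *m y).
  apply: cvg_mulmx; first exact: (at_lim hb').
  by apply: (@cvg_mulmx _ _ _ _ _ U _ _ (fun=> y)); [exact: (at_lim hb)|exact: cvg_cst].
have h2 : (fun n => scaled (fun n => (gs n)^-1%g) n *m (scaled gs n *m y)) @ U --> (0 * 0) *: y.
  have -> : (fun n => scaled (fun n => (gs n)^-1%g) n *m (scaled gs n *m y)) =
      (fun n => (`|rho (gs n)^-1%g|^-1 * `|rho (gs n)|^-1) *: y).
    apply/funext => n; rewrite /scaled -!scalemxAl -scalemxAr mulmxA rhoVK mul1mx scalerA.
    by [].
  apply: (@cvgZ _ _ _ U _ (fun n => `|rho (gs n)^-1%g|^-1 * `|rho (gs n)|^-1) (fun=> y)).
    by apply: cvgM; [exact: (at_0 hb')|exact: (at_0 hb)].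
  exact: cvg_cst.
have E : v' *m b' *m (v *m b *m y) = (0 * 0) *: y by exact: (mx_lim_unique _ h1 h2).
move: E; rewrite !rank1_mul evZr mulr0 scale0r => /eqP.
rewrite scaler_eq0 mulf_eq0 (negPf (at_X hb Xy)) (negPf (chart_neq0 (at_bd hb').2)) orbF.
by move/eqP.
Qed.

(** A fixed point in X would be attracted to the boundary, and [bd_fix] excludes the boundary. A
    fixed point elsewhere would lie on the support line at every boundary point, provided by the
    inverse sequences; already three such lines cannot be concurrent. *)
Lemma no_fixed (p : 'cV[R]_3) : p != 0 -> ~ forall x, exists c : R, rho x *m p = c *: p.
Proof.
move=> p0 fixp; have [[_ XZ] Xo _ _ _ _] := dX.
have nbp : ~ proj_boundary X p.
  move=> /bd_nrm [f0 bp]; apply: (bd_fix bp) => x; have [c cE] := fixp x.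
  by exists c; rewrite -scalemxAr cE !scalerA mulrC.
have nXp : ~ X p.
  move=> Xp; have [v [_ [_ [bv _ _ _]]]] := three_bd.
  have [gs [b [hb _]]] := bd_attracting bv.
  have [t tE] := attracts_line hb p0 fixp (at_X hb Xp).
  apply: (bd_notin bv); split; last exact: bv.2.
  rewrite tE; apply: XZ => //; apply: contraTneq (chart_neq0 bv.2) => t0.
  by rewrite tE t0 scale0r eqxx.
have sup v : bOm v -> exists b : 'rV[R]_3, [/\ ev b v = 0, ev b p = 0 &
    forall u, bOm u -> u != v -> 0 < ev b u].
  move=> bv; have [gs [b [hb ge]]] := bd_attracting bv.
  have [v' [b' hb']] := rank_one (escapesV ge).
  have b'v := inverse_ker hb hb'.
  have b'p : ev b' p = 0.
    apply/eqP; apply: contrapT => /negP bp0; have [t tE] := attracts_line hb' p0 fixp bp0.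
    have v'0 := chart_neq0 (at_bd hb').2.
    have t0 : t != 0 by apply: contraNneq v'0 => t0; rewrite tE t0 scale0r.
    have [[_ cv' _] _] := at_bd hb'.
    apply: nbp; split => //.
    have -> : p = t^-1 *: v' by rewrite tE scalerA mulVf// scale1r.
    by apply: (projective_closure (domain_projective dX)); rewrite ?invr_eq0.
  have mid u : bOm u -> u != v -> Om (seg v u (1 / 2)).
    move=> bu uv; apply: (strict_seg dX (bd_cl bv) (bd_cl bu)); first by rewrite eq_sym.
    by apply/andP; split; lra.
  case: (convex_sign (domain_convex dX) (a := b')) => [y [Xy _]|h|h]; first exact: (at_X hb').
    exists b'; split => // u bu uv; have := h _ (mid _ bu uv).
    by rewrite seg_ev b'v; lra.
  exists (- b'); split; rewrite ?evNl ?b'v ?b'p ?oppr0// => u bu uv; have := h _ (mid _ bu uv).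
  by rewrite seg_ev evNl b'v; lra.
have [v1 [v2 [v3 [b1 b2 b3 [v12 v13 v23]]]]] := three_bd.
have [c1 [c11 c1p c1u]] := sup _ b1; have [c2 [c22 c2p c2u]] := sup _ b2.
have [c3 [c33 c3p c3u]] := sup _ b3.
have cr : cross v1 p != 0.
  apply/eqP => /(cross0_prop (chart_neq0 b1.2)) [t tE].
  have t0 : t != 0 by apply: contraNneq p0 => t0; rewrite tE t0 scale0r.
  have [[_ cv1 _] _] := b1; apply: nbp; split => //.
  by rewrite tE; apply: (projective_closure (domain_projective dX)).
(* c vanishes at p and v1, so it is proportional to c1. But c has opposite signs at v2 and v3, where
   c1 is positive. *)
pose c := ev c2 v1 *: c3 - ev c3 v1 *: c2.
have cv1 : ev c v1 = 0 by rewrite evBl !evZl; ring.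
have cp : ev c p = 0 by rewrite evBl !evZl c2p c3p; ring.
have := ann_prop cr cv1 cp c11 c1p v2 v3.
have p21 : 0 < ev c2 v1 by exact: c2u.
have p31 : 0 < ev c3 v1 by exact: c3u.
have l : 0 < ev c v2 * ev c1 v3.
  rewrite evBl !evZl c22 mulr0 subr0 !mulr_gt0//; [apply: c3u => //|apply: c1u => //].
  by rewrite eq_sym.
have r : 0 < - (ev c v3 * ev c1 v2).
  rewrite evBl !evZl c33 mulr0 sub0r mulNr opprK !mulr_gt0//; [apply: c2u => //|apply: c1u => //].
    by rewrite eq_sym.
  by rewrite eq_sym.
lra.
Qed.

Variable eta : G -> 'M[R]_(3 + 1).
Hypotheses (eta_SAff : forall x, SAff (eta x)) (eta_lin : linear_part eta = rho).
Hypothesis eta_nss : ~ semi_simple eta.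
Local Notation e4 := (@e4 R).

Lemma Q_eta x (w : 'cV[R]_(3 + 1)) : Q (eta x *m w) = rho x *m Q w.
Proof.
case: (eta_SAff x) => _ u0 _; rewrite -eta_lin /linear_part /Q.
by rewrite -{1}[eta x]submxK -{1}[w]vsubmxK mul_block_col u0 mul0mx addr0 col_mxKu.
Qed.

Lemma eta_e4 x : eta x *m e4 = e4.
Proof.
case: (eta_SAff x) => _ u0 d1; rewrite -{1}[eta x]submxK /Defs.e4 mul_block_col u0 d1.
by rewrite !mulmx0 !add0r mul0mx mul1mx.
Qed.

Lemma eta_neq0 x : eta x != 0.
Proof.
apply/eqP => e0; have := ev_e4 (row_mx 0 1%:M : 'rV[R]_(3 + 1)).
rewrite -(eta_e4 x) e0 mul0mx ev0r row_mxKr mxE eqxx => /eqP.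
by rewrite eq_sym oner_eq0.
Qed.

Lemma Q0 (w : 'cV[R]_(3 + 1)) : Q w = 0 -> exists t : R, w = t *: e4.
Proof.
by move=> h; exists (dsubmx w 0 0); rewrite [LHS]e4_decomp h col_mx0 add0r.
Qed.

Lemma same_pt_trans m n (u v w : 'M[R]_(m, n)) : same_pt u v -> same_pt v w -> same_pt u w.
Proof.
move=> [t [t0 ->]] [s [s0 ->]]; exists (s * t); split; last by rewrite scalerA.
by rewrite mulf_neq0.
Qed.

Lemma lp_same n (v w : 'cV[R]_n) : same_pt v w -> line_projector w = line_projector v.
Proof.
move=> [t [t0 ->]]; rewrite /line_projector !linearZ/= -!scalemxAl mxE [_ 0 0]mxE.
rewrite !scalerA; congr (_ *: _); set N := (v^T *m v) 0 0.
have [->|N0] := eqVneq N 0; first by rewrite !mulr0 invr0 mulr0 mul0r.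
by field; rewrite t0 N0.
Qed.

Lemma lp_mul n (v : 'cV[R]_n) (u : 'cV[R]_n) : line_projector v *m u = (ev v^T u / ev v^T v) *: v.
Proof.
rewrite /line_projector -scalemxAl -mulmxA.
have -> : v^T *m u = (ev v^T u)%:M by rewrite [LHS]mx11_scalar.
by rewrite mul_mx_scalar scalerA mulrC.
Qed.

Lemma lp_eq n (v w : 'cV[R]_n) : w != 0 -> line_projector v = line_projector w ->
  exists t : R, w = t *: v.
Proof.
move=> w0 e; have ww : ev w^T w != 0 by apply: contra_neq w0; exact: ev_tr_eq0.
exists (ev v^T w / ev v^T v); rewrite -lp_mul e lp_mul divff// scale1r; by [].
Qed.

Lemma lp_cvg n (A : nat -> 'cV[R]_n) (v : 'cV[R]_n) : v != 0 -> A @ U --> v ->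
  (fun k => line_projector (A k)) @ U --> line_projector v.
Proof.
move=> v0 Av; have At : (fun k => (A k)^T) @ U --> v^T by exact: cvg_trmx.
apply: (@cvgZ _ _ _ U _ (fun k => (((A k)^T *m A k) 0 0)^-1)); last exact: cvg_mulmx.
apply: cvgV; first by apply: contra_neq v0; exact: ev_tr_eq0.
by apply: cvg_coord; exact: cvg_mulmx.
Qed.

(** * A limit map lies over the identity of the boundary *)

Section LimitMap.
Variable xi : 'cV[R]_3 -> 'cV[R]_(3 + 1).
Hypothesis hxi : limit_map eta X xi.
(** Rules out the constant map to [e4]; it holds as soon as xi contributes a point to the chart. *)
Hypothesis nontriv : exists2 v, proj_boundary X v & Q (xi v) != 0.
Local Notation y := (fun v => Q (xi v)).

Lemma xi_neq0 v : bOm v -> xi v != 0.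
Proof. by case: hxi => h _ _ _ _ [bv _]; exact: h. Qed.

Lemma bd_nontriv : exists2 v, bOm v & Q (xi v) != 0.
Proof.
have [v bv yv] := nontriv; have [f0 bv'] := bd_nrm bv; case: hxi => _ h _ _ _.
exists ((ev f v)^-1 *: v) => //; have f1 : (ev f v)^-1 != 0 by rewrite invr_eq0.
by have [t [t0 ->]] := h _ _ f1 bv; rewrite QZ scaler_eq0 negb_or t0.
Qed.

Lemma xi_push x v : bOm v -> same_pt (eta x *m xi v) (xi (push x v)).
Proof.
move=> bv; case: hxi => _ hZ _ hE _.
have h := hE x _ bv.1; rewrite eta_lin in h; apply: same_pt_trans h _.
apply: hZ; last exact: rho_bd bv.1.
by rewrite invr_eq0; exact: (push_bd _ bv).1.
Qed.

Lemma Q_push x v : bOm v -> exists t : R, t != 0 /\ Q (xi (push x v)) = t *: (rho x *m Q (xi v)).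
Proof. by move=> /(xi_push x) [t [t0 ->]]; exists t; rewrite QZ Q_eta. Qed.

Lemma xi_cvg (T : Type) (F : set_system T) (FF : Filter F) (ws : T -> 'cV[R]_3) w :
  bOm w -> (\forall t \near F, bOm (ws t)) -> ws @ F --> w ->
  (fun t => line_projector (xi (ws t))) @ F --> line_projector (xi w).
Proof.
move=> bw bws lw; case: hxi => _ _ /subspace_continuousP /(_ _ bw.1) hC _ _.
move=> B /hC; rewrite /nbhs/= /within/= => nB.
by apply: filterS2 bws (lw _ nB) => t [bt _] h; exact: h.
Qed.

(* Otherwise the span of the Q (xi v) would be an invariant line or plane. *)
Lemma span_Q (c : 'rV[R]_3) : c != 0 -> exists2 w, bOm w & ev c (Q (xi w)) != 0.
Proof.
move=> c0; apply: contrapT => h.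
have cz w : bOm w -> ev c (Q (xi w)) = 0.
  by move=> bw; apply/eqP; apply: contrapT => /negP n; apply: h; exists w.
have cx x w : bOm w -> ev (c *m rho x) (Q (xi w)) = 0.
  move=> bw; have [t [t0 E]] := Q_push x bw; rewrite ev_mul.
  have := cz _ (push_bd x bw).2; rewrite E evZr => /eqP.
  by rewrite mulf_eq0 (negPf t0) => /eqP.
have [x0 nx0] : exists x, ~ exists k : R, c *m rho x = k *: c.
  apply: contrapT => h'; apply: (rho_row c0) => x; apply: contrapT => nx.
  by apply: h'; exists x.
have [v0 b0 y0] := bd_nontriv.
have line q : (exists2 w, bOm w & q = Q (xi w)) -> exists t : R, q = t *: Q (xi v0).
  move=> [w bw ->]; apply: cross0_prop => //; apply/eqP; apply: contrapT => /negP cr.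
  apply: nx0; have [z cz0] : exists z, ev c z != 0.
    apply: contrapT => n; move/eqP: c0; apply; apply: ev_eq0 => z; apply/eqP.
    by apply: contrapT => /negP nz; apply: n; exists z.
  exists (ev (c *m rho x0) z / ev c z); apply/eqP; rewrite -subr_eq0; apply/eqP.
  apply: ev_eq0 => z'; rewrite evBl evZl.
  have := ann_prop cr (cx x0 _ b0) (cx x0 _ bw) (cz _ b0) (cz _ bw) z' z.
  move=> E; apply: (mulIf cz0); rewrite mul0r mulrBl E; field; exact: cz0.
apply: (no_fixed y0) => x; have [t [t0 E]] := Q_push x b0.
have [|s sE] := line (Q (xi (push x v0))).
  by exists (push x v0) => //; exact: (push_bd _ b0).2.
exists (t^-1 * s); rewrite -scalerA -sE E scalerA mulVf// scale1r; by [].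
Qed.

(** Let N be a limit of the normalised eta (gs n), with gs attracting to v. N kills [e4], as the
    norms tend to infinity, and Q o N has values in the line of v. For suitable w, equivariance and
    continuity identify the line of N (xi w) with that of xi v. *)
Lemma Q_xi_line v : bOm v -> exists t : R, Q (xi v) = t *: v.
Proof.
move=> bv; have [gs [b [hb _]]] := bd_attracting bv.
have [N N1 hN] := normalized_lim UU (fun n => eta_neq0 (gs n)).
have Nw (w : 'cV[R]_(3 + 1)) :
    (fun n => (`|eta (gs n)|^-1 *: eta (gs n)) *m w) @ U --> N *m w.
  by apply: (@cvg_mulmx _ _ _ _ _ U _ _ (fun=> w)) => //; exact: cvg_cst.
have rle n : `|rho (gs n)| <= `|eta (gs n)|.
  apply: norm_le_coord => // i j; rewrite -eta_lin /linear_part !mxE; exact: coord_le_norm.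
have ep n : 0 < `|eta (gs n)| by rewrite normr_gt0 eta_neq0.
have rp n : 0 < `|rho (gs n)| by rewrite normr_gt0 rho_neq0.
have [k _ hk] : exists2 k : R, `[0, 1]%classic k &
    (fun n => `|rho (gs n)| / `|eta (gs n)|) @ U --> k.
  apply: (ultra_lim UU); first exact: segment_compact.
  apply: nearW => n; rewrite /= in_itv/= divr_ge0//= ler_pdivrMr// mul1r; exact: rle.
have QN (w : 'cV[R]_(3 + 1)) : Q (N *m w) = (k * ev b (Q w)) *: v.
  have h1 : (fun n => Q ((`|eta (gs n)|^-1 *: eta (gs n)) *m w)) @ U --> Q (N *m w).
    by apply: (@cvg_comp _ _ _ _ (@Q R) _ _ _ (Nw w)); exact: Q_continuous.
  have h2 : (fun n => Q ((`|eta (gs n)|^-1 *: eta (gs n)) *m w)) @ U --> k *: (v *m b *m Q w).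
    have -> : (fun n => Q ((`|eta (gs n)|^-1 *: eta (gs n)) *m w)) =
        (fun n => (`|rho (gs n)| / `|eta (gs n)|) *: (scaled gs n *m Q w)).
      apply/funext => n; rewrite -scalemxAl QZ Q_eta /scaled -scalemxAl scalerA.
      by congr (_ *: _); rewrite mulrAC mulfV ?gt_eqF// mul1r.
    apply: (@cvgZ _ _ _ U _ (fun n => `|rho (gs n)| / `|eta (gs n)|)); first exact: hk.
    by apply: (@cvg_mulmx _ _ _ _ _ U _ _ (fun=> Q w)); [exact: (at_lim hb)|exact: cvg_cst].
  have -> : Q (N *m w) = k *: (v *m b *m Q w) by exact: (mx_lim_unique _ h1 h2).
  by rewrite rank1_mul scalerA.
have Ne4 : N *m e4 = 0.
  have h0 : (fun n => `|eta (gs n)|^-1) @ U --> (0 : R).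
    apply: (@squeeze_cvgr nat U _ R (fun=> 0) (fun n => `|rho (gs n)|^-1)).
    - by apply: nearW => n; rewrite invr_ge0 normr_ge0/= lef_pV2 ?posrE.
    - exact: cvg_cst.
    - exact: (at_0 hb).
  have h2 : (fun n => (`|eta (gs n)|^-1 *: eta (gs n)) *m e4) @ U --> 0 *: e4.
    have -> : (fun n => (`|eta (gs n)|^-1 *: eta (gs n)) *m e4) =
        (fun n => `|eta (gs n)|^-1 *: e4).
      by apply/funext => n; rewrite -scalemxAl eta_e4.
    by apply: (@cvgZ _ _ _ U _ _ (fun=> e4)) => //; exact: cvg_cst.
  have -> : N *m e4 = 0 *: e4 by exact: (mx_lim_unique _ (Nw e4) h2).
  by rewrite scale0r.
pose B := N *m col_mx (1%:M : 'M[R]_3) (0 : 'M[R]_(1, 3)).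
have NE w : N *m w = B *m Q w.
  rewrite {1}[w]e4_decomp mulmxDr -scalemxAr Ne4 scaler0 addr0 /B -mulmxA.
  by rewrite mul_col_mx mul1mx mul0mx.
have [d d0 dN] : exists2 d : 'rV[R]_3, d != 0 & forall w, ev d (Q w) != 0 -> N *m w != 0.
  have B0 : B != 0.
    apply: contra_eq_neq N1 => B0; have -> : N = 0.
      apply/matrixP => i j; have /(congr1 (fun M : 'cV[R]_(3 + 1) => M i 0)) := NE (delta_mx j 0).
      by rewrite B0 mul0mx -colE !mxE.
    by rewrite normr0 eq_sym oner_neq0.
  have [i Bi] : exists i, row i B != 0.
    apply: contrapT => n; move/eqP: B0; apply; apply/row_matrixP => i; rewrite row0.
    by apply/eqP; apply: contrapT => /negP ni; apply: n; exists i.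
  exists (row i B) => // w; apply: contra_neq => Nw0.
  by rewrite /ev -row_mul -NE Nw0 row0 mxE.
(* [span_Q] gives a point where N (xi w) is nonzero; if it is on the repelling line, a nearby
   boundary point is off it and still good, by continuity of the line of xi. *)
have [w [bw bw0 dw]] : exists w, [/\ bOm w, ev b w != 0 & ev d (Q (xi w)) != 0].
  have [w1 b1 d1] := span_Q d0.
  have [z1|n1] := eqVneq (ev b w1) 0; last by exists w1.
  have [ws [wsP wsl]] := bd_dense b1.
  pose h (P : 'M[R]_(3 + 1)) := ev (row_mx d 0) (P *m xi w1).
  have hE w : h (line_projector (xi w)) =
      ev (xi w)^T (xi w1) / ev (xi w)^T (xi w) * ev d (Q (xi w)).
    by rewrite /h lp_mul evZr ev_col.
  have hl : (fun n => h (line_projector (xi (ws n)))) @ U --> h (line_projector (xi w1)).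
    apply: (@cvg_ev _ _ _ U _ (fun=> row_mx d 0)); first exact: cvg_cst.
    apply: (@cvg_mulmx _ _ _ _ _ U _ _ (fun=> xi w1)); last exact: cvg_cst.
    by apply: xi_cvg => //; apply: filterS wsP => n [].
  have h0 : h (line_projector (xi w1)) != 0.
    rewrite hE divff ?mul1r//; apply: contra_neq (xi_neq0 b1); exact: ev_tr_eq0.
  have hn : \forall n \near U, h (line_projector (xi (ws n))) != 0 by exact: (cvgr_neq0 _ hl).
  have [n [[bn nn] hnn]] := filter_ex (filterI wsP hn).
  exists (ws n); split => //.
    by apply/eqP => zn; apply: nn; exact: (support_zero (at_X hb) bn b1 zn z1).
  by apply: contra_neq hnn => dz; rewrite hE dz mulr0.
have l1 : (fun n => line_projector (xi (push (gs n) w))) @ U --> line_projector (xi v).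
  apply: xi_cvg => //; first by apply: nearW => n; exact: (push_bd _ bw).2.
  by apply: (@cvg_attract _ _ _ (fun=> w) w hb) => //; exact: cvg_cst.
have l2 : (fun n => line_projector (xi (push (gs n) w))) @ U --> line_projector (N *m xi w).
  have -> : (fun n => line_projector (xi (push (gs n) w))) =
      (fun n => line_projector ((`|eta (gs n)|^-1 *: eta (gs n)) *m xi w)).
    apply/funext => n; rewrite (lp_same (xi_push (gs n) bw)) -scalemxAl.
    apply/esym/lp_same; exists `|eta (gs n)|^-1; split => //.
    by rewrite invr_eq0 gt_eqF.
  by apply: lp_cvg => //; exact: dN.
have E : line_projector (N *m xi w) = line_projector (xi v) by exact: (mx_lim_unique _ l2 l1).
have [t tE] := lp_eq (xi_neq0 bv) E.
by exists (t * (k * ev b (Q (xi w)))); rewrite tE QZ QN scalerA.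
Qed.

(** By equivariance and [bd_fix], a zero v comes with a second zero v'. One of the two is off any
    given repelling line and is pushed to any boundary point u, so xi u is on the line of [e4],
    against [nontriv]. *)
Lemma Q_xi_neq0 v : bOm v -> Q (xi v) != 0.
Proof.
move=> bv; apply/eqP => v0.
have push0 x w : bOm w -> Q (xi w) = 0 -> Q (xi (push x w)) = 0.
  by move=> bw w0; have [t [_ ->]] := Q_push x bw; rewrite w0 mulmx0 scaler0.
have [v' [bv' v'v v'0]] : exists v', [/\ bOm v', v' <> v & Q (xi v') = 0].
  apply: contrapT => n; apply: (bd_fix bv) => x; have [f0 bp] := push_bd x bv.
  have e : push x v = v.
    by apply: contrapT => ne; apply: n; exists (push x v); split => //; exact: push0.
  by exists (ev f (rho x *m v)); rewrite -{3}e /push scalerA mulfV// scale1r.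
have [u bu /eqP] := bd_nontriv; apply.
have [gs [b [hb _]]] := bd_attracting bu.
have [w [bw w0 bw0]] : exists w, [/\ bOm w, Q (xi w) = 0 & ev b w != 0].
  have [z|z] := eqVneq (ev b v) 0; last by exists v.
  exists v'; split => //; apply/eqP => z'; apply: v'v.
  exact: (support_zero (at_X hb) bv' bv z' z).
have l1 : (fun n => line_projector (xi (push (gs n) w))) @ U --> line_projector (xi u).
  apply: xi_cvg => //; first by apply: nearW => n; exact: (push_bd _ bw).2.
  by apply: (@cvg_attract _ _ _ (fun=> w) w hb) => //; exact: cvg_cst.
have l2 : (fun n => line_projector (xi (push (gs n) w))) @ U --> line_projector e4.
  have -> : (fun n => line_projector (xi (push (gs n) w))) = fun=> line_projector e4.
    apply/funext => n; have bn := (push_bd (gs n) bw).2.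
    have [t tE] := Q0 (push0 (gs n) _ bw w0); apply: lp_same; exists t; split => //.
    by apply: contraNneq (xi_neq0 bn) => t0; rewrite tE t0 scale0r.
  exact: cvg_cst.
have E : line_projector e4 = line_projector (xi u) by exact: (mx_lim_unique _ l2 l1).
by have [t ->] := lp_eq (xi_neq0 bu) E; rewrite QZ Q_e4 scaler0.
Qed.

Definition lift_bd v := (ev f (Q (xi v)))^-1 *: xi v.

Lemma f_Q_xi v : bOm v -> ev f (Q (xi v)) != 0.
Proof.
move=> bv; have [t tE] := Q_xi_line bv; have := Q_xi_neq0 bv; rewrite tE evZr bv.2 mulr1.
by rewrite scaler_eq0 negb_or => /andP[].
Qed.

Lemma Q_lift v : bOm v -> Q (lift_bd v) = v.
Proof.
move=> bv; have := f_Q_xi bv; rewrite /lift_bd QZ; have [t ->] := Q_xi_line bv.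
by rewrite evZr bv.2 mulr1 => t0; rewrite scalerA mulVf// scale1r.
Qed.

(** Continuity is known for lines only. Applying the line projector to one fixed vector and
    normalising by f o Q recovers the lift continuously. *)
Lemma lift_cvg (T : Type) (F : set_system T) (FF : Filter F) (ws : T -> 'cV[R]_3) w :
  bOm w -> (\forall t \near F, bOm (ws t)) -> ws @ F --> w ->
  (fun t => lift_bd (ws t)) @ F --> lift_bd w.
Proof.
move=> bw bws lw; pose q : 'rV[R]_(3 + 1) := row_mx f 0.
pose h (P : 'M[R]_(3 + 1)) := (ev q (P *m q^T))^-1 *: (P *m q^T).
have hE v : bOm v -> lift_bd v = h (line_projector (xi v)).
  move=> bv; rewrite /h lp_mul evZr /q ev_col -/q /lift_bd scalerA; congr (_ *: _).
  have f0 := f_Q_xi bv; have -> : ev (xi v)^T q^T = ev f (Q (xi v)).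
    by rewrite ev_trC trmxK /q ev_col.
  have x0 : ev (xi v)^T (xi v) != 0 by apply: contra_neq (xi_neq0 bv); exact: ev_tr_eq0.
  by field; rewrite f0 x0.
rewrite hE//; apply: (@cvg_near_eq _ _ F _ (fun t => h (line_projector (xi (ws t))))).
  by apply: filterS bws => t bt; rewrite hE.
have lP := xi_cvg FF bw bws lw.
have l1 : (fun t => line_projector (xi (ws t)) *m q^T) @ F --> line_projector (xi w) *m q^T.
  by apply: (@cvg_mulmx _ _ _ _ _ F _ _ (fun=> q^T)) => //; exact: cvg_cst.
apply: (@cvgZ _ _ _ F _ (fun t => (ev q (line_projector (xi (ws t)) *m q^T))^-1)) => //.
apply: cvgV; last by apply: (@cvg_ev _ _ _ F _ (fun=> q)) => //; exact: cvg_cst.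
rewrite lp_mul evZr /q ev_col mulf_neq0 ?f_Q_xi// mulf_neq0 ?invr_eq0//.
  by rewrite ev_trC trmxK ev_col f_Q_xi.
by apply: contra_neq (xi_neq0 bw); exact: ev_tr_eq0.
Qed.

Lemma lift_eta x v : bOm v -> eta x *m lift_bd v = ev f (rho x *m v) *: lift_bd (push x v).
Proof.
move=> bv; have [t [t0 E]] := xi_push x bv; have f0 := f_Q_xi bv.
have bp := (push_bd x bv).2; have fp := f_Q_xi bp.
have h : ev f (Q (xi (push x v))) = t * (ev f (Q (xi v)) * ev f (rho x *m v)).
  have fQ : Q (xi v) = ev f (Q (xi v)) *: v.
    by rewrite -{3}(Q_lift bv) /lift_bd QZ scalerA divff// scale1r.
  by rewrite E QZ evZr Q_eta {1}fQ -scalemxAr evZr.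
rewrite /lift_bd h E -scalemxAr !scalerA; congr (_ *: _).
have f1 : ev f (rho x *m v) != 0 by exact: (push_bd x bv).1.
by field; rewrite t0 f0 f1.
Qed.

End LimitMap.

(** Two lifts of w differ by a multiple of [e4], which eta fixes, whereas eta (gs k) stretches the
    lifts by a factor tending to infinity in absolute value. After rescaling, the difference
    disappears in the limit at v. *)
Lemma lift_unique xi xi' : limit_map eta X xi -> limit_map eta X xi' ->
  (exists2 v, proj_boundary X v & Q (xi v) != 0) ->
  (exists2 v, proj_boundary X v & Q (xi' v) != 0) ->
  forall v, bOm v -> lift_bd xi v = lift_bd xi' v.
Proof.
move=> h h' n n' v bv; have [gs [b [hb _]]] := bd_attracting bv.
have [w bw bw0] := bd_other (at_neq0 (at_X hb)).
have [t tE] : exists t : R, lift_bd xi w - lift_bd xi' w = t *: e4.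
  by apply: Q0; rewrite /Q linearB/= -!/(Q _) !Q_lift// subrr.
pose ps k := push (gs k) w.
have bps k : bOm (ps k) by exact: (push_bd _ bw).2.
have psl : ps @ U --> v by apply: (@cvg_attract _ _ _ (fun=> w) w hb) => //; exact: cvg_cst.
have E k : (`|rho (gs k)|^-1 * t) *: e4 =
    ev f (scaled gs k *m w) *: (lift_bd xi (ps k) - lift_bd xi' (ps k)).
  rewrite -scalemxAl evZr -!scalerA; congr (_ *: _).
  by rewrite scalerBr -!lift_eta// -mulmxBr tE -scalemxAr eta_e4.
have l1 : (fun k => (`|rho (gs k)|^-1 * t) *: e4) @ U --> (0 * t) *: e4.
  apply: (@cvgZ _ _ _ U _ (fun k => `|rho (gs k)|^-1 * t) (fun=> e4)).
    by apply: (@cvgM _ _ U _ _ (fun=> t)); [exact: (at_0 hb)|exact: cvg_cst].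
  exact: cvg_cst.
have l2 : (fun k => (`|rho (gs k)|^-1 * t) *: e4) @ U -->
    ev f (v *m b *m w) *: (lift_bd xi v - lift_bd xi' v).
  rewrite (funext E); apply: (@cvgZ _ _ _ U _ (fun k => ev f (scaled gs k *m w))).
    apply: (@cvg_ev _ _ _ U _ (fun=> f)); first exact: cvg_cst.
    by apply: (@cvg_mulmx _ _ _ _ _ U _ _ (fun=> w)); [exact: (at_lim hb)|exact: cvg_cst].
  by apply: cvgB; apply: lift_cvg => //; exact: nearW.
have /eqP : ev f (v *m b *m w) *: (lift_bd xi v - lift_bd xi' v) = (0 * t) *: e4.
  exact: (mx_lim_unique _ l2 l1).
rewrite rank1_mul evZr bv.2 mulr1 mul0r scale0r.
by rewrite scaler_eq0 (negPf bw0) subr_eq0 => /eqP.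
Qed.

Lemma Hitchin_limit_graph : (limit_curve eta X `&` chart4 f) !=set0 ->
  limit_graph X f (limit_curve eta X `&` chart4 f).
Proof.
have point xi u w : limit_map eta X xi -> proj_boundary X u -> same_pt (xi u) w ->
    chart4 f w -> [/\ exists2 v, proj_boundary X v & Q (xi v) != 0,
      bOm ((ev f u)^-1 *: u) & w = lift_bd xi ((ev f u)^-1 *: u)].
  move=> hxi bu [t [t0 wE]] fw.
  have n : exists2 v, proj_boundary X v & Q (xi v) != 0.
    exists u => //; apply: contra_eq_neq fw => Q0'.
    by rewrite wE QZ Q0' scaler0 ev0r eq_sym oner_neq0.
  have [f0 bu'] := bd_nrm bu; split => //.
  have f1 : (ev f u)^-1 != 0 by rewrite invr_eq0.
  case: (hxi) => _ hZ _ _ _; have [s [s0 sE]] := hZ _ _ f1 bu.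
  move: fw; rewrite wE /chart4/= QZ evZr => fw.
  have fx : ev f (Q (xi u)) != 0 by apply: contra_eq_neq fw => ->; rewrite mulr0 eq_sym oner_neq0.
  rewrite /lift_bd sE QZ evZr scalerA; congr (_ *: _).
  by apply: (mulIf fx); rewrite fw; field; rewrite fx s0.
move=> [w0 [[xi [u0 [hxi bu0 s0]]] c0]].
have [n _ _] := point _ _ _ hxi bu0 s0 c0.
have LamE : limit_curve eta X `&` chart4 f = lift_bd xi @` bOm.
  apply/seteqP; split => [w [[xi' [u [hxi' bu su]]] cw]|_ [v bv <-]].
    have [n' bu' ->] := point _ _ _ hxi' bu su cw.
    by exists ((ev f u)^-1 *: u) => //; exact: lift_unique.
  split; last by rewrite /chart4/= Q_lift// bv.2.
  exists xi, v; split => //; first exact: bv.1.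
  by exists (ev f (Q (xi v)))^-1; rewrite invr_eq0 f_Q_xi.
split; rewrite LamE.
- apply: continuous_compact; last exact: bd_compact.
  apply/subspace_continuousP => v bv; apply: (@lift_cvg xi hxi n _ _ _ id) => //.
    by apply: withinT.
  exact: cvg_within.
- by move=> _ [v bv <-]; rewrite Q_lift.
- by move=> _ _ [v bv <-] [v' bv' <-]; rewrite !Q_lift// => ->.
- by move=> v bv; exists (lift_bd xi v); [exists v|rewrite Q_lift].
(* A functional a vanishing on Lam with nonzero value on [e4] is invariant: a o eta x - a descends
   to R^3 and vanishes on the boundary of Om, hence everywhere. So eta would preserve the kernel of
   a. *)
- move=> a az; apply/eqP; apply: contrapT => /negP a4; apply: eta_nss; exists a; split.
    by apply: contraNneq a4 => ->; rewrite ev0l.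
  move=> x; exists 1; rewrite scale1r; apply/eqP; rewrite -subr_eq0; apply/eqP.
  have d4 : ev (a *m eta x - a) e4 = 0 by rewrite evBl ev_mul eta_e4 subrr.
  rewrite (ev_e4_0 d4); suff -> : lsubmx (a *m eta x - a) = 0 by rewrite row_mx0.
  apply/eqP; apply: contrapT => /negP l0; have [v bv /eqP] := bd_other l0; apply.
  rewrite -[v](Q_lift hxi n bv) ev_lsub// evBl ev_mul (lift_eta hxi n x bv) evZr.
  have az' u : bOm u -> ev a (lift_bd xi u) = 0 by move=> bu; apply: az; exists u.
  by rewrite (az' _ bv) (az' _ (push_bd x bv).2) mulr0 subr0.
Qed.

End Dynamics.

(** * The two conclusions for transverse arcs *)

Section Arcs.
Context {R : realType} {G : groupType}.
Local Notation e4 := (@e4 R).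
Variables (eta : G -> 'M[R]_(3 + 1)) (X : set 'cV[R]_3) (f : 'rV[R]_3).
Local Notation Om := (in_chart f X).
Local Notation Lam := (limit_curve eta X `&` chart4 f).
Hypothesis (dX : convex_domain X f) (gL : limit_graph X f Lam).
Variables (e : R).
Hypothesis (e1 : e = 1 \/ e = -1).
Local Notation D := (sheet X f Lam e).

Lemma lifted_distance_refl (rho : G -> 'M[R]_3) (dS : 'cV[R]_3 -> 'cV[R]_3 -> R) x :
  lifted_hyperbolic_distance rho X dS -> X x -> dS x x = 0.
Proof.
move=> [dev [sec [_ _ _ h]]] Xx; rewrite h// /half_plane_dist !subrr expr0n/= addr0 mul0r addr0.
by rewrite /acosh expr1n subrr sqrtr0 addr0 ln1.
Qed.

Lemma arc_diam_bounds (rho : G -> 'M[R]_3) (dS : 'cV[R]_3 -> 'cV[R]_3 -> R) (k : R -> 'cV[R]_3) M :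
  lifted_hyperbolic_distance rho X dS -> X (k 0) ->
  (forall s t, 0 <= s <= 1 -> 0 <= t <= 1 -> dS (k s) (k t) <= M) ->
  [/\ 0 <= arc_diam dS k, arc_diam dS k <= M &
      forall s t, 0 <= s <= 1 -> 0 <= t <= 1 -> dS (k s) (k t) <= arc_diam dS k].
Proof.
move=> hd X0 kM; have h0 : 0 <= (0 : R) <= 1 by rewrite lexx ler01.
have ub s t : 0 <= s <= 1 -> 0 <= t <= 1 -> dS (k s) (k t) <= arc_diam dS k.
  move=> s01 t01; apply: ub_le_sup; last by exists s, t.
  by exists M => _ [s' [t' [? ? ->]]]; exact: kM.
split => //; first by rewrite -(lifted_distance_refl hd X0) ub.
apply: ge_sup; first by exists (dS (k 0) (k 0)), 0, 0.
by move=> _ [s' [t' [? ? ->]]]; exact: kM.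
Qed.

(** [cross_estimate] at x = k 0 for e psi(k) and phi, the latter with the sign making it positive at
    k 0: each is at most 0 somewhere on k, hence O(diameter) at k 0. *)
Lemma direction_estimate (rho : G -> 'M[R]_3) (dS : 'cV[R]_3 -> 'cV[R]_3 -> R)
    (dP : 'rV[R]_3 -> 'rV[R]_3 -> R) K :
  lifted_hyperbolic_distance rho X dS -> riemannian_distance dP ->
  compact K -> K `<=` Om ->
  exists C : R, forall (k : R -> 'cV[R]_3) L phi,
    transverse_arc eta X f D k -> (forall t, 0 <= t <= 1 -> K (k t)) ->
    leaf eta X f D L -> crosses k L -> dual_point L phi ->
    cocycle eta X f D k != 0 ->
    dP (cocycle eta X f D k) phi <= C * arc_diam dS k `^ 2^-1.
Proof.
move=> hd hP Kc KO.
have [C1 C10 est] := cross_estimate dX gL e1 Kc KO.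
have [C2 C20 rie] := riemannian_bound hP.
have [C3 [M [C30 M0 hyp]]] := hyperbolic_bounds dX hd Kc KO.
exists (C2 * C1 * (3 * C3) * Num.sqrt M) => k L phi [kO _ nl0 _ _] kK lL [t0 t01 Lt] dL psi0.
have h0 : 0 <= (0 : R) <= 1 by rewrite lexx ler01.
have h1 : 0 <= (1 : R) <= 1 by rewrite lexx ler01.
have Ok0 : Om (k 0) by exact: kO.
have Ok1 : Om (k 1) by exact: kO.
have [dl0 dlM dlk] : [/\ 0 <= arc_diam dS k, arc_diam dS k <= M &
    forall s t, 0 <= s <= 1 -> 0 <= t <= 1 -> dS (k s) (k t) <= arc_diam dS k].
  by apply: (arc_diam_bounds hd Ok0.1) => s t hs ht; apply: (hyp _ _ _ _).2; exact: kK.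
set dl := arc_diam dS k in dl0 dlM dlk *.
(* 3 is the dimension factor of [ev_bound]; C3 dl bounds distances from k 0 in the chart. *)
pose d : R := 3 * C3 * dl.
have d0 : 0 <= d by rewrite !mulr_ge0.
have close (a : 'rV[R]_3) t : 0 <= t <= 1 -> ev a (k t) <= 0 -> ev a (k 0) <= d * `|a|.
  move=> ht at0; apply: le_trans (_ : ev a (k 0 - k t) <= _); first by rewrite evBr; lra.
  apply: le_trans (ler_norm _) (le_trans (ev_bound _ _) _).
  have [n1 _] := hyp _ _ (kK _ h0) (kK _ ht).
  have n2 : `|k 0 - k t| <= C3 * dl by apply: le_trans n1 _; rewrite ler_wpM2l// dlk.
  have -> : d * `|a| = 3 * `|a| * (C3 * dl) by rewrite /d; ring.
  by rewrite ler_wpM2l// mulr_ge0// normr_ge0.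
have [s0L s04 s0q] := alphaP dX gL e1 Ok0; have [s1L s14 s1q] := alphaP dX gL e1 Ok1.
set s0 := e *: alpha eta X f D (k 0) in s0L s04 s0q.
set s1 := e *: alpha eta X f D (k 1) in s1L s14 s1q.
set psi := cocycle eta X f D k in psi0 *.
have psE w : ev (e *: psi) (Q w) = ev s1 w - ev s0 w.
  by rewrite evZl cocycle_ev// mulrBr /s1 /s0 !evZl.
have [[Hq Oq _] Qq] := qplusP dX gL e1 Ok1.
have psd : ev (e *: psi) (k 0) <= d * `|e *: psi|.
  apply: (close _ 1) => //; rewrite -Qq psE s1q sub0r oppr_le0; exact: (hull_ge0 s0L).
have psc w : Lam w -> ev s0 w = 0 -> 0 <= ev (e *: psi) (Q w).
  by move=> Lw w0; rewrite psE w0 subr0; exact: s1L.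
have [LE _] := leaf_dual dX gL e1 lL dL.
have p0 : ev phi (k 0) != 0.
  by apply/eqP => p0; apply: nl0; exists L => //; rewrite LE.
have [s [s1' sp]] : exists s : R, (s = 1 \/ s = -1) /\ 0 < ev (s *: phi) (k 0).
  have [h|h|/eqP] := ltgtP 0 (ev phi (k 0)).
  - by exists 1; split; [left|rewrite scale1r].
  - by exists (-1); split; [right|rewrite evZl mulN1r oppr_gt0].
  - by rewrite eq_sym (negPf p0).
have sn : s != 0 by case: s1' => ->; rewrite ?oppr_eq0 oner_neq0.
have dL' : dual_point L (s *: phi).
  case: dL => phi0 phiL; split; first by rewrite scaler_eq0 negb_or sn.
  by move=> v /phiL; rewrite evZl => ->; rewrite mulr0.
have phd : ev (s *: phi) (k 0) <= d * `|s *: phi|.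
  by apply: (close _ t0) => //; rewrite dL'.2.
have phc w : Lam w -> ev s0 w = 0 -> 0 <= ev (s *: phi) (Q w).
  exact: (leaf_side dX gL e1 lL dL' Ok0 sp).
have cr := est (k 0) s0 _ _ d (kK _ h0) (And3 s0L s04 s0q) d0 psc phc psd phd.
have n1 (c : R) n (a : 'rV[R]_n) : c = 1 \/ c = -1 -> `|c *: a| = `|a|.
  by case=> ->; rewrite normrZ ?normrN normr1 mul1r.
have nc (c : R) (u : 'cV[R]_3) : c = 1 \/ c = -1 -> `|c *: u| = `|u|.
  by case=> ->; rewrite normrZ ?normrN normr1 mul1r.
rewrite !linearZ/= crossZl crossZr !nc ?n1// in cr.
have pp : 0 < `|psi| * `|phi| by rewrite mulr_gt0 ?normr_gt0//; case: dL.
apply: le_trans (rie _ _ psi0 dL.1) _.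
apply: le_trans (_ : C2 * (C1 * d) <= _).
  by rewrite ler_wpM2l// ler_pdivrMr// mulrA.
rewrite powR12_sqrt// /d.
(* The bound M on diameters of arcs in K trades the linear estimate for the exponent 1/2. *)
have dE : dl <= Num.sqrt M * Num.sqrt dl.
  rewrite -{1}(sqr_sqrtr dl0) expr2 ler_wpM2r ?sqrtr_ge0//; exact: ler_wsqrtr.
have -> : C2 * (C1 * (3 * C3 * dl)) = C2 * C1 * (3 * C3) * dl by ring.
by rewrite -[leRHS]mulrA ler_wpM2l// !mulr_ge0.
Qed.

Lemma cocycle_cone (k : R -> 'cV[R]_3) :
  transverse_arc eta X f D k -> crosses_leaves_once eta X f D k ->
  exists2 E : set 'rV[R]_3, proper_convex_cone E &
    forall s t : R, 0 <= s -> s < t -> t <= 1 ->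
      ~ lamination eta X f D (k s) -> ~ lamination eta X f D (k t) ->
      E (cocycle eta X f D (subarc k s t)).
Proof.
move=> tr once; have [kO _ _ nl1 _] := tr.
have O1 : Om (k 1) by apply: kO; rewrite ler01 lexx.
have supp1 := alphaP dX gL e1 O1; set a1 := e *: alpha eta X f D (k 1) in supp1.
have [a1L a14 a1q] := supp1; have [[Hq Oq _] Qq] := qplusP dX gL e1 O1.
pose E := [set phi : 'rV[R]_3 | forall w, Lam w -> ev a1 w = 0 -> ev phi (e *: Q w) <= 0].
have Ec : closed E.
  move=> p clp w Lw w0.
  have Ac : closed [set phi : 'rV[R]_3 | ev phi (e *: Q w) <= 0].
    apply: (@preimage_closed _ _ (fun phi : 'rV[R]_3 => ev phi (e *: Q w)) [set x : R | x <= 0]).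
      by move=> ? _; exact: evl_continuous.
    exact: closed_le.
  apply: Ac => B pB; have [z [Ez Bz]] := clp B pB.
  by exists z; split => //; exact: Ez.
exists E; first split.
- apply/convexP => x y s Ex Ey /andP[s0 s1] w Lw w0; rewrite /seg evDl !evZl.
  by have := Ex _ Lw w0; have := Ey _ Lw w0; nra.
- move=> t v t0 Ev w Lw w0; rewrite evZl; exact: mulr_ge0_le0 (ltW t0) (Ev _ Lw w0).
- move=> u v v0 uv.
  have vw w : Lam w -> ev a1 w = 0 -> ev v (Q w) = 0.
    move=> Lw w0; have h t : ev u (e *: Q w) + t * ev v (e *: Q w) <= 0.
      by have := Ec _ (uv t) w Lw w0; rewrite evDl evZl.
    have ve : ev v (e *: Q w) = 0.
      apply/eqP; apply: contrapT => /negP n.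
      (* With this t the value would be 1. *)
      have := h ((1 - ev u (e *: Q w)) / ev v (e *: Q w)).
      by rewrite divfK//; lra.
    by move: ve; rewrite evZr; case: e1 => ->; rewrite ?mul1r ?mulN1r // => /eqP; rewrite oppr_eq0 => /eqP.
  have vk : ev v (k 1) = 0.
    rewrite -Qq; apply/eqP; rewrite eq_le; apply/andP; split.
      rewrite -oppr_ge0 -evNl; apply: (contact_ge0 a1L) => // w Lw w0.
      by rewrite evNl vw// oppr0.
    by apply: (contact_ge0 a1L) => // w Lw w0; rewrite vw.
  have vq : ev v (Q (qplus D (k 1))) = 0 by rewrite Qq.
  have vge w : Lam w -> ev a1 w = 0 -> 0 <= ev v (Q w) by move=> Lw w0; rewrite vw.
  have [lL _] := leafI dX gL a1L a14 Hq Oq a1q vge v0 vq.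
  by apply: nl1; exists [set x | Om x /\ ev v x = 0].
move=> s t s0 st t1 nls nlt w Lw w0.
have s01 : 0 <= s <= 1 by apply/andP; split; lra.
have t01 : 0 <= t <= 1 by apply/andP; split; lra.
have k0E : subarc k s t 0 = k s by rewrite /subarc mul0r addr0.
have k1E : subarc k s t 1 = k t by rewrite /subarc mul1r addrC subrK.
have Os := kO _ s01; have Ot := kO _ t01.
rewrite evZr cocycle_ev// ?k0E ?k1E// mulrBr -!evZl subr_le0.
exact: (contact_monotone dX gL e1 tr once s0 st t1 nlt (alphaP dX gL e1 Os) (alphaP dX gL e1 Ot) supp1 Lw w0).
Qed.

End Arcs.

Theorem proposition3p23 (R : realType)
    (g : nat) (S : topologicalType) (s0 : S)
    (G : groupType) (cls : (R -> S) -> G)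
    (rho : G -> 'M[R]_3) (eta : G -> 'M[R]_(3 + 1))
    (X : set 'cV[R]_3) (f : 'rV[R]_3) (D : set 'cV[R]_(3 + 1))
    (dS : 'cV[R]_3 -> 'cV[R]_3 -> R) (dP : 'rV[R]_3 -> 'rV[R]_3 -> R)
    (g_ge2 : (2 <= g)%N)
    (S_surface : @closed_orientable_surface R g S)
    (G_pi1 : fundamental_group s0 cls)
    (rho_Hitchin : Hitchin S rho X)
    (eta_repr : is_representation eta)
    (eta_SAff : forall x, SAff (eta x))
    (eta_linear_part : linear_part eta = rho)
    (eta_non_semi_simple : ~ semi_simple eta)
    (f_chart : chart_of X f)
    (D_disk : Xi_boundary_disk eta X f D)
    (dS_hyperbolic : lifted_hyperbolic_distance rho X dS)
    (dP_riemannian : riemannian_distance dP) :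
  (exists2 a : R, 0 < a < 1 &
    forall K : set 'cV[R]_3, compact K -> K `<=` in_chart f X ->
      exists C : R, forall (k : R -> 'cV[R]_3) L phi,
        transverse_arc eta X f D k ->
        (forall t, 0 <= t <= 1 -> K (k t)) ->
        leaf eta X f D L -> crosses k L -> dual_point L phi ->
        cocycle eta X f D k != 0 ->
        dP (cocycle eta X f D k) phi <= C * arc_diam dS k `^ a) /\
  (forall k : R -> 'cV[R]_3,
    transverse_arc eta X f D k -> crosses_leaves_once eta X f D k ->
    (forall L, leaf eta X f D L -> crosses k L -> cocycle eta X f D k != 0) /\
    exists2 E : set 'rV[R]_3, proper_convex_cone E &
      forall s t : R, 0 <= s -> s < t -> t <= 1 ->
        ~ lamination eta X f D (k s) -> ~ lamination eta X f D (k t) ->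
        E (cocycle eta X f D (subarc k s t))).
Proof.
have lin : linear_part eta = rho := eta_linear_part.
have [etaI etaM] := eta_repr.
have rhoE x : rho x = ulsubmx (eta x) by rewrite -lin.
have rho1 : rho 1%g = 1%:M.
  by rewrite rhoE etaI scalar_mx_block block_mxKul.
have rhoM x y : rho (x * y)%g = rho x *m rho y.
  rewrite !rhoE etaM; case: (eta_SAff x) => _ u0 _.
  by rewrite -{1}[eta x]submxK -{1}[eta y]submxK mulmx_block block_mxKul u0 mul0mx addr0.
have rho_det x : \det (rho x) = 1 by rewrite rhoE; case: (eta_SAff x).
(* Extended by 0 on [e4], an invariant line of functionals for rho is one for eta, that is, an
   invariant hyperplane. *)
have rho_row (b : 'rV[R]_3) : b != 0 -> ~ forall x, exists c : R, b *m rho x = c *: b.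
  move=> b0 bx; apply: eta_non_semi_simple; exists (row_mx b 0); split.
    by apply: contraNneq b0 => h; rewrite -(row_mxKl b (0 : 'M[R]_1)) h linear0.
  move=> x; have [c cE] := bx x; exists c; case: (eta_SAff x) => _ u0 _.
  rewrite -{1}[eta x]submxK mul_row_block u0 mulmx0 !mul0mx !addr0 -rhoE cE.
  by rewrite scale_row_mx scaler0.
have dX := Hitchin_domain rho_Hitchin f_chart.
have [U [UU Uoo]] := ultraFilterLemma (F := \oo) _.
(* The existence of a limit map meeting the chart comes from the disk: without it the hull, and
   hence [Xi_boundary], would be empty. *)
have Lam0 : (limit_curve eta X `&` chart4 f) !=set0.
  apply: contrapT => n; have [y [[cl _] _] _] := D_disk.
  have [z [[Hz _] _]] := cl setT filterT; suff : set0 z by [].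
  apply: hull_min Hz => // w Lw; by case: n; exists w.
have gL := Hitchin_limit_graph rho1 rhoM rho_det S_surface rho_Hitchin f_chart UU Uoo
  rho_row eta_SAff lin eta_non_semi_simple Lam0.
have [e e1 DE] := disk_sheet dX gL D_disk; subst D.
split.
  exists 2^-1 => [|K Kc KO]; first by apply/andP; split; lra.
  exact: (direction_estimate dX gL e1 dS_hyperbolic dP_riemannian Kc KO).
move=> k tr once; split; last exact: cocycle_cone.
by move=> L lL cr; exact: (cocycle_neq0 dX gL e1 tr once lL cr).
Qed.
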